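(* Let $G$ be a group acting freely, cellularly, and cocompactly on a connected CAT($0$) cube complex $X$, and let $V$ be the set of vertices of $X$. If $X/G$ is Eulerian of dimension $n$, then for any $x,y\in V/G$, the multivariate growth series $\mathcal{G}_{x,y}(\mathbf{t})$ (regarded as a rational function) satisfies $$\mathcal{G}_{x,y}(\mathbf{t}^{-1})=(-1)^n\,\mathcal{G}_{x,y}(\mathbf{t}).$$
   Context: A cube complex is a piecewise-Euclidean metric cell complex obtained by gluing Euclidean cubes together via isometries along their faces. It is CAT($0$) if it is simply connected and the link of every vertex is a flag simplicial complex (every set of pairwise adjacent vertices spans a simplex). $V/G$ is the set of $G$-orbits of vertices of $X$, i.e. the vertex set of $X/G$. Eulerian: let $K$ be a cell complex such that the link $\mathrm{Lk}(\sigma)$ of every nonempty cell $\sigma$ is a simplicial complex. $K$ is Eulerian of dimension $n$ if every maximal cell is $n$-dimensional and for every nonempty cell $\sigma$ of $K$, $\chi(\mathrm{Lk}(\sigma))=1+(-1)^{\dim \mathrm{Lk}(\sigma)}$ (the empty link has dimension $-1$ and Euler characteristic $0$). Links in $X/G$ are identified with links of lifts in $X$ (the action is free). Hyperplanes: two (unoriented) edges $e,e'$ of $X$ are equivalent if there are edges $e=e_1,\dots,e_m=e'$ and cubes $C_1,\dots,C_{m-1}$ such that $e_i$ and $e_{i+1}$ are parallel edges of $C_i$. The set of equivalence classes is denoted $\mathcal{H}$; its elements are identified with hyperplanes of $X$, and an edge crosses the hyperplane given by its class. $\mathcal{H}/G$ is the (finite) set of $G$-orbits of hyperplanes, and $\mathbf{t}=(t_h)_{h\in\mathcal{H}/G}$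 are commuting indeterminates. Groupoid and growth series: for $x,y\in V/G$, $\mathcal{G}_{x,y}$ is the set of homotopy classes (rel endpoints) of paths in $X/G$ from $x$ to $y$. Given $[\gamma]\in\mathcal{G}_{x,y}$, choose a representative edge path in the $1$-skeleton of $X/G$ using as few edges as possible, and put $\tau([\gamma])=\prod_{h\in\mathcal{H}/G}t_h^{m_h}$, where $m_h$ is the number of edges of this path (lifted to $X$) that cross a hyperplane in the orbit $h$; this does not depend on the choice of minimal representative. The multivariate growth series is $\mathcal{G}_{x,y}(\mathbf{t})=\sum_{[\gamma]\in\mathcal{G}_{x,y}}\tau([\gamma])$. It is the power series expansion of a rational function in $\mathbf{t}$, and $\mathcal{G}_{x,y}(\mathbf{t}^{-1})$ denotes the rational function obtained by substituting $t_h^{-1}$ for each $t_h$. *)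

(* Defs.v *)
From HB Require Import structures.
From Stdlib Require Import Relation_Operators.
From mathcomp Require Import all_boot all_order all_algebra fraction finmap ring.
From mathcomp Require Import mpoly.
From mathcomp Require Import all_classical all_reals topology normedtype.

Set Implicit Arguments.
Unset Strict Implicit.
Unset Printing Implicit Defensive.

Import Order.TTheory GRing.Theory Num.Theory.
Import numFieldTopology.Exports.

Local Open Scope classical_set_scope.
Local Open Scope quotient_scope.

Section GeneratedQuotient.
Variables (T : choiceType) (r : T -> T -> Prop).

Definition gen_equiv (x y : T) : bool := `[< clos_refl_sym_trans T r x y >].

Lemma gen_equiv_refl : reflexive gen_equiv.
Proof. by move=> x; apply/asboolP; exact: rst_refl. Qed.

Lemma gen_equiv_sym : ssrbool.symmetric gen_equiv.
Proof. by move=> x y; apply: asbool_equiv_eq; split; exact: rst_sym. Qed.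

Lemma gen_equiv_trans : transitive gen_equiv.
Proof.
by move=> y x z /asboolP xy /asboolP yz; apply/asboolP; exact: rst_trans xy yz.
Qed.

Canonical gen_equiv_equiv :=
  EquivRel gen_equiv gen_equiv_refl gen_equiv_sym gen_equiv_trans.

Definition gquot := {eq_quot gen_equiv}.

HB.instance Definition _ := Choice.on gquot.

Definition gclass (x : T) : gquot := \pi_gquot x.

Lemma gclassP (x y : T) :
  gclass x = gclass y <-> clos_refl_sym_trans T r x y.
Proof.
by split=> [/eqmodP/asboolP|xy] //; apply/eqmodP; exact/asboolP.
Qed.

End GeneratedQuotient.

(* An isometric embedding of [0,1]^m onto a face of [0,1]^n is determined by the
   vertex [fcorner] of [0,1]^n to which the origin is sent and by the direction
   [fdir i] of the image of the i-th coordinate axis.  For m = n these are the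
   symmetries of the n-cube. *)
Record faceMap (m n : nat) := FaceMap {
  fdir : {ffun 'I_m -> 'I_n};
  fcorner : {ffun 'I_n -> bool};
  fdir_inj : injectiveb fdir }.

Section FaceMaps.

Definition fcoord m n (f : faceMap m n) (j : 'I_n) : option 'I_m :=
  [pick i | fdir f i == j].

Definition face_vertex m n (f : faceMap m n) (a : {ffun 'I_m -> bool}) :
    {ffun 'I_n -> bool} :=
  [ffun j => fcorner f j (+) (if fcoord f j is Some i then a i else false)].

Definition face_point (R : realType) m n (f : faceMap m n) (p : 'rV[R]_m) :
    'rV[R]_n :=
  \row_j if fcoord f j is Some i
         then (if fcorner f j then 1 - p ord0 i else p ord0 i)%R
         else (fcorner f j)%:R%R.

Lemma faceMap_eq m n (f g : faceMap m n) :
  fdir f = fdir g -> fcorner f = fcorner g -> f = g.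
Proof.
case: f g => [d c i] [d' c' i'] /= ed ec; rewrite -{}ec {c'}.
by move: i'; rewrite -ed => i'; congr FaceMap; exact: bool_irrelevance.
Qed.

Lemma face_id_subproof n : injectiveb [ffun i : 'I_n => i].
Proof. by apply/injectiveP => i j; rewrite !ffunE. Qed.

Definition id_face n : faceMap n n :=
  FaceMap [ffun => false] (face_id_subproof n).

Lemma face_comp_subproof m n k (f : faceMap n k) (g : faceMap m n) :
  injectiveb [ffun i => fdir f (fdir g i)].
Proof.
apply/injectiveP => i j; rewrite !ffunE => /(injectiveP _ (fdir_inj f)).
exact: (injectiveP _ (fdir_inj g)).
Qed.

Definition comp_face m n k (f : faceMap n k) (g : faceMap m n) : faceMap m k :=
  FaceMap (face_vertex f (fcorner g)) (face_comp_subproof f g).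

Lemma stdface_subproof m n (h : 'I_m -> 'I_n) (hi : injective h) :
  injectiveb [ffun i => h i].
Proof. by apply/injectiveP => i j; rewrite !ffunE; exact: hi. Qed.

(* The coordinate face through the origin spanned by the directions h i. *)
Definition std_face m n (h : 'I_m -> 'I_n) (hi : injective h) : faceMap m n :=
  FaceMap [ffun => false] (stdface_subproof hi).

Lemma vertex_subproof n : injectiveb [ffun i : 'I_0 => widen_ord (leq0n n) i].
Proof. by apply/injectiveP => -[]. Qed.

Definition vertex_face n (a : {ffun 'I_n -> bool}) : faceMap 0 n :=
  FaceMap a (vertex_subproof n).

End FaceMaps.

(* A cube complex is encoded by its isometric characteristic maps: [cube n] is
   the set of all parametrizations [0,1]^n -> X of the n-dimensional cells, so
   that each n-cell occurs once for each of the 2^n n! symmetries of [0,1]^n.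
   [face f c] is the restriction of c along the face embedding f.  The axiom
   [face_free] says that no point of an open cell is identified with another
   point of it.  A cube may have several of its faces glued together, as
   happens in quotients such as the circle with one vertex and one edge. *)

Record cubeComplex := CubeComplex {
  cube :> nat -> choiceType;
  face : forall m n, faceMap m n -> cube n -> cube m;
  face_id : forall n (c : cube n), face (id_face n) c = c;
  face_comp : forall m n k (f : faceMap n k) (g : faceMap m n) (c : cube k),
    face g (face f c) = face (comp_face f g) c;
  face_free : forall n (s : faceMap n n) (c : cube n),
    face s c = c -> s = id_face n }.

Arguments face {_ m n} f _.

(* The realization is the quotient of the disjoint union of the parametrizing
   cubes by (face f c, p) ~ (c, f p), with the quotient (weak) topology.  For the
   locally finite complexes on which a group acts freely and cocompactly this is
   also the topology of the piecewise Euclidean path metric. *)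

Section Realization.
Variables (R : realType) (K : cubeComplex).

Definition unit_cube n : set 'rV[R]_n :=
  [set p | forall i, (0 <= p ord0 i <= 1)%R].
Arguments unit_cube : clear implicits.

Definition cells : choiceType := {n : nat & K n}.

Definition param_points :=
  {s : cells & set_type (unit_cube (tag s))}.

Definition param_point n (c : K n) (p : set_type (unit_cube n)) :
  param_points := existT (fun s : cells => set_type (unit_cube (tag s)))
                         (existT (fun n => K n : Type) n c) p.

Inductive glue : param_points -> param_points -> Prop :=
  Glue m n (f : faceMap m n) (c : K n)
      (p : set_type (unit_cube m)) (q : set_type (unit_cube n)) :
    val q = face_point f (val p) ->
    glue (param_point (face f c) p) (param_point c q).

Definition realization : topologicalType := quotient_topology (gquot glue).

Definition point_of n (c : K n) (p : set_type (unit_cube n)) : realization :=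
  gclass glue (param_point c p).

Lemma unit_cube0 n : (0%R : 'rV[R]_n) \in unit_cube n.
Proof. by apply/mem_set => i; rewrite mxE lexx ler01. Qed.

Definition cube_origin n : set_type (unit_cube n) := exist _ 0%R (unit_cube0 n).

Definition vertex_point (v : K 0) : realization := point_of v (cube_origin 0).

(* For 0 <= t <= 1; [insubd] supplies a dummy point for other t. *)
Definition edge_point (e : K 1) (t : R) : realization :=
  point_of e (insubd (cube_origin 1) (const_mx t)).

End Realization.

Arguments unit_cube : clear implicits.

Section Homotopy.
Local Open Scope ring_scope.
Variables (R : realType) (T : topologicalType).
Implicit Types (x y : T) (p q : R -> T).

Definition is_path x y p :=
  [/\ {within `[0, 1], continuous p}, p 0 = x & p 1 = y].

(* Homotopy relative to the endpoints of the paths p and q from x to y; only the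
   restrictions of p and q to [0,1] matter. *)
Definition homotopic x y p q :=
  exists H : R * R -> T,
    [/\ {within `[0, 1] `*` `[0, 1], continuous H},
        {in `[0, 1], forall t, H (t, 0) = p t},
        {in `[0, 1], forall t, H (t, 1) = q t},
        {in `[0, 1], forall s, H (0, s) = x} &
        {in `[0, 1], forall s, H (1, s) = y}].

Definition homotopy_classes x y : set (set (R -> T)) :=
  [set C | exists2 p, is_path x y p &
           C = [set q | is_path x y q /\ homotopic x y p q]].

Definition concat p q : R -> T :=
  fun t => if t <= 2^-1 then p (2 * t) else q (2 * t - 1).

Definition simply_connected :=
  (forall x y, exists p, is_path x y p) /\
  (forall x p, is_path x x p -> homotopic x x p (cst x)).

End Homotopy.

(* Fix a parametrized k-cell s.  A simplex of dimension j - 1 of Lk(s) is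
   represented by a (k + j)-cube c whose restriction to the first k coordinates
   (all others being 0) is s; its vertices are the (k + 1)-cubes spanned in c by
   s and one of the last j coordinates. *)

Section Links.
Variables (K : cubeComplex) (k : nat) (s : K k).

Definition base_face j : faceMap k (k + j) := std_face (@lshift_inj k j).

Definition spike j (i : 'I_j) (l : 'I_(k + 1)) : 'I_(k + j) :=
  match fintype.split l with inl a => lshift j a | inr _ => rshift k i end.

Lemma spike_inj j (i : 'I_j) : injective (spike i).
Proof.
move=> a b; rewrite /spike.
case: split_ordP => a' ->; case: split_ordP => b' -> => e.
- by rewrite (lshift_inj e).
- by move/eqP: e; rewrite eq_lrshift.
- by move/eqP: e; rewrite eq_rlshift.
- by rewrite (ord1 a') (ord1 b').
Qed.

Definition link_cube j (c : K (k + j)) := face (base_face j) c = s.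

Definition link_vertex j (c : K (k + j)) (i : 'I_j) : K (k + 1) :=
  face (std_face (@spike_inj j i)) c.

(* Simplices as vertex sets; j = 0 gives the empty simplex. *)
Definition link_simplex (A : {fset K (k + 1)}) :=
  exists j (c : K (k + j)),
    link_cube c /\ A = [fset link_vertex c i | i in 'I_j]%fset.

Definition link_is_simplicial :=
  (forall j (c : K (k + j)), link_cube c -> injective (link_vertex c)) /\
  (forall j (c c' : K (k + j)), link_cube c -> link_cube c' ->
     link_vertex c =1 link_vertex c' -> c = c').

Definition link_is_flag :=
  forall A : {fset K (k + 1)},
    (forall u, u \in A -> link_cube u) ->
    (forall u v, u \in A -> v \in A -> u != v -> link_simplex [fset u; v]%fset) ->
    link_simplex A.

(* The dimension is -1 when the empty simplex is the only one. *)
Definition link_dim (d : int) :=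
  (exists2 A, link_simplex A & (#|` A|%:Z - 1)%R = d) /\
  (forall A, link_simplex A -> (#|` A|%:Z - 1 <= d)%R).

(* Meaningful for finite links, such as those of a finite complex. *)
Definition link_euler_char : int :=
  (\sum_(A \in [set A | link_simplex A /\ A != fset0]) (-1 : int) ^+ #|` A|.-1)%R.

Definition maximal_cell :=
  forall m (c : K m) (f : faceMap k m), face f c = s -> m = k.

End Links.

Definition CAT0 (R : realType) (X : cubeComplex) :=
  simply_connected R (realization R X) /\
  (forall v : X 0, link_is_simplicial v /\ link_is_flag v).

Definition Eulerian (n : nat) (K : cubeComplex) :=
  [/\ forall k (s : K k), link_is_simplicial s,
      forall k (s : K k), maximal_cell s -> k = n &
      forall k (s : K k),
        exists2 d : int, link_dim s d & link_euler_char s = (1 + (-1) ^ d)%R].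

(* Cellular actions permute the cubes by isometries. *)
Record cellularAction (G : groupType) (X : cubeComplex) := CellularAction {
  act : G -> forall n, X n -> X n;
  act1 : forall n (c : X n), act 1%g c = c;
  actM : forall g h n (c : X n), act (g * h)%g c = act g (act h c);
  act_face : forall g m n (f : faceMap m n) (c : X n),
    act g (face f c) = face f (act g c) }.

(* No nontrivial element fixes a point of the realization, on which g acts by
   g . [c, p] = [g . c, p]. *)
Definition free_action (R : realType) (G : groupType) (X : cubeComplex)
    (a : cellularAction G X) :=
  forall (g : G) n (c : X n) (p : set_type (unit_cube R n)),
    point_of (act a g c) p = point_of c p -> g = 1%g.

Section QuotientComplex.
Variables (R : realType) (G : groupType) (X : cubeComplex).
Variables (a : cellularAction G X) (afree : free_action R a).

Definition in_orbit n (c c' : X n) := exists g, c' = act a g c.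

Definition orbits n : choiceType := gquot (@in_orbit n).

Definition orbit_of n (c : X n) : orbits n := gclass (@in_orbit n) c.

Lemma orbit_ofP n (c c' : X n) :
  orbit_of c = orbit_of c' <-> exists g, c' = act a g c.
Proof.
split=> [/gclassP|[g e]]; last by apply/gclassP/rst_step; exists g.
elim=> {c c'} [c c' [g ->]|c|c c' _ [g ->]|c c' c'' _ [g ->] _ [h ->]].
- by exists g.
- by exists 1%g; rewrite act1.
- by exists (g^-1)%g; rewrite -actM mulVg act1.
- by exists (h * g)%g; rewrite actM.
Qed.

Definition orbit_face m n (f : faceMap m n) (C : orbits n) : orbits m :=
  orbit_of (face f (repr C)).

Lemma orbit_of_repr n (C : orbits n) : orbit_of (repr C) = C.
Proof. exact: reprK. Qed.

Lemma orbit_faceE m n (f : faceMap m n) (c : X n) :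
  orbit_face f (orbit_of c) = orbit_of (face f c).
Proof.
have /orbit_ofP[g e] := orbit_of_repr (orbit_of c).
by apply/orbit_ofP; exists g; rewrite {1}e act_face.
Qed.

Lemma orbit_face_id n (C : orbits n) : orbit_face (id_face n) C = C.
Proof. by rewrite /orbit_face face_id orbit_of_repr. Qed.

Lemma orbit_face_comp m n k (f : faceMap n k) (g : faceMap m n) (C : orbits k) :
  orbit_face g (orbit_face f C) = orbit_face (comp_face f g) C.
Proof. by rewrite -(orbit_of_repr C) !orbit_faceE face_comp. Qed.

Lemma barycenter_subproof n : (const_mx 2^-1%R : 'rV[R]_n) \in unit_cube R n.
Proof.
apply/mem_set => i; rewrite mxE invr_ge0 ler0n /=.
by rewrite invf_le1 ?ltr0n// ler1n.
Qed.

Definition barycenter n : set_type (unit_cube R n) :=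
  exist _ (const_mx 2^-1%R) (barycenter_subproof n).

Lemma symmetry_barycenter n (s : faceMap n n) :
  val (barycenter n) = face_point s (val (barycenter n)).
Proof.
apply/rowP => j; rewrite !mxE /fcoord.
case: pickP => [i _|nj]; first by rewrite mxE; case: ifP => // _; field.
have [i ij] : exists i, fdir s i = j.
  have /codomP[i ->] : j \in codom (fdir s).
    by rewrite (inj_card_onto (injectiveP _ (fdir_inj s))) ?card_ord.
  by exists i.
by have := nj i; rewrite ij eqxx.
Qed.

Lemma orbit_face_free n (s : faceMap n n) (C : orbits n) :
  orbit_face s C = C -> s = id_face n.
Proof.
set c := repr C; rewrite -[RHS]orbit_of_repr => /orbit_ofP[g e].
suff g1 : g = 1%g by apply: (@face_free X n s c); rewrite {2}/c e g1 act1.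
apply: (afree (c := face s c) (p := barycenter n)); rewrite -e.
apply/esym/gclassP/rst_step; apply: Glue; exact: symmetry_barycenter.
Qed.

Definition quotient_complex : cubeComplex :=
  CubeComplex orbit_face_id orbit_face_comp orbit_face_free.

Definition orbit_cube n (c : X n) : quotient_complex n := orbit_of c.

End QuotientComplex.

Section Hyperplanes.
Variables (G : groupType) (X : cubeComplex) (a : cellularAction G X).

(* Parallel edges of a common cube.  The parametrizations of the two edges need
   not point the same way; in particular both orientations of an edge e are
   related, as faces of e itself. *)
Definition parallel_edges (e e' : X 1) :=
  exists n (c : X n) (f f' : faceMap 1 n),
    [/\ fdir f = fdir f', e = face f c & e' = face f' c].

Definition hyperplane : choiceType := gquot parallel_edges.

Definition hyperplane_of (e : X 1) : hyperplane := gclass parallel_edges e.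

Definition hyperplane_in_orbit (h h' : hyperplane) :=
  exists g e, h = hyperplane_of e /\ h' = hyperplane_of (act a g e).

Definition hyperplane_orbit : choiceType := gquot hyperplane_in_orbit.

Definition hyperplane_orbit_of (h : hyperplane) : hyperplane_orbit :=
  gclass hyperplane_in_orbit h.

End Hyperplanes.

(* An element of [K 1] is an edge together with an orientation, and an edge path
   is a sequence of oriented edges. *)

Section EdgePaths.
Variables (R : realType) (K : cubeComplex).

Definition source (e : K 1) : K 0 := face (vertex_face [ffun => false]) e.
Definition target (e : K 1) : K 0 := face (vertex_face [ffun => true]) e.

Fixpoint is_edge_path (x : K 0) (p : seq (K 1)) (y : K 0) : Prop :=
  if p is e :: p' then source e = x /\ is_edge_path (target e) p' y else x = y.

Fixpoint trace (x : K 0) (p : seq (K 1)) : R -> realization R K :=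
  if p is e :: p' then concat (edge_point e) (trace (target e) p')
  else cst (vertex_point R x).

Definition minimal_representative (x y : K 0)
    (C : set (R -> realization R K)) (p : seq (K 1)) :=
  [/\ is_edge_path x p y, C (trace x p) &
      forall q, is_edge_path x q y -> C (trace x q) -> size p <= size q].

End EdgePaths.

Section GrowthSeries.
Variables (R : realType) (G : groupType) (X : cubeComplex).
Variables (a : cellularAction G X) (afree : free_action R a).
Variables (N : nat) (hyp : 'I_N -> hyperplane_orbit a).

Let XG := quotient_complex afree.
Let proj (n : nat) (c : X n) : XG n := orbit_cube afree c.

(* tau(C) = prod_i t_i ^ (m i), where t_i is the indeterminate attached to the
   orbit [hyp i] and p is a lift to X of a minimal representative of C. *)
Definition tau_is (x y : XG 0) (C : set (R -> realization R XG))
    (m : 'X_{1..N}) :=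
  exists (u v : X 0) (p : seq (X 1)),
    [/\ is_edge_path u p v,
        minimal_representative x y C (map (@proj 1) p) &
        forall i : 'I_N,
          m i = count
            (fun e => hyperplane_orbit_of a (hyperplane_of e) == hyp i) p].

(* The coefficient of the monomial m: there are only finitely many classes to
   count when X/G is finite. *)
Definition growth_series (x y : XG 0) (m : 'X_{1..N}) : nat :=
  #|` fset_set [set C | homotopy_classes (vertex_point R x) (vertex_point R y) C
                        /\ tau_is x y C m]|.

End GrowthSeries.

Definition rational_functions (N : nat) : fieldType := {fraction {mpoly rat[N]}}.

Section RationalFunctions.
Local Open Scope ring_scope.
Variable N : nat.

(* P(t^-1), for a polynomial P. *)
Definition eval_inv (P : {mpoly rat[N]}) : rational_functions N :=
  mmap (fun c : rat => tofrac c%:MP) (fun i => (tofrac 'X_i)^-1) P.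

(* F(t^-1): substitute in the numerator and denominator of F, the latter staying
   nonzero. *)
Definition subst_inv (F : rational_functions N) : rational_functions N :=
  eval_inv (frac (repr F)).1 / eval_inv (frac (repr F)).2.

(* F = P / Q with Q(0) <> 0 and Q * s = P as formal power series. *)
Definition expands_to (F : rational_functions N) (s : 'X_{1..N} -> nat) :=
  exists P Q : {mpoly rat[N]},
    [/\ Q@_0%MM != 0, F = tofrac P / tofrac Q &
        forall m : 'X_{1..N},
          \sum_(k <- msupp Q | (k <= m)%MM) Q@_k * (s (m - k)%MM)%:R = P@_m].

End RationalFunctions.

(* Main.v *)
From HB Require Import structures.
From Stdlib Require Import Relation_Operators.
From mathcomp Require Import all_boot all_order all_algebra fraction.
From mathcomp Require Import finmap ring lra zify generic_quotient mpoly.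
From mathcomp Require Import all_classical all_reals topology normedtype.
Require Import Defs.

(* Fix a lift u of x to X.  A class in G_{x,y} lifts to a unique homotopy class of
   paths from u to a vertex v over y, and X is simply connected, so G_{x,y}(t) is
   the sum of t^d(v) over the vertices v over y, where d(v) counts, orbit by orbit,
   the hyperplanes crossed by a geodesic from u to v.

   Homotopies enter only through local systems: a family of maps indexed by the
   oriented edges and compatible with reversal and with squares is a sheaf on the
   realization, and homotopic edge paths transport alike.  With fibre the edge
   words modulo pushing across squares, this and the flag condition give the
   normal forms of geodesics: those to v form one class, and the edges at v that
   point towards u span a cube.  With fibre G it recovers the end of a lift.

   For vertices v, w put
     B(v,w) = sum_k 1/k! sum_(c, e) prod_i b_i,
   over the parametrized k-cubes c with origin v and the corners e of c at w, with
   b_i = -t_i/(1 - t_i^2) if e_i = 1 and b_i = t_i^2/(1 - t_i^2) if e_i = 0, where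
   t_i belongs to the i-th direction of c.  The cubes spanned by the descending
   edges at w give sum_v t^d(v) B(v,w) = [w = u].  Hence the growth series of X/G
   form the inverse of the finite matrix B of X/G.  Replacing t by 1/t changes the
   sign of -t/(1 - t^2) and turns t^2/(1 - t^2) into its negative minus 1; expanding
   the product and collecting the cubes with a given face, the Eulerian condition
   on its link yields B(1/t) = (-1)^n B(t). *)

Set Implicit Arguments.
Unset Strict Implicit.
Unset Printing Implicit Defensive.

Import Order.TTheory GRing.Theory Num.Theory.
Import numFieldTopology.Exports numFieldNormedType.Exports.

(** The weights in B solve one linear system per direction: b_0 + t b_1 = 0 and t b_0 + b_1 = -t.
    Summed against t^d over the corners of a cube, they leave only the cubes whose edges at w all
    descend, each with sign (-1)^k and the monomial t^d(w). If m edges descend at w, there are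
    m(m-1)...(m-k+1) such parametrized k-cubes; the factor 1/k! turns their signed count into the
    sum of (-1)^k binom(m,k), which vanishes unless m = 0.

    Two obstacles shape the rest. Homotopies are arbitrary continuous maps, and they are not made
    cellular: a section of the sheaf is extended over the square [0,1]^2 instead. And X may have
    infinitely many vertices, so the relation between the series and B is only formal: it is cut off
    at total degree D, where finitely many vertices matter, and each coefficient is read off from
    one such truncation. Denominators are cleared so that the matrix has polynomial entries; at t =
    0 it is the identity, which makes its determinant a legitimate denominator for [expands_to]. *)

(** * Faces of a cube, their corners and edges *)

Lemma fcoord_fdir m n (f : faceMap m n) i : fcoord f (fdir f i) = Some i.
Proof.
rewrite /fcoord; case: pickP => [j /eqP/(injectiveP _ (fdir_inj f)) ->//|].
by move/(_ i); rewrite eqxx.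
Qed.

Lemma fcoordP m n (f : faceMap m n) j i : fcoord f j = Some i -> fdir f i = j.
Proof. by rewrite /fcoord; case: pickP => // k /eqP + [<-]. Qed.

Lemma fcoord_comp m n k (f : faceMap n k) (g : faceMap m n) j :
  fcoord (comp_face f g) j = obind (fcoord g) (fcoord f j).
Proof.
case E: (fcoord f j) => [i|] /=.
  case F: (fcoord g i) => [l|].
    by rewrite -(fcoordP E) -(fcoordP F) -[RHS](fcoord_fdir (comp_face f g)) ffunE.
  rewrite /fcoord; case: pickP => // l; rewrite !ffunE => /eqP e.
  by move: E; rewrite -e fcoord_fdir => -[li]; move: F; rewrite -li fcoord_fdir.
rewrite /fcoord; case: pickP => // l; rewrite !ffunE => /eqP e.
by move: E; rewrite -e fcoord_fdir.
Qed.

Lemma face_vertex_fdir m n (f : faceMap m n) a i :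
  face_vertex f a (fdir f i) = fcorner f (fdir f i) (+) a i.
Proof. by rewrite ffunE fcoord_fdir. Qed.

Lemma face_vertex_out m n (f : faceMap m n) a j :
  fcoord f j = None -> face_vertex f a j = fcorner f j.
Proof. by rewrite ffunE => ->; rewrite addbF. Qed.

Lemma face_vertex0 m n (f : faceMap m n) :
  face_vertex f [ffun=> false] = fcorner f.
Proof. by apply/ffunP => j; rewrite !ffunE; case: fcoord => [i|]; rewrite ?ffunE addbF. Qed.

Lemma faceMap0 n (f g : faceMap 0 n) : fcorner f = fcorner g -> f = g.
Proof. by move=> e; apply: faceMap_eq e; apply/ffunP => -[]. Qed.

Lemma faceMap_leq m n : faceMap m n -> m <= n.
Proof.
move=> f; have := leq_card _ (injectiveP _ (fdir_inj f)); by rewrite !card_ord.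
Qed.

Definition flipv n (a : {ffun 'I_n -> bool}) i := [ffun j => a j (+) (j == i)].

Lemma flipvK n (a : {ffun 'I_n -> bool}) i : flipv (flipv a i) i = a.
Proof. by apply/ffunP => j; rewrite !ffunE -addbA addbb addbF. Qed.

Lemma flipvC n (a : {ffun 'I_n -> bool}) i j :
  flipv (flipv a i) j = flipv (flipv a j) i.
Proof. by apply/ffunP => k; rewrite !ffunE addbAC. Qed.

Lemma face_vertex_flip m n (f : faceMap m n) a i :
  face_vertex f (flipv a i) = flipv (face_vertex f a) (fdir f i).
Proof.
apply/ffunP => j; rewrite !ffunE; case E: (fcoord f j) => [k|].
  rewrite ffunE addbA -(fcoordP E); congr (_ (+) _).
  by rewrite (inj_eq (injectiveP _ (fdir_inj f))).
case: eqP => e; last by rewrite !addbF.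
by move: E; rewrite e fcoord_fdir.
Qed.

Definition subface m n (h : 'I_m -> 'I_n) (hi : injective h) a : faceMap m n :=
  FaceMap a (stdface_subproof hi).

Lemma edge_inj n (i : 'I_n) : injective (fun _ : 'I_1 => i).
Proof. by move=> x y _; rewrite (ord1 x) (ord1 y). Qed.

Lemma ord2_inj n (i j : 'I_n) : i != j ->
  injective (fun k : 'I_2 => if k == ord0 then i else j).
Proof.
move=> nij x y; rewrite -!val_eqE /=.
by case: x y => [[|[|[]]]//= ?] [[|[|[]]]//= ?] e; apply/val_inj => //;
  move: nij; rewrite e eqxx.
Qed.

Section Faces.
Variable K : cubeComplex.
Implicit Types n : nat.

Definition vx n (c : K n) a : K 0 := face (vertex_face a) c.

Definition edge n (c : K n) (i : 'I_n) a : K 1 := face (subface (@edge_inj n i) a) c.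

Definition square n (c : K n) (i j : 'I_n) (ij : i != j) a : K 2 :=
  face (subface (ord2_inj ij) a) c.

Lemma vx_face m n (f : faceMap m n) (c : K n) a :
  vx (face f c) a = vx c (face_vertex f a).
Proof. by rewrite /vx face_comp; congr (face _ c); apply: faceMap0. Qed.

Lemma edge_face m n (f : faceMap m n) (c : K n) i a :
  edge (face f c) i a = edge c (fdir f i) (face_vertex f a).
Proof.
rewrite /edge face_comp; congr (face _ c); apply: faceMap_eq => //.
by apply/ffunP => j; rewrite !ffunE.
Qed.

Lemma face_vertex_sub m n (h : 'I_m -> 'I_n) (hi : injective h) a b i :
  face_vertex (subface hi a) b (h i) = a (h i) (+) b i.
Proof.
have -> : h i = fdir (subface hi a) i by rewrite ffunE.
exact: face_vertex_fdir.
Qed.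

Lemma face_vertex_sub_out m n (h : 'I_m -> 'I_n) (hi : injective h) a b j :
  (forall i, h i != j) -> face_vertex (subface hi a) b j = a j.
Proof.
move=> hj; rewrite face_vertex_out //.
by rewrite /fcoord; case: pickP => // i; rewrite ffunE (negPf (hj i)).
Qed.

Lemma vx_edge n (c : K n) i a b : vx (edge c i a) b = vx c (if b ord0 then flipv a i else a).
Proof.
rewrite vx_face; congr (vx c _); apply/ffunP => j.
case: (i =P j) => [<-|/eqP ij].
  rewrite (face_vertex_sub (@edge_inj n i) a b ord0).
  by case: (b _); rewrite ?addbF // ffunE eqxx.
rewrite face_vertex_sub_out //; case: ifP => // _.
by rewrite ffunE eq_sym (negPf ij) addbF.
Qed.

Lemma source_edge n (c : K n) i a : source (edge c i a) = vx c a.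
Proof. by rewrite [LHS]vx_edge ffunE. Qed.

Lemma target_edge n (c : K n) i a : target (edge c i a) = vx c (flipv a i).
Proof. by rewrite [LHS]vx_edge ffunE. Qed.

Definition zerov n : {ffun 'I_n -> bool} := [ffun=> false].

Definition rev (e : K 1) : K 1 := edge e ord0 (flipv (zerov 1) ord0).

Lemma edge1 (e : K 1) : edge e ord0 (zerov 1) = e.
Proof.
rewrite -[RHS]face_id; congr (face _ e); apply: faceMap_eq; apply/ffunP => j //.
by rewrite !ffunE (ord1 j).
Qed.

Lemma rev_edge n (c : K n) i a : rev (edge c i a) = edge c i (flipv a i).
Proof.
rewrite /rev edge_face ffunE; congr edge.
rewrite face_vertex_flip ffunE; congr flipv.
exact: (face_vertex0 (subface (@edge_inj n i) a)).
Qed.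

Lemma revK (e : K 1) : rev (rev e) = e.
Proof. by rewrite {2}/rev rev_edge flipvK edge1. Qed.

Lemma source_rev e : source (rev e) = target e.
Proof. by rewrite source_edge -{2}(edge1 e) target_edge. Qed.

Lemma target_rev e : target (rev e) = source e.
Proof. by rewrite -source_rev revK. Qed.

Lemma edge_square n (c : K n) i j (ij : i != j) a k b :
  edge (square c ij a) k b =
  edge c (if k == ord0 then i else j)
    (face_vertex (subface (ord2_inj ij) a) b).
Proof. by rewrite edge_face ffunE. Qed.

(** Bottom then right and left then top are the two edge paths from the origin of the square to the
    opposite corner. *)
Definition bottom_edge (c : K 2) := edge c ord0 (zerov 2).
Definition left_edge (c : K 2) := edge c ord_max (zerov 2).
Definition right_edge (c : K 2) := edge c ord_max (flipv (zerov 2) ord0).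
Definition top_edge (c : K 2) := edge c ord0 (flipv (zerov 2) ord_max).

Section square_sides.
Variables (n : nat) (c : K n) (i j : 'I_n) (ij : i != j) (a : {ffun 'I_n -> bool}).
Lemma bottom_edge_square : bottom_edge (square c ij a) = edge c i a.
Proof. by rewrite /bottom_edge edge_square (face_vertex0 (subface _ a)). Qed.
Lemma left_edge_square : left_edge (square c ij a) = edge c j a.
Proof. by rewrite /left_edge edge_square (face_vertex0 (subface _ a)). Qed.
Lemma right_edge_square : right_edge (square c ij a) = edge c j (flipv a i).
Proof.
by rewrite /right_edge edge_square face_vertex_flip (face_vertex0 (subface _ a)) ffunE.
Qed.
Lemma top_edge_square : top_edge (square c ij a) = edge c i (flipv a j).
Proof.
by rewrite /top_edge edge_square face_vertex_flip (face_vertex0 (subface _ a)) ffunE.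
Qed.
End square_sides.
Definition square_sides := (bottom_edge_square, left_edge_square, right_edge_square, top_edge_square).

End Faces.

(** * Local systems on the 1-skeleton and transport inside a cube *)

Section LocalSystem.
Variables (K : cubeComplex) (Phi : Type) (T : K 1 -> Phi -> Phi).

(** All fibres are identified with [Phi], and [T e] maps the fibre over the source of [e] to the
    fibre over its target. The clauses are compatibility with reversal and trivial monodromy around
    squares. *)
Definition local_system :=
  (forall e x, T (rev e) (T e x) = x) /\
  (forall c x, T (right_edge c) (T (bottom_edge c) x) = T (top_edge c) (T (left_edge c) x)).

Hypothesis TT : local_system.

Lemma transport_square n (c : K n) i j a x : i != j ->
  T (edge c j (flipv a i)) (T (edge c i a) x) =
  T (edge c i (flipv a j)) (T (edge c j a) x).
Proof. by move=> ij; have := TT.2 (square c ij a) x; rewrite !square_sides. Qed.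

Lemma transport_flip n (c : K n) i a x :
  T (edge c i (flipv a i)) (T (edge c i a) x) = x.
Proof. by rewrite -rev_edge TT.1. Qed.

(** The corners [truncv a 0], ..., [truncv a n] run from the origin to [a], switching coordinates on
    in increasing order; this path also serves later inductions over a cube. *)
Definition truncv n (a : {ffun 'I_n -> bool}) k := [ffun j : 'I_n => (j < k) && a j].

Fixpoint transport_upto n (c : K n) (a : {ffun 'I_n -> bool}) k (x : Phi) : Phi :=
  if k is k'.+1 then
    let y := transport_upto c a k' x in
    if (insub k' : option 'I_n) is Some i then
      if a i then T (edge c i (truncv a k')) y else y
    else y
  else x.

(* From the origin of [c] to its corner [a]. *)
Definition transport n (c : K n) a := transport_upto c a n.

Lemma truncv_ge n (a : {ffun 'I_n -> bool}) k : n <= k -> truncv a k = a.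
Proof. by move=> nk; apply/ffunP => j; rewrite ffunE (leq_trans (ltn_ord j)). Qed.

Lemma truncv0 n (a : {ffun 'I_n -> bool}) : truncv a 0 = zerov n.
Proof. by apply/ffunP => j; rewrite !ffunE. Qed.

Lemma truncvS n (a : {ffun 'I_n -> bool}) (i : 'I_n) :
  truncv a i.+1 = if a i then flipv (truncv a i) i else truncv a i.
Proof.
case ai: (a i); apply/ffunP => j; rewrite !ffunE ltnS leq_eqVlt -?val_eqE /=;
  case: eqP => /= [/val_inj ->|_]; rewrite ?addbF ?ltnn ?ai //.
Qed.

Lemma truncv_flip n (a : {ffun 'I_n -> bool}) (i : 'I_n) k :
  truncv (flipv a i) k = if i < k then flipv (truncv a k) i else truncv a k.
Proof.
case: ltnP => ik; apply/ffunP => j; rewrite !ffunE; case: eqP => [->|_];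
  rewrite ?addbF //; first by rewrite ik.
by rewrite ltnNge ik.
Qed.

(** The extra edge in direction [i] is carried past each later direction across one square, until it
    comes last. *)
Lemma transport_upto_flip n (c : K n) (a : {ffun 'I_n -> bool}) k (i : 'I_n) x : i < k -> a i = false ->
  transport_upto c (flipv a i) k x =
  T (edge c i (truncv a k)) (transport_upto c a k x).
Proof.
have same l : l <= i -> transport_upto c (flipv a i) l x = transport_upto c a l x.
  elim: l => //= l IH li; rewrite (IH (ltnW li)) truncv_flip ltnNge (ltnW li) /=.
  case: insubP => // j _ jl; rewrite ffunE; case: eqP => [ji|_]; last by rewrite addbF.
  by move: li; rewrite -jl ji ltnn.
move=> ik ai; elim: k ik => // k IH; rewrite ltnS leq_eqVlt => /orP[/eqP <-|ik].
  rewrite /= same // valK ffunE ai eqxx /= truncvS ai.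
  by rewrite truncv_flip ltnn.
rewrite /= IH //; case: insubP => [j _ jk|kn]; last first.
  by rewrite !truncv_ge //; rewrite -leqNgt in kn; [exact: leqW|].
have ij : j != i by apply: contraTneq ik => <-; rewrite jk ltnn.
rewrite ffunE (negPf ij) addbF -jk truncvS; case: ifP => // aj.
by rewrite truncv_flip {1}jk ik transport_square 1?eq_sym.
Qed.

Lemma transport_edge n (c : K n) a i x :
  transport c (flipv a i) x = T (edge c i a) (transport c a x).
Proof.
have H (b : {ffun 'I_n -> bool}) : b i = false -> transport c (flipv b i) x = T (edge c i b) (transport c b x).
  by move=> bi; rewrite /transport transport_upto_flip // truncv_ge.
case ai: (a i); last exact: H.
have bi : flipv a i i = false by rewrite ffunE eqxx ai.
have := H _ bi; rewrite flipvK => ->.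
by have := transport_flip c i (flipv a i) (transport c (flipv a i) x); rewrite flipvK => ->.
Qed.

Lemma transport0 n (c : K n) x : transport c (zerov n) x = x.
Proof.
suff H k : transport_upto c (zerov n) k x = x by exact: H.
elim: k => //= k ->.
by case: insubP => // i _ _; rewrite ffunE.
Qed.

(** All corners are joined to the origin by edges, so a family compatible with [T] is known from its
    value there. Applied to the corners of a face, this gives [transport_face]. *)
Lemma transport_uniq n (c : K n) (g : {ffun 'I_n -> bool} -> Phi) :
  (forall a i, g (flipv a i) = T (edge c i a) (g a)) ->
  forall a, g a = transport c a (g (zerov n)).
Proof.
move=> gE a; rewrite -{1}(truncv_ge a (leqnn n)) /transport.
suff H k : g (truncv a k) = transport_upto c a k (g (zerov n)) by exact: H.
elim: k => [|k IH] /=; first by rewrite truncv0.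
case: insubP => [i _ ik|]; last first.
  by rewrite -leqNgt => nk; rewrite -IH !truncv_ge // leqW.
by rewrite -{}ik in IH *; rewrite truncvS; case: (a i); rewrite ?gE IH.
Qed.

Lemma transport_face m n (f : faceMap m n) (c : K n) a x :
  transport c (face_vertex f a) x =
  transport (face f c) a (transport c (fcorner f) x).
Proof.
pose g b := transport c (face_vertex f b) x.
rewrite -[LHS]/(g a) (@transport_uniq _ (face f c) g).
  by rewrite /g (face_vertex0 f).
by move=> b i; rewrite /g edge_face face_vertex_flip transport_edge.
Qed.

Lemma transport_bij n (c : K n) a : bijective (transport c a).
Proof.
have Tb e : bijective (T e).
  by exists (T (rev e)) => x; [|rewrite -{1}(revK e)]; rewrite TT.1.
suff H k : bijective (transport_upto c a k) by exact: H.
elim: k => [|k IH] /=; first by exists id.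
case: insubP => // i _ _; case: (a i) => //.
exact: bij_comp.
Qed.

End LocalSystem.

(** * Homotopy invariance of local systems *)

Local Open Scope classical_set_scope.
Local Open Scope ring_scope.

(** Real induction: the supremum of the [s] with [Q 0 s] is attained and cannot lie below 1. This
    takes the place of subdividing the interval. *)
Lemma interval_chain (R : realType) (Q : R -> R -> Prop) :
  (forall a b c, a <= b -> b <= c -> Q a b -> Q b c -> Q a c) ->
  (forall t, 0 <= t <= 1 -> exists2 d, 0 < d &
     forall a b, 0 <= a -> a <= t -> t <= b -> b <= 1 ->
       t - d < a -> b < t + d -> Q a b) ->
  Q 0 1.
Proof.
move=> Qtr Qloc.
pose A := [set s | 0 <= s <= 1 /\ Q 0 s].
have A0 : A 0.
  split; first by rewrite lexx ler01.
  have [|d d0 H] := Qloc 0; first by rewrite lexx ler01.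
  by apply: H; rewrite ?ler01 // ?subr_lt0 // add0r.
have supA : has_sup A.
  by split; [exists 0 | exists 1 => s [/andP[_ s1] _]].
set s := sup A.
have s01 : 0 <= s <= 1.
  apply/andP; split; first exact: ub_le_sup supA.2 _ A0.
  by apply: ge_sup; [exists 0 | move=> x [/andP[_ s1] _]].
have [d d0 H] := Qloc s s01.
have [r Ar sr] := sup_adherent d0 supA.
have rs : r <= s by exact: ub_le_sup supA.2 _ Ar.
case: Ar => /andP[r0 r1] Qr.
(* Either 1 or a point strictly beyond the supremum [s], still within reach of [s]. *)
pose b := Num.min 1 (s + d / 2).
have sb : s <= b by rewrite /b le_min (andP s01).2 /=; lra.
have Qb : Q 0 b.
  apply: (Qtr _ _ _ _ _ Qr) => //; first exact: le_trans sb.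
  apply: H => //; first by rewrite /b ge_min lexx.
  by rewrite /b gt_min; apply/orP; right; lra.
have Ab : A b.
  split=> //; apply/andP; split; first by case/andP: s01 => *; exact: le_trans sb.
  by rewrite /b ge_min lexx.
have bs : b <= s by exact: ub_le_sup supA.2 _ Ab.
move: Qb bs; rewrite /b minEle; case: ifP => // _ _; lra.
Qed.

Lemma continuous_pair (T U V : topologicalType) (f : T -> U) (g : T -> V) :
  continuous f -> continuous g -> continuous (fun x => (f x, g x)).
Proof. by move=> cf cg x; exact: (cvg_pair (cf x) (cg x)). Qed.

Lemma affine_continuous (R : realType) (a b : R) : continuous (fun t : R => a + t * b).
Proof.
by move=> t; apply: cvgD; [exact: cvg_cst|apply: cvgM; [exact: cvg_id|exact: cvg_cst]].
Qed.

Lemma within_nearP (S T : topologicalType) (g : S -> T) (W : set S) :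
  {within W, continuous g} <-> forall z, W z -> forall U, nbhs (g z) U ->
    \forall w \near z, W w -> U (g w).
Proof.
split=> [/subspace_continuousP gc z Wz U /(gc z Wz) //|H].
by apply/subspace_continuousP => z Wz U Ug; exact: H.
Qed.

Lemma within_comp (S S' T : topologicalType) (g : S -> T) (l : S' -> S) W W' :
  {within W', continuous l} -> (forall z, W' z -> W (l z)) ->
  {within W, continuous g} -> {within W', continuous (g \o l)}.
Proof.
move=> /within_nearP lc lW /within_nearP gc; apply/within_nearP => z Wz U.
move=> /(gc _ (lW _ Wz))/(lc _ Wz); apply: filterS => w /= H Ww.
by apply: (H Ww); exact: lW.
Qed.

Section Flat.
Variables (R : realType) (B : topologicalType) (Phi : Type).
Variables (Nb : B -> set B) (rs : B -> B -> Phi -> Phi).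

(* The sheets of a covering space of [B] with fibre [Phi]: [rs b q] compares the
   fibre over [q] with the fibre over [b] when [q] is close to [b]. *)
Definition locally_constant_sheaf :=
  [/\ forall b, nbhs b (Nb b),
      forall b x, rs b b x = x,
      forall b q, Nb b q -> bijective (rs b q) &
      forall b q, Nb b q -> \forall q' \near q,
        Nb b q' /\ forall x, rs b q (rs q q' x) = rs b q' x].

Hypothesis sheaf : locally_constant_sheaf.

(** A section over [W] of the sheaf pulled back along [g]: the values near [z], compared in the
    fibre over [g z], are constant. *)
Definition flat (S : topologicalType) (g : S -> B) (W : set S) (s : S -> Phi) :=
  forall z, W z -> \forall w \near z, W w -> s z = rs (g z) (g w) (s w).

Section Generic.
Variables (S : topologicalType) (g : S -> B).
Implicit Types (W : set S) (s : S -> Phi).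

Lemma flat_sub W W' s : W' `<=` W -> flat g W s -> flat g W' s.
Proof.
move=> WW fs z Wz; apply: filterS (fs z (WW _ Wz)) => w H /WW; exact: H.
Qed.

(** Fix one element of the fibre over [g z0] and take the values that correspond to it; the cocycle
    rule of the sheaf makes this a section near [z0]. *)
Lemma flat_local W z0 : {within W, continuous g} -> W z0 ->
  exists2 U, nbhs z0 U & forall z x, W z -> U z ->
     exists2 s, flat g (W `&` U) s & s z = x.
Proof.
move=> gc Wz0.
have [Nn _ Nbij Ntr] := sheaf.
pose U := [set z | W z -> Nb (g z0) (g z)].
have Uz0 : nbhs z0 U by move/within_nearP: gc; exact.
exists U => // z x Wz Uz.
(* Off the neighbourhood the value is arbitrary. *)
have inv w : exists y, (W `&` U) w -> rs (g z0) (g w) y = rs (g z0) (g z) x.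
  have [[Ww Uw]|?] := pselect ((W `&` U) w); last by exists x.
  have [h _ hK] := Nbij _ _ (Uw Ww).
  by exists (h (rs (g z0) (g z) x)) => _; rewrite hK.
have [s sE] := choice inv.
exists s; last first.
  by have /bij_inj := Nbij _ _ (Uz Wz); apply; exact: sE.
move=> v [Wv Uv].
move/within_nearP: gc => /(_ _ Wv _ (Ntr _ _ (Uv Wv))).
apply: filterS => w Hw [Ww Uw].
have [_ tr] := Hw Ww.
have /bij_inj := Nbij _ _ (Uv Wv); apply.
by rewrite tr !sE.
Qed.

(** Near a point outside the closed set [W1] the condition on [W1] is void, and likewise for [W2],
    so flatness can be checked on each piece separately. *)
Lemma flat_glue W1 W2 s1 s2 : closed W1 -> closed W2 ->
  flat g W1 s1 -> flat g W2 s2 -> (forall z, W1 z -> W2 z -> s1 z = s2 z) ->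
  exists s, [/\ flat g (W1 `|` W2) s, (forall z, W1 z -> s z = s1 z) &
                forall z, W2 z -> s z = s2 z].
Proof.
move=> c1 c2 f1 f2 e.
pose s z := if pselect (W1 z) then s1 z else s2 z.
have sE1 z : W1 z -> s z = s1 z by rewrite /s; case: pselect.
have sE2 z : W2 z -> s z = s2 z by rewrite /s; case: pselect => // *; exact: e.
exists s; split=> // z Wz.
have nW (W : set S) t : closed W -> flat g W t -> (forall z, W z -> s z = t z) ->
    \forall w \near z, W w -> s z = rs (g z) (g w) (s w).
  move=> cW fW sE; have [Wz'|nWz] := pselect (W z).
    by apply: filterS (fW z Wz') => w + Ww; rewrite !sE //; exact.
  have : nbhs z (~` W) by apply: open_nbhs_nbhs; split => //; exact: closed_openC.
  by apply: filterS => w nWw /nWw.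
apply: filterS (filterI (nW W1 s1 c1 f1 sE1) (nW W2 s2 c2 f2 sE2)).
by move=> w [H1 H2] [/H1|/H2].
Qed.

End Generic.

Lemma flat_comp (S S' : topologicalType) (g : S -> B) (l : S' -> S) W W' s :
  {within W', continuous l} -> (forall z, W' z -> W (l z)) ->
  flat g W s -> flat (g \o l) W' (s \o l).
Proof.
move=> lc lW fs z Wz.
have /within_nearP/(_ z Wz _ (fs _ (lW _ Wz))) := lc.
apply: filterS => w /= H Ww.
by apply: (H Ww); exact: lW.
Qed.

Lemma flat_congr (S : topologicalType) (g g' : S -> B) W s :
  (forall z, W z -> g z = g' z) -> flat g W s -> flat g' W s.
Proof.
by move=> gg fs z Wz; apply: filterS (fs z Wz) => w H Ww; rewrite -!gg //; exact: H.
Qed.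

Local Notation I01 := (`[0%R, 1%R]%classic : set R).

Lemma nbhs_near (t : R) (P : R -> Prop) : (\forall w \near t, P w) ->
  exists2 d, 0 < d & forall w, t - d < w -> w < t + d -> P w.
Proof.
move=> /nbhs_ballP[d /= d0 H]; exists d => // w w1 w2.
by apply: H; rewrite /ball /= ltr_distlC w1 w2.
Qed.

(** Injectivity of [rs] spreads agreement from a point to its neighbours and back; such equivalences
    chain along the interval. *)
Lemma flat_uniq (g : R -> B) s s' : {within I01, continuous g} ->
  flat g I01 s -> flat g I01 s' -> (s 0 = s' 0 <-> s 1 = s' 1).
Proof.
move=> gc fs fs'.
apply: (@interval_chain R (fun a b => s a = s' a <-> s b = s' b)).
  by move=> a b c _ _ H1 H2; rewrite H1.
move=> t t01.
have tI : I01 t by rewrite /= in_itv.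
have [Nn _ Nbij _] := sheaf.
move/within_nearP: gc => /(_ _ tI _ (Nn _)).
move=> H3; move: (fs t tI) (fs' t tI) => H1 H2.
have [d d0 H] := nbhs_near (filterI H1 (filterI H2 H3)).
have {}H w : 0 <= w -> w <= 1 -> t - d < w -> w < t + d -> s w = s' w <-> s t = s' t.
  move=> w0 w1 tw wt; have [] := H w tw wt.
  have wI : I01 w by rewrite /= in_itv /= w0.
  move=> /(_ wI) h1 [/(_ wI) h2 /(_ wI) h3].
  rewrite h1 h2; split=> [->//|]; exact: (bij_inj (Nbij _ _ h3)).
exists d => // a b a0 at_ tb b1 ta bt.
have ab := le_trans at_ tb.
by rewrite (H a) 1?(H b) //; lra.
Qed.

Definition rect (a b c d : R) : set (R * R) := `[a, b] `*` `[c, d].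

Lemma rect_closed a b c d : closed (rect a b c d).
Proof. have -> : rect a b c d = (fst @^-1` `[a, b]) `&` (snd @^-1` `[c, d]) by [].
apply: closedI; apply: closed_comp; try exact: interval_closed.
  by move=> x _; exact: cvg_fst.
by move=> x _; exact: cvg_snd. Qed.

(** Restrict to the segment from [z] to [w], which stays in the rectangle. *)
Lemma flat_uniq_rect (g : R * R -> B) a b c d s s' z w :
  {within rect a b c d, continuous g} ->
  flat g (rect a b c d) s -> flat g (rect a b c d) s' ->
  rect a b c d z -> rect a b c d w -> s z = s' z -> s w = s' w.
Proof.
move=> gc fs fs' Wz Ww.
pose l (t : R) : R * R := (z.1 + t * (w.1 - z.1), z.2 + t * (w.2 - z.2)).
have l0 : l 0 = z by rewrite /l !mul0r !addr0; case: (z).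
have l1 : l 1 = w by rewrite /l !mul1r !(addrC _ (_ - _)) !subrK; case: (w).
have lc : continuous l.
  by apply: continuous_pair; exact: affine_continuous.
have lW t : I01 t -> rect a b c d (l t).
  rewrite /rect /= !in_itv /= => /andP[t0 t1].
  move: Wz Ww; rewrite /rect /= !in_itv /= => -[/andP[? ?] /andP[? ?]] [/andP[? ?] /andP[? ?]].
  by split; apply/andP; split; nra.
have lc' : {within I01, continuous l} by exact: continuous_subspaceT.
have := @flat_uniq (g \o l) (s \o l) (s' \o l).
rewrite /= l0 l1 => H e; apply/H => //.
- exact: within_comp lc' lW gc.
- exact: flat_comp lc' lW fs.
- exact: flat_comp lc' lW fs'.
Qed.

Definition flat_extends (g : R * R -> B) a b c d :=
  forall z x, rect a b c d z ->
    exists2 s, flat g (rect a b c d) s & s z = x.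

Lemma rectW a b c d a' b' c' d' : a <= a' -> b' <= b -> c <= c' -> d' <= d ->
  rect a' b' c' d' `<=` rect a b c d.
Proof.
move=> ? ? ? ? z; rewrite /rect /= !in_itv /= => -[/andP[? ?] /andP[? ?]].
by split; lra.
Qed.

(** The common part is again a nonempty rectangle, so two sections that agree at its point [v] agree
    on all of it and can be glued. *)
Lemma flat_extends_union (g : R * R -> B) a b c d a1 b1 c1 d1 a2 b2 c2 d2
    a0 b0 c0 d0 :
  {within rect a b c d, continuous g} ->
  rect a b c d = rect a1 b1 c1 d1 `|` rect a2 b2 c2 d2 ->
  rect a1 b1 c1 d1 `&` rect a2 b2 c2 d2 = rect a0 b0 c0 d0 ->
  rect a0 b0 c0 d0 !=set0 ->
  flat_extends g a1 b1 c1 d1 -> flat_extends g a2 b2 c2 d2 ->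
  flat_extends g a b c d.
Proof.
move=> gc W12 W0 [v Wv] E1 E2.
have [Wv1 Wv2] : (rect a1 b1 c1 d1 `&` rect a2 b2 c2 d2) v by rewrite W0.
have gc0 : {within rect a0 b0 c0 d0, continuous g}.
  by apply: continuous_subspaceW gc; rewrite -W0 W12 => z [? _]; left.
have glue s1 s2 : flat g (rect a1 b1 c1 d1) s1 -> flat g (rect a2 b2 c2 d2) s2 ->
    s1 v = s2 v -> exists s, [/\ flat g (rect a b c d) s,
       (forall z, rect a1 b1 c1 d1 z -> s z = s1 z) &
       (forall z, rect a2 b2 c2 d2 z -> s z = s2 z)].
  move=> f1 f2 e; rewrite W12; apply: flat_glue => //; try exact: rect_closed.
  move=> z z1 z2; apply: (flat_uniq_rect gc0 _ _ Wv _ e).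
  - by apply: flat_sub f1; rewrite -W0 => w [].
  - by apply: flat_sub f2; rewrite -W0 => w [].
  - by rewrite -W0.
move=> z x; rewrite W12 => -[z1|z2].
  have [s1 f1 s1z] := E1 _ x z1; have [s2 f2 s2v] := E2 _ (s1 v) Wv2.
  by have [|s [fs e1 _]] := glue s1 s2 f1 f2; [|exists s; rewrite -?W12 // e1].
have [s2 f2 s2z] := E2 _ x z2; have [s1 f1 s1v] := E1 _ (s2 v) Wv1.
by have [|s [fs _ e2]] := glue s1 s2 f1 f2; [|exists s; rewrite -?W12 // e2].
Qed.

Lemma flat_extends_hcat (g : R * R -> B) a b b' c d :
  {within rect a b' c d, continuous g} -> a <= b -> b <= b' -> c <= d ->
  flat_extends g a b c d -> flat_extends g b b' c d -> flat_extends g a b' c d.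
Proof.
move=> gc ab bb cd; apply: (@flat_extends_union _ _ _ _ _ _ _ _ _ _ _ _ _ b b c d) => //.
- apply/seteqP; split=> -[z1 z2]; rewrite /rect /= !in_itv /=.
    move=> [/andP[? ?] ->]; have [zb|zb] := leP z1 b; [left|right]; split => //; lra.
  by move=> [|] [/andP[? ?] ->]; split => //; lra.
- apply/seteqP; split=> -[z1 z2]; rewrite /rect /= !in_itv /=.
    by move=> [[/andP[? ?] ->] [/andP[? ?] _]]; split => //; lra.
  by move=> [/andP[? ?] ->]; split; split => //; lra.
- by exists (b, c); rewrite /rect /= !in_itv /= !lexx cd.
Qed.

Lemma flat_extends_vcat (g : R * R -> B) a b c d d' :
  {within rect a b c d', continuous g} -> a <= b -> c <= d -> d <= d' ->
  flat_extends g a b c d -> flat_extends g a b d d' -> flat_extends g a b c d'.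
Proof.
move=> gc ab cd dd; apply: (@flat_extends_union _ _ _ _ _ _ _ _ _ _ _ _ _ a b d d) => //.
- apply/seteqP; split=> -[z1 z2]; rewrite /rect /= !in_itv /=.
    move=> [-> /andP[? ?]]; have [zb|zb] := leP z2 d; [left|right]; split => //; lra.
  by move=> [|] [-> /andP[? ?]]; split => //; lra.
- apply/seteqP; split=> -[z1 z2]; rewrite /rect /= !in_itv /=.
    by move=> [[-> /andP[? ?]] [_ /andP[? ?]]]; split => //; lra.
  by move=> [-> /andP[? ?]]; split; split => //; lra.
- by exists (a, d); rewrite /rect /= !in_itv /= !lexx ab.
Qed.

Lemma flat_extends_local (g : R * R -> B) t u :
  {within rect 0 1 0 1, continuous g} -> rect 0 1 0 1 (t, u) ->
  exists2 e, 0 < e & forall a b c d,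
    0 <= a -> b <= 1 -> 0 <= c -> d <= 1 -> t - e < a -> b < t + e ->
    u - e < c -> d < u + e -> flat_extends g a b c d.
Proof.
move=> gc Wtu.
have [U /nbhs_ballP[e /= e0 eU] H] := flat_local gc Wtu.
exists e => // a b c d a0 b1 c0 d1 ta bt uc du z x Wz.
have sub : rect a b c d `<=` rect 0 1 0 1 `&` U.
  move=> v; rewrite /rect /= !in_itv /= => -[/andP[? ?] /andP[? ?]].
  split; first by split; lra.
  by apply: eU; split; rewrite /ball /= ltr_distlC; lra.
have [/H Hz /Hz {Hz}Hz] := sub _ Wz.
by have [s fs sz] := Hz x; exists s => //; exact: flat_sub fs.
Qed.

(** Narrow vertical strips are filled by chaining small rectangles upwards; the strips are then
    chained sideways. *)
Lemma flat_square (g : R * R -> B) :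
  {within rect 0 1 0 1, continuous g} -> flat_extends g 0 1 0 1.
Proof.
move=> gc.
(* The chain lemma quantifies over all reals [a] and [b], so the bounds travel as premises of the
   chained property. *)
suff E : 0 <= 0 :> R -> 0 <= 1 :> R -> 1 <= 1 :> R -> flat_extends g 0 1 0 1 by apply: E.
apply: (@interval_chain R (fun a b => 0 <= a -> a <= b -> b <= 1 -> flat_extends g a b 0 1)).
  move=> a b c ab bc H1 H2 a0 ac c1.
  apply: (@flat_extends_hcat _ a b c) => //; rewrite ?ler01 //.
  - by apply: continuous_subspaceW gc; apply: rectW.
  - by apply: H1 => //; lra.
  - by apply: H2 => //; lra.
move=> t t01.
(* One width must serve the whole height of the strip; each vertical gluing takes the minimum of two
   widths. *)
have [e e0 H] : exists2 e, 0 < e & forall a b, 0 <= a -> a <= b -> b <= 1 -> t - e < a ->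
    b < t + e -> flat_extends g a b 0 1.
  suff E : 0 <= 0 :> R -> 1 <= 1 :> R -> exists2 e, 0 < e & forall a b, 0 <= a -> a <= b -> b <= 1 ->
    t - e < a -> b < t + e -> flat_extends g a b 0 1 by exact: E.
  apply: (@interval_chain R (fun c d => 0 <= c -> d <= 1 -> exists2 e, 0 < e &
    forall a b, 0 <= a -> a <= b -> b <= 1 -> t - e < a -> b < t + e -> flat_extends g a b c d)).
    move=> c c' c'' cc cc' H1 H2 c0 c1.
    have [|e1 e10 {}H1] := H1 c0; first by lra.
    have [||e2 e20 {}H2] := H2; [by lra | by lra |].
    exists (Num.min e1 e2); first by rewrite lt_min e10.
    move=> a b a0 ab b1; rewrite ltrBlDl => ta bt.
    have [e1t e2t] : (t < e1 + a) /\ (t < e2 + a).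
      by move: ta; rewrite -ltrBlDr lt_min ltrBlDr ltrBlDr => /andP.
    have [e1b e2b] : (b < t + e1) /\ (b < t + e2).
      by move: bt; rewrite -ltrBlDl lt_min !ltrBlDl => /andP.
    apply: (@flat_extends_vcat _ a b c c') => //.
    - by apply: continuous_subspaceW gc; apply: rectW.
    - by apply: H1 => //; lra.
    - by apply: H2 => //; lra.
  move=> u u01; have [|e e0 H] := @flat_extends_local g t u gc.
    by rewrite /rect /= !in_itv.
  exists e => // c d c0 cu ud d1 uc du _ _; exists e => // a b a0 ab b1 ta bt.
  exact: H.
by exists e => // a b a0 at_ tb b1 ta bt _ ab _; apply: H.
Qed.

(** Parallel transport along the path [g] takes [x] to [y]. *)
Definition carries (g : R -> B) (x y : Phi) :=
  exists s, [/\ flat g I01 s, s 0 = x & s 1 = y].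

Lemma carries_uniq g x y y' : {within I01, continuous g} ->
  carries g x y -> carries g x y' -> y = y'.
Proof.
move=> gc [s [fs <- <-]] [s' [fs' e <-]].
by apply/(flat_uniq gc fs fs').
Qed.

Lemma carries_cst b x : carries (cst b) x x.
Proof.
exists (fun=> x); split=> // z _; apply: filterE => w _.
by case: sheaf => _ ->.
Qed.

Lemma carries_congr (g g' : R -> B) x y :
  {in I01, g =1 g'} -> carries g x y -> carries g' x y.
Proof.
move=> gg [s [fs s0 s1]]; exists s; split=> //.
by apply: flat_congr fs => z Iz; apply: gg; apply/mem_set.
Qed.

Lemma carries_comp (S : topologicalType) (g : S -> B) (W : set S) s (l : R -> S) :
  {within I01, continuous l} -> (forall t, I01 t -> W (l t)) -> flat g W s ->
  carries (g \o l) (s (l 0)) (s (l 1)).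
Proof. by move=> lc lW fs; exists (s \o l); split=> //; exact: flat_comp fs. Qed.

Lemma carries_homotopic b b' (p q : R -> B) x y y' :
  is_path b b' p -> is_path b b' q -> homotopic b b' p q ->
  carries p x y -> carries q x y' -> y = y'.
Proof.
move=> [pc _ _] [qc _ _] [H [Hc Hp Hq H0 H1]] xy xy'.
have [s fs s0] : exists2 s, flat H (rect 0 1 0 1) s & s (0, 0) = x.
  by apply: (flat_square Hc); rewrite /rect /= !in_itv /= !lexx ler01.
have side (l : R -> R * R) (r : R -> B) : continuous l -> (forall t, I01 t -> rect 0 1 0 1 (l t)) ->
    {in I01, H \o l =1 r} -> carries r (s (l 0)) (s (l 1)).
  move=> lc lW lr; apply: carries_congr lr _; apply: carries_comp fs => //.
  exact: continuous_subspaceT.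
have I0 : I01 0 by rewrite /= in_itv /= lexx ler01.
have I1 : I01 1 by rewrite /= in_itv /= lexx ler01.
have c1 t : I01 t -> rect 0 1 0 1 (t, 0) by split.
have c2 t : I01 t -> rect 0 1 0 1 (t, 1) by split.
have c3 t : I01 t -> rect 0 1 0 1 (0, t) by split.
have c4 t : I01 t -> rect 0 1 0 1 (1, t) by split.
have idc : continuous (@id R) by move=> ?; exact: cvg_id.
have cc u : continuous (cst u : R -> R) by exact: cst_continuous.
have inI (r r' : R -> B) : {in `[0, 1]%R, forall t, r t = r' t} -> {in I01, r =1 r'}.
  by move=> rr t /set_mem tI; exact: rr.
have pb := side _ p (continuous_pair idc (cc 0)) c1 (inI _ _ Hp).
have pt := side _ q (continuous_pair idc (cc 1)) c2 (inI _ _ Hq).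
have pl := side _ (cst b) (continuous_pair (cc 0) idc) c3 (inI _ _ H0).
have pr := side _ (cst b') (continuous_pair (cc 1) idc) c4 (inI _ _ H1).
have cstc u : {within I01, continuous (cst u : R -> B)}.
  by apply: continuous_subspaceT; exact: cst_continuous.
rewrite /cst /= s0 in pb pt pl pr.
have e2 := carries_uniq (cstc b') pr (carries_cst b' _).
rewrite (carries_uniq pc xy pb) -e2.
by apply: (carries_uniq qc pt); rewrite -(carries_uniq (cstc b) (carries_cst b x) pl).
Qed.

Lemma concat_left (p q : R -> B) t : t <= 2^-1 -> concat p q t = p (2 * t).
Proof. by rewrite /concat => ->. Qed.

Lemma concat_right (p q : R -> B) t : p 1 = q 0 -> 2^-1 <= t ->
  concat p q t = q (2 * t - 1).
Proof.
move=> pq; rewrite le_eqVlt => /orP[/eqP <-|t2].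
  by rewrite concat_left // divff ?pnatr_eq0 // subrr.
by rewrite /concat leNgt t2.
Qed.

Local Notation IL := (`[0%R, 2^-1%R]%classic : set R).
Local Notation IR := (`[2^-1%R, 1%R]%classic : set R).

Lemma I01E : I01 = IL `|` IR.
Proof.
apply/seteqP; split=> t; rewrite /= !in_itv /=.
  by move=> /andP[? ?]; have [?|?] := leP t 2^-1; [left|right]; lra.
by move=> [|] /andP[? ?]; lra.
Qed.

Lemma double_within (W : set R) : {within W, continuous (fun t : R => 2 * t)}.
Proof.
apply: continuous_subspaceT => t.
by apply: cvgM; [exact: cvg_cst|exact: cvg_id].
Qed.

Lemma double1_within (W : set R) : {within W, continuous (fun t : R => 2 * t - 1)}.
Proof.
apply: continuous_subspaceT => t.
by apply: cvgB; [apply: cvgM; [exact: cvg_cst|exact: cvg_id]|exact: cvg_cst].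
Qed.

Lemma IL_double t : IL t -> I01 (2 * t).
Proof. by rewrite /= !in_itv /= => /andP[? ?]; lra. Qed.

Lemma IR_double t : IR t -> I01 (2 * t - 1).
Proof. by rewrite /= !in_itv /= => /andP[? ?]; lra. Qed.

Lemma concat_within (p q : R -> B) : {within I01, continuous p} ->
  {within I01, continuous q} -> p 1 = q 0 -> {within I01, continuous (concat p q)}.
Proof.
move=> pc qc pq; rewrite I01E; apply: withinU_continuous.
- exact: interval_closed.
- exact: interval_closed.
- have := within_comp (@double_within IL) IL_double pc.
  apply: subspace_eq_continuous => t /set_mem; rewrite /= in_itv /= => /andP[_ t2].
  by rewrite /from_subspace /= concat_left.
- have := within_comp (@double1_within IR) IR_double qc.
  apply: subspace_eq_continuous => t /set_mem; rewrite /= in_itv /= => /andP[t2 _].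
  by rewrite /from_subspace /= concat_right.
Qed.

Lemma carries_concat (p q : R -> B) x y z : p 1 = q 0 ->
  carries p x y -> carries q y z -> carries (concat p q) x z.
Proof.
move=> pq [s [fs s0 s1]] [s' [fs' s0' s1']].
have f1 : flat (concat p q) IL (s \o (fun t => 2 * t)).
  have := flat_comp (@double_within IL) IL_double fs.
  apply: flat_congr => t; rewrite /= in_itv /= => /andP[_ t2].
  by rewrite concat_left.
have f2 : flat (concat p q) IR (s' \o (fun t => 2 * t - 1)).
  have := flat_comp (@double1_within IR) IR_double fs'.
  apply: flat_congr => t; rewrite /= in_itv /= => /andP[t2 _].
  by rewrite concat_right.
have [||w|r [fr e1 e2]] := flat_glue _ _ f1 f2.
- exact: interval_closed.
- exact: interval_closed.
- rewrite /= !in_itv /= => /andP[_ w1] /andP[w2 _].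
  have -> : w = 2^-1 by apply/eqP; rewrite eq_le w1.
  by rewrite divff ?pnatr_eq0 // subrr s1 s0'.
exists r; split; first by rewrite I01E.
- by rewrite e1 /= ?mulr0 // in_itv /= lexx invr_ge0 ler0n.
- rewrite e2 /=; last by rewrite in_itv /=; lra.
  by rewrite -s1'; congr s'; lra.
Qed.

End Flat.

(** * Points of faces, open stars and carriers in the realization *)

Section FacePoint.
Variable R : realType.

Lemma face_point_fdir m n (f : faceMap m n) (p : 'rV[R]_m) i :
  face_point f p ord0 (fdir f i) =
  if fcorner f (fdir f i) then 1 - p ord0 i else p ord0 i.
Proof. by rewrite mxE fcoord_fdir. Qed.

Lemma face_point_out m n (f : faceMap m n) (p : 'rV[R]_m) j :
  fcoord f j = None -> face_point f p ord0 j = (fcorner f j)%:R.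
Proof. by move=> e; rewrite mxE e. Qed.

Lemma face_point_comp m n k (f : faceMap n k) (g : faceMap m n) (p : 'rV[R]_m) :
  face_point (comp_face f g) p = face_point f (face_point g p).
Proof.
apply/rowP => j; rewrite !mxE fcoord_comp /= ffunE.
case: fcoord => [i|] /=; last by rewrite addbF.
rewrite mxE; case: fcoord => [l|].
  by case: (fcorner f j); case: (fcorner g i) => //=; rewrite opprB addrC subrK.
by case: (fcorner f j); case: (fcorner g i) => //=; rewrite ?subrr ?subr0.
Qed.

Lemma face_point_id n (p : 'rV[R]_n) : face_point (id_face n) p = p.
Proof.
apply/rowP => j.
have {1}-> : j = fdir (id_face n) j by rewrite ffunE.
by rewrite face_point_fdir ffunE.
Qed.

Lemma face_point_dist m n (f : faceMap m n) (p q : 'rV[R]_m) r : 0 < r ->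
  (forall i, `|p ord0 i - q ord0 i| < r) ->
  forall j, `|face_point f p ord0 j - face_point f q ord0 j| < r.
Proof.
move=> r0 H j; rewrite !mxE; case: fcoord => [i|]; last by rewrite subrr normr0.
by case: (fcorner f j) => //; rewrite opprB addrC addrA subrK distrC.
Qed.

Lemma face_factor m n k (f : faceMap m k) (g : faceMap n k) :
  (forall i, fcoord g (fdir f i) != None) ->
  (forall j, fcoord g j = None -> fcorner f j = fcorner g j) ->
  exists f', f = comp_face g f'.
Proof.
move=> H1 H2.
have ex i : exists l, fdir g l == fdir f i.
  have := H1 i; case E: fcoord => [l|] // _; exists l; exact/eqP/fcoordP.
pose h i := xchoose (ex i).
have hE i : fdir g (h i) = fdir f i by apply/eqP; exact: (xchooseP (ex i)).
have hi : injective h.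
  by move=> i j e; apply: (injectiveP _ (fdir_inj f)); rewrite -!hE e.
(* The corner is read in the coordinates of [g], which may reverse an axis. *)
exists (subface hi [ffun l => fcorner f (fdir g l) (+) fcorner g (fdir g l)]).
apply: faceMap_eq; apply/ffunP => j; first by rewrite !ffunE hE.
rewrite ffunE; case E: (fcoord g j) => [l|]; last by rewrite addbF H2.
by rewrite !ffunE (fcoordP E) addbC -addbA addbb addbF.
Qed.

End FacePoint.

Section Star.
Variables (R : realType) (K : cubeComplex).

(** The open [r]-ball around the point [p0] of [c0], read in the chart [c]. The cell [c0] may occur
    several times as a face of [c], hence the existential over [f]. *)
Definition near_face n0 (c0 : K n0) (p0 : 'rV[R]_n0) (r : R) n (c : K n) (p : 'rV[R]_n) :=
  exists2 f : faceMap n0 n, face f c = c0 &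
    forall j, `|p ord0 j - face_point f p0 ord0 j| < r.

(* [p] keeps distance [2 r] from the boundary of the cube; the bound on [r]
   matters in dimension 0. *)
Definition interior_pt n (p : 'rV[R]_n) (r : R) :=
  [/\ 0 < r, r <= 4^-1 & forall i, 2 * r <= p ord0 i <= 1 - 2 * r].

Lemma interior_ptW n (p : 'rV[R]_n) (r : R) s : 0 < s -> s <= r ->
  interior_pt p r -> interior_pt p s.
Proof. by move=> s0 sr [r0 r4 H]; split=> [//||i]; [lra|have := H i; lra]. Qed.

Lemma near_face_up m n0 (c0 : K n0) (p0 : 'rV[R]_n0) (r : R) n (g : faceMap m n)
    (c : K n) (p : 'rV[R]_m) : 0 < r ->
  near_face c0 p0 r (face g c) p -> near_face c0 p0 r c (face_point g p).
Proof.
move=> r0 [f fc H]; exists (comp_face g f); first by rewrite -face_comp.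
by move=> j; rewrite face_point_comp; exact: face_point_dist.
Qed.

(** A coordinate fixed by [g] is 0 or 1, while the coordinates of [p0] stay [2 * r] away from both.
    The factor 2 pays for the triangle inequality in [near_face_uniq]. *)
Lemma near_face_factor m n0 (p0 : 'rV[R]_n0) (r : R) n (g : faceMap m n) (f : faceMap n0 n)
    (p : 'rV[R]_m) : interior_pt p0 r ->
  (forall j, `|face_point g p ord0 j - face_point f p0 ord0 j| < 2 * r) ->
  exists f', f = comp_face g f'.
Proof.
move=> [r0 r4 I] H; apply: face_factor.
  move=> i; apply/eqP => E; have := H (fdir f i).
  rewrite face_point_fdir face_point_out //; have := I i.
  by case: (fcorner f _); case: (fcorner g _) => /=;
    rewrite ltr_norml => ? /andP[? ?]; lra.
move=> j E; have := H j; rewrite (face_point_out _ E).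
case F: (fcoord f j) => [i|].
  have := I i; rewrite -(fcoordP F) face_point_fdir.
  by case: (fcorner f _); case: (fcorner g _) => //=;
    rewrite ltr_norml => ? /andP[? ?]; lra.
rewrite face_point_out //.
by case: (fcorner f _); case: (fcorner g _) => //=;
    rewrite ltr_norml => /andP[? ?]; lra.
Qed.

Lemma near_face_down m n0 (c0 : K n0) (p0 : 'rV[R]_n0) (r : R) n (g : faceMap m n)
    (c : K n) (p : 'rV[R]_m) : interior_pt p0 r ->
  near_face c0 p0 r c (face_point g p) -> near_face c0 p0 r (face g c) p.
Proof.
move=> I [f fc H]; have [r0 _ _] := I.
have [|f' fE] := near_face_factor (f := f) (g := g) (p := p) I.
  by move=> j; have := H j; lra.
exists f'; first by rewrite face_comp -fE.
move=> i; have := H (fdir g i); rewrite fE face_point_comp !face_point_fdir.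
case: (fcorner g _) => //.
by rewrite opprB addrC addrA subrK distrC.
Qed.

(** The second face is the first one preceded by a symmetry fixing [c0], which is trivial by
    [face_free]. So a point of the star determines the corner to which one has to transport. *)
Lemma near_face_uniq n0 (c0 : K n0) (p0 : 'rV[R]_n0) (r : R) n (c : K n) (p : 'rV[R]_n)
    (f f' : faceMap n0 n) : interior_pt p0 r ->
  face f c = c0 -> face f' c = c0 ->
  (forall j, `|p ord0 j - face_point f p0 ord0 j| < r) ->
  (forall j, `|p ord0 j - face_point f' p0 ord0 j| < r) -> f = f'.
Proof.
move=> I fc fc' H H'.
have [|s fE] := near_face_factor (f := f') (g := f) (p := p0) I.
  move=> j; have := H j; have := H' j.
  by rewrite !ltr_norml => /andP[? ?] /andP[? ?]; apply/andP; split; lra.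
have : face s c0 = c0 by rewrite -{1}fc face_comp -fE.
move/face_free => s1; rewrite fE s1.
apply: faceMap_eq; first by apply/ffunP => i; rewrite !ffunE.
exact: (esym (face_vertex0 f)).
Qed.

Local Notation real := (realization R K).

Definition near_param n0 (c0 : K n0) (p0 : 'rV[R]_n0) (r : R) (x : param_points R K) :=
  near_face c0 p0 r (projT2 (projT1 x) : K (tag (projT1 x))) (val (projT2 x)).

Lemma near_param_class n0 (c0 : K n0) (p0 : 'rV[R]_n0) (r : R) x y :
  interior_pt p0 r -> gclass (@glue R K) x = gclass (@glue R K) y ->
  near_param c0 p0 r x <-> near_param c0 p0 r y.
Proof.
move=> I /gclassP; elim=> {x y} [x y []|x|x y _|x y z _ H1 _ H2] //.
- move=> m n f c p q e; rewrite /near_param /= e.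
  by have [r0 _ _] := I; split; [exact: near_face_up | exact: near_face_down].
- by move=> ->.
- by rewrite H1.
Qed.

(** Tested on a representative of the class; [near_param_class] gives independence of the choice. *)
Definition star n0 (c0 : K n0) (p0 : 'rV[R]_n0) (r : R) : set real :=
  [set q | near_param c0 p0 r (repr q)].

Lemma star_point n0 (c0 : K n0) (p0 : 'rV[R]_n0) (r : R) n (c : K n) p :
  interior_pt p0 r ->
  star c0 p0 r (point_of c p) <-> near_face c0 p0 r c (val p).
Proof.
move=> I; rewrite /star /=.
have -> : near_face c0 p0 r c (val p) = near_param c0 p0 r (param_point c p) by [].
apply: near_param_class => //.
by rewrite /gclass reprK.
Qed.

Lemma near_coords n (p : set_type (unit_cube R n)) (k : 'rV[R]_n) (r : R) :
  (forall j, `|val p ord0 j - k ord0 j| < r) ->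
  nbhs p (fun p' : set_type (unit_cube R n) => forall j : 'I_n,
    `|val p' ord0 j - k ord0 j| < r).
Proof.
move=> H.
apply: (@filter_forall _ _ (fun j (p' : set_type (unit_cube R n)) =>
    `|val p' ord0 j - k ord0 j| < r) (nbhs p)) => j.
have cj : continuous (fun p' : set_type (unit_cube R n) => (val p' : 'rV[R]_n) ord0 j).
  move=> x; apply: (@continuous_comp _ _ _
    (set_val : set_type (unit_cube R n) -> 'rV[R]_n) (fun M : 'rV[R]_n => M ord0 j)).
    exact: initial_continuous.
  exact: coord_continuous.
apply: (cj p [set y : R | `|y - k ord0 j| < r]).
apply/nbhs_ballP; exists (r - `|val p ord0 j - k ord0 j|) => /=.
  by rewrite subr_gt0.
move=> y; rewrite /ball /= distrC ltrBrDr; apply: le_lt_trans.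
by rewrite -[X in `|X|](subrKA (val p ord0 j)) ler_normD.
Qed.

Lemma near_face_open n0 (c0 : K n0) (p0 : 'rV[R]_n0) (r : R) n (c : K n) :
  open [set p : set_type (unit_cube R n) | near_face c0 p0 r c (val p)].
Proof.
rewrite openE => p [f fc H].
by apply: filterS (near_coords H) => p' H'; exists f.
Qed.

Lemma star_open n0 (c0 : K n0) (p0 : 'rV[R]_n0) (r : R) : interior_pt p0 r ->
  open (star c0 p0 r).
Proof.
move=> I; rewrite /open /= /quotient_open.
apply/sigT_openP => -[n c].
have := near_face_open c0 p0 r c; congr open.
by apply/seteqP; split=> p; rewrite /= -star_point.
Qed.

Lemma min_family (I : finType) (F : I -> R) (b : R) : 0 < b -> (forall i, 0 < F i) ->
  exists r : R, [/\ 0 < r, r <= b & forall i, r <= F i].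
Proof.
move=> b0 F0; exists (\big[Num.min/b]_i F i); split.
- elim/big_rec: _ => // i x _ x0; by rewrite lt_min F0.
- by rewrite (bigmin_le_id).
- by move=> i; exact: bigmin_le_cond.
Qed.

(** Keep the coordinates strictly between 0 and 1 as the directions of a face, and let its corner
    record which of the others equal 1. *)
Lemma interior_rep (q : real) : exists n (c : K n) (p : set_type (unit_cube R n)) (r : R),
  point_of c p = q /\ interior_pt (val p) r.
Proof.
have : exists n (c : K n) p, point_of c p = q.
  by case: (repr q) (reprK q) => -[n c] p e; exists n, c, p.
move=> [n [c [p <-]]] {q}.
have p01 i : 0 <= val p ord0 i <= 1 by have /set_mem := valP p; exact.
pose D := [set j | 0 < val p ord0 j < 1]%SET.
pose h (i : 'I_#|D|) : 'I_n := enum_val i.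
have hi : injective h by exact: enum_val_inj.
pose f := subface hi [ffun j => val p ord0 j == 1].
pose p' : 'rV[R]_#|D| := \row_i val p ord0 (h i).
have p'01 : p' \in unit_cube R #|D| by apply/mem_set => i; rewrite mxE.
have hD i : 0 < val p ord0 (h i) < 1 by have := enum_valP i; rewrite inE.
have pE : val p = face_point f p'.
  apply/rowP => j; case E: (fcoord f j) => [i|].
    rewrite -(fcoordP E) face_point_fdir !ffunE mxE.
    by have /andP[_ ?] := hD i; rewrite lt_eqF.
  rewrite face_point_out // ffunE.
  have : j \notin D.
    apply: contraT; rewrite negbK => jD.
    have := fcoord_fdir f (enum_rank_in jD j).
    by rewrite ffunE /h enum_rankK_in // E.
  rewrite inE negb_and -!leNgt.
  have /andP[p0 p1] := p01 j; case/orP => pj.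
    have -> : val p ord0 j = 0 by apply/eqP; rewrite eq_le pj.
    by rewrite eq_sym oner_eq0.
  have -> : val p ord0 j = 1 by apply/eqP; rewrite eq_le pj p1.
  by rewrite eqxx.
(* Half the distance to the boundary, because [interior_pt] asks for [2 * r]. *)
have F0 i : 0 < Num.min (val p ord0 (h i)) (1 - val p ord0 (h i)) / 2.
  apply: divr_gt0; rewrite ?ltr0n // lt_min.
  by have := hD i; lra.
have q0 : 0 < 4^-1 :> R by rewrite invr_gt0 ltr0n.
have [r [r0 r4 rH]] := min_family q0 F0.
exists #|D|, (face f c), (exist _ p' p'01), r; split.
  by apply/gclassP/rst_step; exact: Glue.
split=> // i; rewrite mxE; have := rH i.
rewrite ler_pdivlMr ?ltr0n // le_min => /andP[? ?].
by lra.
Qed.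

End Star.

Section Carrier.
Variables (R : realType) (K : cubeComplex).
Local Notation real := (realization R K).
Implicit Types (b q : real).

Lemma carrier_ex q : exists s : {n : nat & (K n * set_type (unit_cube R n) * R)%type},
  point_of (projT2 s).1.1 (projT2 s).1.2 = q /\
  interior_pt (val (projT2 s).1.2) (projT2 s).2.
Proof. by have [n [c [p [r H]]]] := interior_rep q; exists (existT _ n (c, p, r)). Qed.

(** A chosen cube having [q] in its interior, with coordinates and a radius; the fibre over [q] will
    be attached at the origin of this cube. *)
Definition carrier_data q := projT1 (cid (carrier_ex q)).
Definition cdim q := projT1 (carrier_data q).
Definition carrier q : K (cdim q) := (projT2 (carrier_data q)).1.1.
Definition cpoint q : set_type (unit_cube R (cdim q)) := (projT2 (carrier_data q)).1.2.
Definition cradius q := (projT2 (carrier_data q)).2.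

Lemma carrierK q : point_of (carrier q) (cpoint q) = q.
Proof. exact: (projT2 (cid (carrier_ex q))).1. Qed.

Lemma carrier_interior q : interior_pt (val (cpoint q)) (cradius q).
Proof. exact: (projT2 (cid (carrier_ex q))).2. Qed.

Lemma cradius_gt0 q : 0 < cradius q.
Proof. by have [] := carrier_interior q. Qed.

Definition carrier_star q : set real := star (carrier q) (val (cpoint q)) (cradius q).

Lemma near_face_refl n (c : K n) (p : 'rV[R]_n) (r : R) : 0 < r -> near_face c p r c p.
Proof.
by move=> r0; exists (id_face n); rewrite ?face_id // => j; rewrite face_point_id subrr normr0.
Qed.

Lemma carrier_star_nbhs q (r : R) : 0 < r -> r <= cradius q ->
  nbhs q (star (carrier q) (val (cpoint q)) r).
Proof.
move=> r0 rq.
have I := interior_ptW r0 rq (carrier_interior q).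
apply: open_nbhs_nbhs; split; first exact: star_open.
suff : star (carrier q) (val (cpoint q)) r (point_of (carrier q) (cpoint q)) by rewrite carrierK.
by apply/star_point => //; exact: near_face_refl.
Qed.

(** The face witnessing that the point lies in the star of radius [r] is the same for every small
    [r], so the distance that it bounds is zero. *)
Lemma carrier_face n (c : K n) (p : set_type (unit_cube R n)) :
  exists2 f, face f c = carrier (point_of c p) &
    val p = face_point f (val (cpoint (point_of c p))).
Proof.
set q := point_of c p.
have near (r : R) : 0 < r -> r <= cradius q -> near_face (carrier q) (val (cpoint q)) r c (val p).
  move=> r0 rq; have I := interior_ptW r0 rq (carrier_interior q).
  by apply/star_point => //; exact: nbhs_singleton (carrier_star_nbhs r0 rq).
have [f fc H] := near _ (cradius_gt0 q) (lexx _).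
exists f => //; apply/rowP => j; apply/eqP; rewrite -subr_eq0 -normr_eq0.
apply: contraT => ne0; set d := `|_| in ne0.
have d0 : 0 < d by rewrite lt_def ne0 normr_ge0.
pose r := Num.min (cradius q) d.
have r0 : 0 < r by rewrite lt_min cradius_gt0.
have rq : r <= cradius q by rewrite ge_min lexx.
have [f' fc' H'] := near _ r0 rq.
have ff' : f = f'.
  apply: (near_face_uniq (carrier_interior q) fc fc' H) => i.
  exact: lt_le_trans (H' i) rq.
have rd : r <= d by rewrite ge_min lexx orbT.
by have := lt_le_trans (H' j) rd; rewrite -ff' ltxx.
Qed.

Lemma carrier_star_face b q : carrier_star b q ->
  near_face (carrier b) (val (cpoint b)) (cradius b) (carrier q) (val (cpoint q)).
Proof.
by rewrite -{1}(carrierK q) => /(star_point _ _ _ (carrier_interior b)).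
Qed.

Lemma carrier_vertex n (c : K n) (p : set_type (unit_cube R n)) (f : faceMap _ n)
    (a : {ffun 'I_n -> bool}) :
  face f c = carrier (point_of c p) ->
  val p = face_point f (val (cpoint (point_of c p))) ->
  (forall j, val p ord0 j = (a j)%:R) -> fcorner f = a.
Proof.
move=> fc pE pa; apply/ffunP => j; have := pa j; rewrite pE.
case E: (fcoord f j) => [i|]; last first.
  rewrite (face_point_out _ E); case: (fcorner f j); case: (a j) => //= /eqP.
    by rewrite oner_eq0.
  by rewrite eq_sym oner_eq0.
rewrite -(fcoordP E) face_point_fdir.
have [r0 r4 /(_ i)] := carrier_interior (point_of c p).
by move: {fc pE pa E} r0 r4 => r0 r4; case: (fcorner _ _); case: (a _) => //= /andP[? ?] ?; lra.
Qed.

End Carrier.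

(** * The sheaf on the realization defined by a local system *)

Section Sheaf.
Variables (R : realType) (K : cubeComplex) (Phi : Type) (T : K 1 -> Phi -> Phi).
Hypothesis TT : local_system T.
Local Notation real := (realization R K).
Implicit Types (b q : real).

(** For [q] in the star of [b], the origin of the carrier of [b] is a corner of the carrier of [q],
    and transport to that corner compares the two fibres. Outside the star [id] is a dummy. *)
Definition sheet b q : Phi -> Phi :=
  if pselect (near_face (carrier b) (val (cpoint b)) (cradius b) (carrier q) (val (cpoint q)))
  is left H then transport T (carrier q) (fcorner (s2val (cid2 H))) else id.

Lemma sheetE b q (f : faceMap _ _) : face f (carrier q) = carrier b ->
  (forall j, `|val (cpoint q) ord0 j - face_point f (val (cpoint b)) ord0 j| < cradius b) ->
  sheet b q = transport T (carrier q) (fcorner f).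
Proof.
move=> fc H; rewrite /sheet; case: pselect => [H'|[]]; last by exists f.
case: cid2 => f' /= fc' H''; congr (transport _ _ (fcorner _)).
exact: (near_face_uniq (carrier_interior b) fc' fc H'').
Qed.

(** The cocycle rule is [transport_face] for a face of a face; the work is to shrink the star of [q]
    into that of [b]. *)
Lemma realization_sheaf : locally_constant_sheaf (@carrier_star R K) sheet.
Proof.
split.
- by move=> b; exact: carrier_star_nbhs (cradius_gt0 b) (lexx _).
- move=> b x; rewrite (sheetE (face_id (carrier b))); first exact: transport0.
  by move=> j; rewrite face_point_id subrr normr0 cradius_gt0.
- move=> b q /carrier_star_face[f fc H]; rewrite (sheetE fc H).
  exact: transport_bij.
move=> b q /carrier_star_face[f fc H].
(* The slack of [q] inside the star of [b], coordinate by coordinate. *)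
have F0 j : 0 < cradius b - `|val (cpoint q) ord0 j - face_point f (val (cpoint b)) ord0 j|.
  by rewrite subr_gt0.
have m0 : 0 < Num.min (cradius q) (cradius b) by rewrite lt_min !cradius_gt0.
have [r [r0 + rb]] := min_family m0 F0; rewrite le_min => /andP[rq rb'].
apply: filterS (carrier_star_nbhs r0 rq) => q'.
have I := interior_ptW r0 rq (carrier_interior q).
rewrite -{1}(carrierK q') => /(star_point _ _ _ I)[g gc Hg].
have Hg' j : `|val (cpoint q') ord0 j - face_point g (val (cpoint q)) ord0 j| < cradius q.
  exact: lt_le_trans (Hg j) rq.
have gf : face (comp_face g f) (carrier q') = carrier b by rewrite -face_comp gc.
have Hgf j : `|val (cpoint q') ord0 j -
    face_point (comp_face g f) (val (cpoint b)) ord0 j| < cradius b.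
  rewrite face_point_comp -[X in `|X|](subrKA (face_point g (val (cpoint q)) ord0 j)).
  apply: le_lt_trans (ler_normD _ _) _.
  case E: (fcoord g j) => [i|]; last first.
    rewrite !(face_point_out _ E) subrr normr0 addr0 -(face_point_out (val (cpoint q)) E).
    exact: lt_le_trans (Hg j) rb'.
  have := Hg j; have := rb i; rewrite -(fcoordP E) !face_point_fdir lerBrDr => rbi Hgi.
  apply: lt_le_trans rbi; rewrite ltr_leD //.
  by case: (fcorner g _) => //; rewrite opprB addrC addrA subrK distrC.
split.
  by rewrite /carrier_star -{1}(carrierK q'); apply/star_point;
    [exact: carrier_interior | exists (comp_face g f)].
move=> x; rewrite (sheetE fc H) (sheetE gc Hg') (sheetE gf Hgf) /=.
by rewrite transport_face // gc.
Qed.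

Lemma point_of_continuous n (c : K n) : continuous (@point_of R K n c).
Proof.
move=> p; apply: (@continuous_comp _ _ _ (param_point c) (\pi_(realization R K)%qT)).
  exact: existT_continuous.
exact: pi_continuous.
Qed.

(** The section at time [t] is the transport of [x] inside [c] to the origin of the carrier of the
    point reached. *)
Lemma cube_carries n (c : K n) (l : R -> set_type (unit_cube R n)) x
    (a b : {ffun 'I_n -> bool}) :
  {within `[0, 1], continuous l} ->
  (forall j, val (l 0) ord0 j = (a j)%:R) -> (forall j, val (l 1) ord0 j = (b j)%:R) ->
  carries sheet (point_of c \o l) (transport T c a x) (transport T c b x).
Proof.
move=> lc la lb.
pose f t := s2val (cid2 (carrier_face c (l t))).
have fc t : face (f t) c = carrier (point_of c (l t)) by rewrite /f; case: cid2.
have fp t : val (l t) = face_point (f t) (val (cpoint (point_of c (l t)))).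
  by rewrite /f; case: cid2.
exists (fun t => transport T c (fcorner (f t)) x); split; last first.
- by rewrite (carrier_vertex (fc 1) (fp 1) lb).
- by rewrite (carrier_vertex (fc 0) (fp 0) la).
move=> t It.
have gc : {within `[0, 1], continuous (point_of c \o l)}.
  apply: (within_comp (W := setT)) lc _ _ => //.
  exact/continuous_subspaceT/point_of_continuous.
have r0 := cradius_gt0 (point_of c (l t)).
have Ht j : `|val (l t) ord0 j -
    face_point (f t) (val (cpoint (point_of c (l t)))) ord0 j| < cradius (point_of c (l t)).
  by rewrite -fp subrr normr0.
have {Ht}Hl : \forall w \near t, `[0, 1]%classic w -> forall j, `|val (l w) ord0 j -
    face_point (f t) (val (cpoint (point_of c (l t)))) ord0 j| < cradius (point_of c (l t)).
  by move/within_nearP: lc => /(_ t It _ (near_coords Ht)).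
have [Nn _ _ _] := realization_sheaf.
move/within_nearP: gc => /(_ t It _ (Nn _)) /(filterI Hl).
apply: filterS => w [Hw H] Iw; have {Hw H} [Hw] := (Hw Iw, H Iw).
move/carrier_star_face => [g gw Hg].
rewrite (sheetE gw Hg) -(fc w) -transport_face //.
rewrite -[face_vertex _ _]/(fcorner (comp_face (f w) g)); congr (transport _ _ (fcorner _) _).
have gf : face (comp_face (f w) g) c = carrier (point_of c (l t)).
  by rewrite -face_comp fc.
apply: (near_face_uniq (carrier_interior _) (fc t) gf Hw) => j.
by rewrite face_point_comp (fp w); exact: face_point_dist.
Qed.

End Sheaf.

(** * Transport along edge paths, and edge connectedness *)

Section EdgePathTransport.
Variables (R : realType) (K : cubeComplex).

Lemma unit_cube_const (t : R) : 0 <= t <= 1 -> (const_mx t : 'rV[R]_1) \in unit_cube R 1.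
Proof. by move=> t01; apply/mem_set => i; rewrite mxE. Qed.

Let edge_coord (t : R) : set_type (unit_cube R 1) := insubd (cube_origin R 1) (const_mx t).

Lemma edge_coordE t : 0 <= t <= 1 -> val (edge_coord t) = const_mx t.
Proof. by move=> t01; rewrite /edge_coord val_insubd unit_cube_const. Qed.

Lemma edge_coord_within : {within `[0, 1], continuous edge_coord}.
Proof.
apply: continuous_comp_initial.
have : {within `[0, 1], continuous (fun t : R => const_mx t : 'rV[R]_1)}.
  apply: continuous_subspaceT => t U /nbhs_ballP[e /= e0 H].
  apply/nbhs_ballP; exists e => // s ts; apply: H.
  by split=> // i j; rewrite !mxE.
apply: subspace_eq_continuous => t /set_mem /=; rewrite in_itv /= => t01.
by rewrite /from_subspace /= -edge_coordE.
Qed.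

Lemma edge_point_end (e : K 1) (b : bool) :
  edge_point e (b%:R : R) = vertex_point R (face (vertex_face [ffun=> b]) e).
Proof.
apply/esym/gclassP/rst_step/Glue.
rewrite edge_coordE; last by case: b; rewrite /= ?lexx ler01.
apply/rowP => j; rewrite !mxE /fcoord.
by case: pickP => [[]//|_]; rewrite ffunE.
Qed.

Lemma edge_point0 (e : K 1) : edge_point e (0 : R) = vertex_point R (source e).
Proof. exact: (edge_point_end e false). Qed.

Lemma edge_point1 (e : K 1) : edge_point e (1 : R) = vertex_point R (target e).
Proof. exact: (edge_point_end e true). Qed.

Lemma edge_point_within (e : K 1) : {within `[0, 1], continuous (@edge_point R K e)}.
Proof.
apply: (within_comp (W := setT)) edge_coord_within _ _ => //.
exact/continuous_subspaceT/point_of_continuous.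
Qed.

Lemma trace_path (x : K 0) p (y : K 0) : is_edge_path x p y ->
  is_path (vertex_point R x) (vertex_point R y) (@trace R K x p).
Proof.
elim: p x => [|e p IH] x /=.
  move=> ->; split => //; apply: continuous_subspaceT; exact: cst_continuous.
move=> [<- /IH[pc p0 p1]]; split.
- by apply: concat_within => //; [exact: edge_point_within | rewrite edge_point1].
- by rewrite concat_left ?invr_ge0 ?ler0n // mulr0 edge_point0.
- rewrite concat_right ?edge_point1 //; last by lra.
  by rewrite -p1; congr (trace _ _ _); lra.
Qed.

Section Transport.
Variables (Phi : Type) (T : K 1 -> Phi -> Phi).
Hypothesis TT : local_system T.

Lemma edge_carries e z : carries (sheet (R := R) T) (edge_point e) z (T e z).
Proof.
have := @cube_carries R K _ _ TT _ e edge_coord z (zerov 1) (flipv (zerov 1) ord0)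
  edge_coord_within.
rewrite transport_edge // transport0 edge1; apply => j.
  by rewrite edge_coordE ?lexx ?ler01 // !mxE ffunE.
by rewrite edge_coordE ?lexx ?ler01 // !mxE !ffunE (ord1 j).
Qed.

Lemma trace_carries x p y z : is_edge_path x p y ->
  carries (sheet (R := R) T) (@trace R K x p) z (foldl (fun w e => T e w) z p).
Proof.
have S := realization_sheaf R TT.
elim: p x z => [|e p IH] x z /=; first by move=> _; exact: carries_cst S _ _.
move=> [_ /[dup] /trace_path[_ p0 _] /IH H].
by apply: carries_concat (edge_carries e z) (H _); rewrite edge_point1.
Qed.

Theorem homotopic_transport x p q y z : is_edge_path x p y -> is_edge_path x q y ->
  homotopic (vertex_point R x) (vertex_point R y) (@trace R K x p) (@trace R K x q) ->
  foldl (fun w e => T e w) z p = foldl (fun w e => T e w) z q.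
Proof.
move=> xp xq pq; apply: (carries_homotopic (realization_sheaf R TT) _ _ pq).
- exact: trace_path.
- exact: trace_path.
- exact: trace_carries xp.
- exact: trace_carries xq.
Qed.

End Transport.

Definition edge_connected (x y : K 0) := exists p, is_edge_path x p y.

Lemma edge_path_cat (x : K 0) p y q z : is_edge_path x p y -> is_edge_path y q z ->
  is_edge_path x (p ++ q) z.
Proof.
elim: p x => [|e p IH] x /=; first by move=> ->.
by move=> [xe ep] yz; split => //; exact: IH.
Qed.

Lemma edge_path_rev (x : K 0) p y : is_edge_path x p y ->
  is_edge_path y (seq.rev (map (@rev K) p)) x.
Proof.
elim: p x => [|e p IH] x /=; first by move=> ->.
move=> [xe /IH ep]; rewrite rev_cons -cats1; apply: edge_path_cat ep _.
by rewrite /= source_rev target_rev.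
Qed.

Lemma edge_connected_vx n (c : K n) a b : edge_connected (vx c a) (vx c b).
Proof.
suff H b' : edge_connected (vx c (zerov n)) (vx c b').
  have [p Hp] := H a; have [q Hq] := H b.
  by exists (seq.rev (map (@rev K) p) ++ q); apply: edge_path_cat Hq; exact: edge_path_rev.
suff H k : edge_connected (vx c (zerov n)) (vx c (truncv b' k)).
  by rewrite -(truncv_ge b' (leqnn n)); exact: H.
elim: k => [|k [p Hp]].
  by rewrite truncv0; exists [::].
have [kn|nk] := ltnP k n; last by exists p; move: Hp; rewrite !truncv_ge // leqW.
rewrite (truncvS b' (Ordinal kn)); case: ifP => _; last by exists p.
exists (p ++ [:: edge c (Ordinal kn) (truncv b' k)]); apply: edge_path_cat Hp _.
by rewrite /= source_edge target_edge.
Qed.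

(** The carrier at time [t] is a face of the carrier at all nearby times, so the edge component of
    the carrier does not change along the path. *)
Lemma path_edge_connected (x y : K 0) (g : R -> realization R K) :
  is_path (vertex_point R x) (vertex_point R y) g -> edge_connected x y.
Proof.
move=> [gc g0 g1].
have base (q : realization R K) n (c : K n) (f : faceMap (cdim q) n) a b :
    face f c = carrier q -> edge_connected (vx c a) (vx (carrier q) b).
  by move=> <-; rewrite vx_face; exact: edge_connected_vx.
have vtx (v : K 0) : vx (carrier (vertex_point R v)) (zerov _) = v.
  have [f fc _] := carrier_face v (cube_origin R 0).
  rewrite -fc vx_face /vx -[RHS]face_id; congr (face _ _).
  by apply: faceMap0; apply/ffunP => -[].
pose P t := edge_connected x (vx (carrier (g t)) (zerov _)).
suff : P 0 -> P 1.
  rewrite /P g0 g1 !vtx; apply; by exists [::].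
apply: (@interval_chain R (fun a b => P a -> P b)); first by auto.
move=> t t01.
have tI : `[0, 1]%classic t by rewrite /= in_itv.
move/within_nearP: gc => /(_ t tI _ (carrier_star_nbhs (cradius_gt0 _) (lexx _))).
move/nbhs_near => [d d0 H]; exists d => // a b a0 at_ tb b1 ta bt.
have near w : 0 <= w -> w <= 1 -> t - d < w -> w < t + d -> P w <-> P t.
  move=> w0 w1 wt tw; have := H w wt tw.
  rewrite /= in_itv /= w0 w1 => /(_ isT)/carrier_star_face[f fc _].
  have [p pE] := base _ _ _ _ (zerov _) (zerov _) fc.
  split=> -[q qE].
    by exists (q ++ p); exact: edge_path_cat pE.
  by exists (q ++ seq.rev (map (@rev K) p)); exact: edge_path_cat (edge_path_rev pE).
by rewrite (near a) 1?(near b) //; lra.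
Qed.

End EdgePathTransport.

(** * Finiteness of the cells of a compact complex *)

Section Compact.
Variables (R : realType) (K : cubeComplex).
Hypothesis Kcompact : compact [set: realization R K].

Definition cell n (c : K n) : cells K := existT (fun n => K n : Type) n c.

(** Finitely many stars cover. The barycenter of [c] is at distance 1/2 from every proper face, more
    than any radius, so the carrier whose star contains it is [c] up to a symmetry. *)
Lemma cells_finite_sym : exists s : seq (cells K), forall n (c : K n),
  exists2 b, b \in s & exists2 f : faceMap (tag b) n,
    face f c = tagged b & forall j, fcoord f j != None.
Proof.
have [[n0 [c0 _]]|nocell] := pselect (exists n (c : K n), True); last first.
  by exists [::] => n c; case: nocell; exists n, c.
(* [compact_cover] wants a pointed space, hence the separate treatment of the empty complex. *)
pose T : ptopologicalType := HB.pack (realization R K)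
  (isPointed.Build _ (point_of c0 (cube_origin R n0))).
have : @compact T setT by exact: Kcompact.
rewrite compact_cover => /(_ (realization R K) setT (@carrier_star R K)).
case.
- by move=> b _; apply: star_open; exact: carrier_interior.
- by move=> b _; exists b => //; exact: nbhs_singleton (carrier_star_nbhs (cradius_gt0 b) (lexx _)).
move=> D _ cov.
exists [seq cell (carrier b) | b <- (D : {fset realization R K})] => n c.
have [b bD] := cov (point_of c (barycenter R n)) Logic.I.
move=> /(star_point _ _ _ (carrier_interior b))[f fc H].
have [r0 r4 _] := carrier_interior b.
exists (cell (carrier b)); first by apply/mapP; exists b.
exists f => // j.
apply/eqP => E; have := H j; rewrite (face_point_out _ E) !mxE.
by clear -r0 r4; case: (fcorner f j); rewrite ltr_norml /= => /andP[? ?]; lra.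
Qed.

(** Enumerates the symmetries by a finite type of pairs; a pair with non-injective directions is
    sent to the identity. *)
Definition mk_faceMap n (u : {ffun 'I_n -> 'I_n} * {ffun 'I_n -> bool}) : faceMap n n :=
  if (insub u.1 : option {d : {ffun 'I_n -> 'I_n} | injectiveb d}) is Some d
  then FaceMap u.2 (valP d) else id_face n.

Lemma mk_faceMapK n (f : faceMap n n) : mk_faceMap (fdir f, fcorner f) = f.
Proof.
rewrite /mk_faceMap /= .
case: insubP => [d _ dE|]; last by rewrite fdir_inj.
exact: faceMap_eq.
Qed.

Lemma faceMap_surj m n (f : faceMap m n) : (forall j, fcoord f j != None) -> m = n.
Proof.
move=> fs; apply/eqP; rewrite eqn_leq (faceMap_leq f) /=.
have ex j : exists i, fdir f i == j.
  by have := fs j; case E: fcoord => [i|] // _; exists i; rewrite (fcoordP E).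
rewrite -(card_ord n) -(card_ord m); apply: (@leq_card _ _ (fun j => xchoose (ex j))).
by move=> i j e; rewrite -(eqP (xchooseP (ex i))) e (eqP (xchooseP (ex j))).
Qed.

Lemma cells_finite n : exists s : seq (K n), forall c, c \in s.
Proof.
have [s sP] := cells_finite_sym.
pose F (b : cells K) : seq (K n) :=
  if tag b =P n is ReflectT e then
    [seq face (mk_faceMap u) (ecast i (K i) e (tagged b)) | u : {ffun 'I_n -> 'I_n} * {ffun 'I_n -> bool}]
  else [::].
exists (flatten [seq F b | b <- s]) => c.
have [b bs [f fc fs]] := sP n c.
apply/flatten_mapP; exists b => //; rewrite /F.
case: eqP (faceMap_surj fs) => // e _.
case: b {bs F} e f fc fs => m c' /= e; case: n / e c => c f fc fs.
have [||g fg] := @face_factor m m m (id_face m) f.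
- by move=> i; exact: fs.
- by move=> j E; have := fs j; rewrite E.
apply/mapP; exists (fdir g, fcorner g); first exact: mem_enum.
by rewrite mk_faceMapK -fc face_comp -fg face_id.
Qed.

End Compact.

(** * Operations on homotopies *)

Lemma within_compT (S S' T : topologicalType) (l : S' -> S) (g : S -> T) W W' :
  continuous l -> (forall z, W' z -> W (l z)) ->
  {within W, continuous g} -> {within W', continuous (fun z => g (l z))}.
Proof. by move=> cl lW; apply: (within_comp _ lW); exact: continuous_subspaceT. Qed.

Section Homotopies.
Variables (R : realType) (T : topologicalType).
Implicit Types (x y : T) (p q : R -> T).
Local Notation I01 := (`[0%R, 1%R]%classic : set R).
Local Notation square := (`[0%R, 1%R] `*` `[0%R, 1%R] : set (R * R)).

Lemma in01 (t : R) : t \in `[0, 1] <-> 0 <= t <= 1.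
Proof. by rewrite in_itv. Qed.

Lemma set01 (t : R) : I01 t <-> 0 <= t <= 1.
Proof. by rewrite /= in_itv. Qed.

Lemma homotopic_sym x y p q : homotopic x y p q -> homotopic x y q p.
Proof.
move=> [H [cH H0 H1 Hx Hy]]; exists (fun z => H (z.1, 1 - z.2)); split.
- apply: (within_compT (l := fun z : R * R => (z.1, 1 - z.2 : R)) _ _ cH).
    apply: continuous_pair; first by move=> z; exact: cvg_fst.
    by move=> z; apply: cvgB; [exact: cvg_cst|exact: cvg_snd].
  move=> [t s] [] /set01 /= tI /set01 /= sI.
  by split; apply/set01 => /=; lra.
- by move=> t tI; rewrite /= subr0 H1.
- by move=> t tI; rewrite /= subrr H0.
- by move=> s /in01 sI; rewrite /= Hx //; apply/in01; lra.
- by move=> s /in01 sI; rewrite /= Hy //; apply/in01; lra.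
Qed.

Lemma homotopic_trans x y p q r :
  homotopic x y p q -> homotopic x y q r -> homotopic x y p r.
Proof.
move=> [H [cH H0 H1 Hx Hy]] [H' [cH' H0' H1' Hx' Hy']].
pose L (z : R * R) : T := H (z.1, 2 * z.2); pose L' (z : R * R) : T := H' (z.1, 2 * z.2 - 1).
pose J z := if z.2 <= 2^-1 then L z else L' z.
have JL z : z.2 <= 2^-1 -> J z = L z by rewrite /J => ->.
have JL' z : I01 z.1 -> 2^-1 <= z.2 -> J z = L' z.
  move=> tI; rewrite /J le_eqVlt => /orP[/eqP e|]; last by rewrite ltNge => /negPf ->.
  rewrite -e lexx /L /L' -e mulfV ?subrr ?H1 ?H0' ?pnatr_eq0 //; exact/in01/set01.
exists J; split.
- have -> : square = (`[0%R, 1%R] `*` `[0%R, 2^-1%R]) `|` (`[0%R, 1%R] `*` `[2^-1%R, 1%R]).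
    rewrite [X in _ `*` X](I01E R); apply/seteqP; split=> [[t s] [tI [sI|sI]]|[t s] [[tI sI]|[tI sI]]].
    - by left.
    - by right.
    - by split=> //; left.
    - by split=> //; right.
  apply: withinU_continuous; try by apply: rect_closed.
    suff : {within `[0%R, 1%R] `*` `[0%R, 2^-1%R], continuous L}.
      apply: subspace_eq_continuous => -[t s] /set_mem[_ /=]; rewrite in_itv /= => /andP[_ s1].
      by rewrite /from_subspace JL.
    apply: (within_compT (l := fun z : R * R => (z.1, 2 * z.2 : R)) _ _ cH).
      apply: continuous_pair; first by move=> z; exact: cvg_fst.
      by move=> z; apply: cvgM; [exact: cvg_cst|exact: cvg_snd].
    move=> [t s] [] /= tI; rewrite in_itv /= => /andP[s0 s1]; split=> //=.
    by rewrite in_itv /=; lra.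
  suff : {within `[0%R, 1%R] `*` `[2^-1%R, 1%R], continuous L'}.
    apply: subspace_eq_continuous => -[t s] /set_mem[tI /=]; rewrite in_itv /= => /andP[s1 _].
    by rewrite /from_subspace JL'.
  apply: (within_compT (l := fun z : R * R => (z.1, 2 * z.2 - 1 : R)) _ _ cH').
    apply: continuous_pair; first by move=> z; exact: cvg_fst.
    move=> z; apply: cvgB; last exact: cvg_cst.
    by apply: cvgM; [exact: cvg_cst|exact: cvg_snd].
  move=> [t s] [] /= tI; rewrite in_itv /= => /andP[s0 s1]; split=> //=.
  by rewrite in_itv /=; lra.
- by move=> t tI; rewrite JL ?invr_ge0 ?ler0n // /L /= mulr0 H0.
- move=> t tI; rewrite JL' /=; [|exact/set01/in01|by lra].
  by rewrite /L' /= mulr1 (_ : 2 - 1 = 1) ?H1' //; ring.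
- move=> s /in01 sI; rewrite /J /L /L' /=; case: leP => s2.
    by rewrite Hx //; apply/in01; lra.
  by rewrite Hx' //; apply/in01; lra.
- move=> s /in01 sI; rewrite /J /L /L' /=; case: leP => s2.
    by rewrite Hy //; apply/in01; lra.
  by rewrite Hy' //; apply/in01; lra.
Qed.

(* The homotopy t -> H((1 - t) b(s) + t (1/2, 0)), where b runs along the three
   sides of the square on which the contraction H of p q^-1 is constant. *)
Lemma simply_connected_homotopic x y p q : simply_connected R T ->
  is_path x y p -> is_path x y q -> homotopic x y p q.
Proof.
move=> [_ sc] [cp p0 p1] [cq q0 q1].
pose r t : T := q (1 - t).
have cr : {within I01, continuous r}.
  apply: (within_compT (l := fun t : R => 1 - t : R) _ _ cq).
    by move=> t; apply: cvgB; [exact: cvg_cst|exact: cvg_id].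
  by move=> t /set01 tI; apply/set01; lra.
have pr : p 1 = r 0 by rewrite /r subr0 p1 q1.
have pl : is_path x x (concat p r).
  split; first exact: concat_within.
    by rewrite concat_left ?invr_ge0 ?ler0n // mulr0.
  rewrite concat_right //; last by lra.
  by rewrite /r (_ : 1 - _ = 0) //; ring.
have [H [cH H0 H1 Hx Hy]] := sc _ _ pl.
(* In thirds of [0,1] the point (b1, b2) climbs the left side from (0, 0), crosses the top and
   descends the right side to (1, 0). *)
pose b1 (s : R) := Num.min 1 (Num.max 0 (3 * s - 1)).
pose b2 (s : R) := Num.min 1 (Num.min (3 * s) (3 - 3 * s)).
pose phi (z : R * R) := ((1 - z.1) * b1 z.2 + z.1 * 2^-1, (1 - z.1) * b2 z.2).
have cl (k : R) : continuous (fun s : R => 3 * s + k).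
  by move=> s; apply: cvgD; [apply: cvgM; [exact: cvg_cst|exact: cvg_id]|exact: cvg_cst].
have cl' : continuous (fun s : R => 3 - 3 * s).
  by move=> s; apply: cvgB; [exact: cvg_cst|apply: cvgM; [exact: cvg_cst|exact: cvg_id]].
have cb1 : continuous b1.
  move=> s; apply: (@continuous_min R R (fun=> 1) (fun s => Num.max 0 (3 * s - 1))).
    exact: cvg_cst.
  by apply: (@continuous_max R R (fun=> 0) (fun s => 3 * s - 1)); [exact: cvg_cst|exact: cl].
have cb2 : continuous b2.
  move=> s; apply: (@continuous_min R R (fun=> 1) (fun s => Num.min (3 * s) (3 - 3 * s))).
    exact: cvg_cst.
  apply: (@continuous_min R R (fun s => 3 * s) (fun s => 3 - 3 * s)); last exact: cl'.
  by apply: cvgM; [exact: cvg_cst|exact: cvg_id].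
have bI s : 0 <= s <= 1 -> [/\ 0 <= b1 s <= 1, 0 <= b2 s <= 1 & b1 s = 0 \/ b1 s = 1 \/ b2 s = 1].
  move=> sI; have [s1|s1] := leP (3 * s) 1.
    have -> : b1 s = 0 by rewrite /b1 max_l ?min_r //; lra.
    have -> : b2 s = 3 * s by rewrite /b2 [Num.min (3 * s) _]min_l ?min_r //; lra.
    by split; [lra|lra|left].
  have [s2|s2] := leP (3 * s) 2.
    have -> : b1 s = 3 * s - 1 by rewrite /b1 max_r ?min_r //; lra.
    have -> : b2 s = 1 by rewrite /b2 min_l // le_min; apply/andP; split; lra.
    by split; [lra|lra|right; right].
  have -> : b1 s = 1 by rewrite /b1 min_l // le_max; apply/orP; right; lra.
  have -> : b2 s = 3 - 3 * s by rewrite /b2 [Num.min (3 * s) _]min_r ?min_r //; lra.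
  by split; [lra|lra|right; left].
have Hb s : 0 <= s <= 1 -> H (b1 s, b2 s) = x.
  move=> /bI[b1I b2I [->|[->|->]]]; [exact/Hx/in01|exact/Hy/in01|exact/H1/in01].
exists (H \o phi); split.
- apply: (within_compT _ _ cH).
    apply: continuous_pair => z.
      apply: cvgD.
        apply: cvgM; first by apply: cvgB; [exact: cvg_cst|exact: cvg_fst].
        by apply: cvg_comp; [exact: cvg_snd|exact: cb1].
      by apply: cvgM; [exact: cvg_fst|exact: cvg_cst].
    apply: cvgM; first by apply: cvgB; [exact: cvg_cst|exact: cvg_fst].
    by apply: cvg_comp; [exact: cvg_snd|exact: cb2].
  move=> [t s] [] /set01 /= /andP[t0 t1] /set01 /bI[/andP[u0 u1] /andP[v0 v1] _].
  by split; apply/set01; rewrite /phi /=; apply/andP; split; nra.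
- move=> t /in01 tI; rewrite /phi /= (_ : b1 0 = 0); last by rewrite /b1 max_l ?min_r //; lra.
  rewrite (_ : b2 0 = 0); last by rewrite /b2 mulr0 subr0 [Num.min 0 _]min_l ?min_r //; lra.
  rewrite !mulr0 add0r H0; last by apply/in01; lra.
  by rewrite concat_left; [congr p; field|lra].
- move=> t /in01 tI; rewrite /phi /= (_ : b1 1 = 1); last by rewrite /b1 min_l // le_max; apply/orP; right; lra.
  rewrite (_ : b2 1 = 0); last by rewrite /b2 mulr1 subrr [Num.min 3 _]min_r ?min_r //; lra.
  rewrite mulr0 mulr1 H0; last by apply/in01; lra.
  rewrite concat_right //; last by lra.
  by rewrite /r; congr q; field.
- by move=> s /in01 sI; rewrite /phi /= subr0 !mul1r mul0r addr0 Hb.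
- move=> s /in01 sI; rewrite /phi /= subrr !mul0r add0r mul1r H0; last by apply/in01; lra.
  by rewrite concat_left // mulfV ?pnatr_eq0.
Qed.

End Homotopies.

Lemma homotopic_image (R : realType) (T T' : topologicalType) (f : T -> T') x y (p q : R -> T) :
  continuous f -> homotopic x y p q -> homotopic (f x) (f y) (f \o p) (f \o q).
Proof.
move=> cf [H [cH H0 H1 Hx Hy]]; exists (f \o H); split.
- by apply: (within_comp (W := setT) cH) => //; exact: continuous_subspaceT.
- by move=> t tI; rewrite /= H0.
- by move=> t tI; rewrite /= H1.
- by move=> t tI; rewrite /= Hx.
- by move=> t tI; rewrite /= Hy.
Qed.

(** * Geodesics *)

Local Close Scope ring_scope.
Local Close Scope classical_set_scope.

(** * Squares and cubes at a vertex *)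

Section VertexLinks.
Variable X : cubeComplex.

Lemma link_cube0 (v : X 0) j (c : X (0 + j)) : link_cube v c <-> vx (c : X j) (zerov j) = v.
Proof.
rewrite /link_cube /vx.
suff -> : base_face 0 j = (vertex_face (zerov j) : faceMap 0 (0 + j)) by [].
exact: faceMap0.
Qed.

Lemma link_vertex0 j (c : X (0 + j)) (i : 'I_j) :
  link_vertex (k := 0) c i = edge (c : X j) i (zerov j) :> X 1.
Proof.
rewrite /link_vertex /edge; congr (face _ c).
apply: (@faceMap_eq 1 j) => //; apply/ffunP => l; rewrite !ffunE /spike.
by case: split_ordP => [[]//|k _]; apply/val_inj.
Qed.

Definition adjacent (e f : X 1) := exists2 c : X 2, bottom_edge c = e & left_edge c = f.

Hypothesis simplicial : forall v : X 0, link_is_simplicial v.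

Lemma edges_at_inj n (c : X n) : injective (fun i => edge c i (zerov n)).
Proof.
have [H _] := simplicial (vx c (zerov n)).
have := H n c; rewrite link_cube0 => /(_ erefl) inj i j e.
by apply: inj; rewrite !link_vertex0.
Qed.

Lemma cube_uniq n (c c' : X n) : vx c (zerov n) = vx c' (zerov n) ->
  (forall i, edge c i (zerov n) = edge c' i (zerov n)) -> c = c'.
Proof.
move=> v e; have [_ H] := simplicial (vx c (zerov n)).
apply: (H n c c'); rewrite ?link_cube0 // => i.
by have := e i; rewrite -!link_vertex0.
Qed.

Lemma ord2P (i : 'I_2) : i = ord0 \/ i = ord_max.
Proof. by case: i => [[|[|[]]]// H]; [left|right]; apply/val_inj. Qed.

Lemma adjacent_simplex (v : X 0) (e f : X 1) : source e = v -> adjacent e f ->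
  link_simplex v ([fset e; f]%fset : {fset X (0 + 1)}).
Proof.
move=> ev [c ce cf]; exists 2, c; split.
  by apply/link_cube0; rewrite -ev -ce source_edge.
apply/fsetP => g; rewrite !inE; apply/orP/imfsetP => /=.
  move=> [/eqP->|/eqP->]; [exists ord0|exists ord_max] => //; rewrite link_vertex0.
    by rewrite -ce.
  by rewrite -cf.
move=> [i _ ->]; rewrite link_vertex0; case: (ord2P i) => ->; [left|right].
  by rewrite -ce.
by rewrite -cf.
Qed.

Hypothesis flag : forall v : X 0, link_is_flag v.

(** Flagness gives a cube with the right set of edges in some order; the face along [h] restores the
    given numbering. *)
Lemma flag_cube n (v : X 0) (e : 'I_n -> X 1) : injective e ->
  (forall i, source (e i) = v) -> (forall i j, i != j -> adjacent (e i) (e j)) ->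
  exists2 c : X n, vx c (zerov n) = v & forall i, edge c i (zerov n) = e i.
Proof.
move=> einj es eadj.
pose A : {fset X (0 + 1)} := [fset e i | i in 'I_n]%fset.
have AP f : f \in A -> exists i, f = e i by move=> /imfsetP[i _ ->]; exists i.
have [||m [c [cv AE]]] := flag (v := v) (A := A).
- by move=> f /AP[i ->]; apply/link_cube0; rewrite -(es i) -{2}(edge1 (e i)) source_edge.
- move=> f g /AP[i ->] /AP[j ->] ij; apply: adjacent_simplex => //.
  by apply: eadj; apply: contraNneq ij => ->.
have ex i : exists k, edge (c : X m) k (zerov m) == e i.
  have : (e i : X (0 + 1)) \in A by apply/imfsetP; exists i.
  by rewrite AE => /imfsetP[k _ eik]; exists k; rewrite -link_vertex0 -eik.
pose h i := xchoose (ex i).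
have hE i : edge (c : X m) (h i) (zerov m) = e i by apply/eqP; exact: (xchooseP (ex i)).
have hi : injective h by move=> i j ij; apply: einj; rewrite -!hE ij.
exists (face (subface hi (zerov m)) (c : X m)).
  by rewrite vx_face (face_vertex0 (subface hi _)); apply/link_cube0.
by move=> i; rewrite edge_face (face_vertex0 (subface hi _)) ffunE.
Qed.

Definition Square (b r l t : X 1) := exists c : X 2,
  [/\ bottom_edge c = b, right_edge c = r, left_edge c = l & top_edge c = t].

Lemma Square_cube n (c : X n) i j a : i != j ->
  Square (edge c i a) (edge c j (flipv a i)) (edge c j a) (edge c i (flipv a j)).
Proof. by move=> ij; exists (square c ij a); rewrite !square_sides. Qed.

Lemma Square_ind (P : X 1 -> X 1 -> X 1 -> X 1 -> Prop) :
  (forall c : X 2, P (edge c ord0 (zerov 2)) (edge c ord_max (flipv (zerov 2) ord0))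
     (edge c ord_max (zerov 2)) (edge c ord0 (flipv (zerov 2) ord_max))) ->
  forall b r l t, Square b r l t -> P b r l t.
Proof. by move=> H b r l t [c [<- <- <- <-]]; exact: H. Qed.

Lemma Square_sym b r l t : Square b r l t -> Square l t b r.
Proof. by elim/Square_ind => c; exact: Square_cube. Qed.

(** The same square seen from the end of [b]. *)
Lemma Square_rot b r l t : Square b r l t -> Square (rev b) l r (rev t).
Proof.
elim/Square_ind => c; rewrite !rev_edge.
have := @Square_cube _ c ord0 ord_max (flipv (zerov 2) ord0) isT.
by rewrite flipvK flipvC.
Qed.

(** The same square seen from the corner opposite to its origin. *)
Lemma Square_opp b r l t : Square b r l t -> Square (rev r) (rev b) (rev t) (rev l).
Proof.
by move=> /Square_rot/Square_sym/Square_rot; rewrite ?revK.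
Qed.

Lemma Square_source b r l t : Square b r l t ->
  [/\ source b = source l, source r = target b, source t = target l & target r = target t].
Proof.
by elim/Square_ind => c; rewrite !source_edge !target_edge; split=> //; rewrite flipvC.
Qed.

Lemma Square_neq b r l t : Square b r l t -> b <> l.
Proof. by elim/Square_ind => c /edges_at_inj. Qed.

(** Both squares have the same edges at their common origin, and in a simplicial link these
    determine the cube. *)
Lemma Square_uniq b r l t r' t' : Square b r l t -> Square b r' l t' -> r = r' /\ t = t'.
Proof.
move=> [c [cb <- cl <-]] [c' [cb' <- cl' <-]].
suff -> : c = c' by [].
apply: cube_uniq.
  by rewrite -(source_edge c ord0) -(source_edge c' ord0); congr source; rewrite [LHS]cb.
by move=> i; case: (ord2P i) => ->; [rewrite [LHS]cb|rewrite [LHS]cl].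
Qed.

Lemma Square_adjacent b r l t : Square b r l t -> adjacent b l.
Proof. by move=> [c [? _ ? _]]; exists c. Qed.

End VertexLinks.

(** * Edge words up to squares, and appending with cancellation *)

Section Words.
Variable X : cubeComplex.
Implicit Types (w p q : seq (X 1)) (e f b r l t : X 1).

(* Words record edge paths backwards: the head is the last edge. *)
Inductive swap_step : seq (X 1) -> seq (X 1) -> Prop :=
| SwapHead b r l t q : Square b r l t -> swap_step (r :: b :: q) (t :: l :: q)
| SwapCons e w w' : swap_step w w' -> swap_step (e :: w) (e :: w').

Definition swaps w w' := clos_refl_sym_trans _ swap_step w w'.

Lemma swaps_refl w : swaps w w. Proof. exact: rst_refl. Qed.
Lemma swaps_sym w w' : swaps w w' -> swaps w' w. Proof. exact: rst_sym. Qed.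
Lemma swaps_trans w2 w1 w3 : swaps w1 w2 -> swaps w2 w3 -> swaps w1 w3.
Proof. exact: rst_trans. Qed.

Lemma swaps_cons e w w' : swaps w w' -> swaps (e :: w) (e :: w').
Proof.
elim=> [x y H|x|x y _ H|x y z _ H1 _ H2].
- by apply: rst_step; apply: SwapCons.
- exact: swaps_refl.
- exact: swaps_sym.
- exact: swaps_trans H2.
Qed.

Lemma swaps_square b r l t q : Square b r l t -> swaps (r :: b :: q) (t :: l :: q).
Proof. by move=> H; apply: rst_step; apply: SwapHead. Qed.

Lemma swap_step_sym w w' : swap_step w w' -> swap_step w' w.
Proof.
by elim=> [b r l t q /Square_sym H|e v v' _ H]; [apply: SwapHead|apply: SwapCons].
Qed.

(** A swap step is undone by a swap step, so the induction needs no symmetric case. *)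
Lemma swaps_ind (P : seq (X 1) -> seq (X 1) -> Prop) :
  (forall w, P w w) -> (forall w1 w2 w3, swaps w1 w2 -> P w1 w2 -> P w2 w3 -> P w1 w3) ->
  (forall w w', swap_step w w' -> P w w') -> forall w w', swaps w w' -> P w w'.
Proof.
move=> Pr Pt Ps w w' H.
suff : P w w' /\ P w' w by case.
elim: H => [x y s|x|x y _ []|x y z xy [H1 H2] yz [H3 H4]]; split=> //.
- exact: Ps.
- exact/Ps/swap_step_sym.
- exact: Pt xy H1 H3.
- exact: Pt (swaps_sym yz) H4 H2.
Qed.

Lemma swaps_size w w' : swaps w w' -> size w = size w'.
Proof.
elim/swaps_ind=> [//|w1 w2 w3 _ -> ->//|v v' ].
by elim=> [//|e u u' _ /= ->].
Qed.

Hypothesis simplicial : forall v : X 0, link_is_simplicial v.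
Hypothesis flag : forall v : X 0, link_is_flag v.

(** An exchange property: distinct last edges must be the two final sides of one square, over a
    common remainder [u]. *)
Definition last_edges_related w w' :=
  match w, w' with
  | e :: p, f :: q => e = f /\ swaps p q \/
      exists b l u, [/\ Square b e l f, swaps p (b :: u) & swaps q (l :: u)]
  | [::], [::] => True
  | _, _ => False
  end.

(* Three squares around a common vertex bound a 3-cube; the three opposite
   squares provide the swaps. *)
Lemma three_squares b1 e l1 f b2 l2 g b3 l3 :
  Square b1 e l1 f -> Square b2 f l2 g -> Square b3 l1 l3 b2 ->
  exists b4 l4 h, [/\ Square b4 e l4 g, Square b3 b1 h b4 & Square l3 l2 h l4].
Proof.
move=> S1 S2 S3.
have T1 := Square_rot (Square_sym S1).
have T2 := Square_rot S2.
have T3 := Square_opp S3.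
(* The three squares meet at the source of [f], and these are their edges there. *)
pose d (i : 'I_3) : X 1 := match val i with 0 => f | 1 => rev l1 | _ => rev b2 end.
pose i0 : 'I_3 := @Ordinal 3 0 isT.
pose i1 : 'I_3 := @Ordinal 3 1 isT.
pose i2 : 'I_3 := @Ordinal 3 2 isT.
have P i : [\/ i = i0, i = i1 | i = i2].
  by case: i => [[|[|[|//]]] H]; [apply: Or31|apply: Or32|apply: Or33]; apply/val_inj.
have adj i j : i != j -> adjacent (d i) (d j).
  case: (P i) => ->; case: (P j) => -> // _; rewrite /d /=; apply: Square_adjacent.
  - exact: Square_sym T1.
  - exact: Square_sym T2.
  - exact: T1.
  - exact: T3.
  - exact: T2.
  - exact: Square_sym T3.
have dinj : injective d.
  move=> i j; case: (eqVneq i j) => // /adj[c cb cl] dij.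
  have [] : bottom_edge c <> left_edge c; last by rewrite cb cl.
  by apply: (Square_neq simplicial); exists c.
have [i|//|c _ cE] := flag_cube flag (v := source f) dinj.
  have [e1 _ _ _] := Square_source T1; have [e2 _ _ _] := Square_source T2.
  by case: (P i) => ->.
pose z := zerov 3.
have := Square_cube c z (i := i1) (j := i0) isT.
rewrite !cE => /(Square_uniq simplicial)/(_ T1)[E1 E2].
have := Square_cube c z (i := i2) (j := i0) isT.
rewrite !cE => /(Square_uniq simplicial)/(_ T2)[E3 E4].
have := Square_cube c z (i := i1) (j := i2) isT.
rewrite !cE => /(Square_uniq simplicial)/(_ T3)[E5 E6].
have {E2} eE : e = edge c i1 (flipv (flipv z i0) i1) by rewrite -rev_edge E2 revK.
have {E4} gE : g = edge c i2 (flipv (flipv z i0) i2) by rewrite -rev_edge E4 revK.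
have {E5} b3E : b3 = edge c i2 (flipv (flipv z i1) i2) by rewrite -rev_edge E5 revK.
have {E6} l3E : l3 = edge c i1 (flipv (flipv z i2) i1) by rewrite -rev_edge E6 revK.
pose o := flipv (flipv (flipv z i0) i1) i2.
have oE : flipv (flipv (flipv z i1) i2) i0 = o by rewrite /o (flipvC (flipv z i1)) (flipvC z).
exists (edge c i2 o), (edge c i1 o), (edge c i0 (flipv (flipv z i1) i2)); split.
- have := Square_cube c o (i := i2) (j := i1) isT.
  by rewrite /o flipvK -eE [flipv (flipv (flipv z i0) i1) i2]flipvC flipvK -gE.
- have := Square_cube c (flipv (flipv z i1) i2) (i := i2) (j := i0) isT.
  by rewrite flipvK -b3E E1 oE.
- have := Square_cube c (flipv (flipv z i1) i2) (i := i1) (j := i0) isT.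
  by rewrite oE {1 2}[flipv (flipv z i1) i2]flipvC flipvK -l3E E3.
Qed.

(** Only transitivity is hard. If the pairs ([e], [f]) and ([f], [g]) each come from a square,
    induction on length compares the two forms of the shortened middle word: equal last edges make
    the two squares coincide, distinct ones complete them to a cube. *)
Lemma swaps_last w w' : swaps w w' -> last_edges_related w w'.
Proof.
have [n] := ubnP (size w); elim: n w w' => // n IH w w' + H.
elim/swaps_ind: H => [w0|w1 w2 w3 H12 H1 H2|w1 w2 H].
- by case: w0 => // e p _; left; split=> //; exact: swaps_refl.
- move=> n1; have {}H1 := H1 n1; rewrite (swaps_size H12) in n1.
  have {}H2 := H2 n1.
  case: w1 w2 w3 H1 H2 n1 {H12} => [|e p] [|f q] [|g r] //=.
  move=> H1 H2; rewrite ltnS => qn.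
  case: H1 => [[-> pq]|[b1 [l1 [u1 [S1 pu qu]]]]].
    case: H2 => [[-> qr]|[b [l [u [S qu ru]]]]].
      by left; split=> //; exact: swaps_trans qr.
    by right; exists b, l, u; split=> //; exact: swaps_trans qu.
  case: H2 => [[<- qr]|[b2 [l2 [u2 [S2 qu2 ru]]]]].
    right; exists b1, l1, u1; split=> //; exact: swaps_trans (swaps_sym qr) qu.
  have := IH q (l1 :: u1) qn qu => _.
  have H := swaps_trans (swaps_sym qu) qu2.
  have {H} : last_edges_related (l1 :: u1) (b2 :: u2).
    by apply: IH H; rewrite -(swaps_size qu).
  case=> [[lb uu]|[b3 [l3 [u3 [S3 uu1 uu2]]]]].
    left; have T1 := Square_sym S1; rewrite lb in T1.
    have := Square_uniq simplicial (Square_rot T1) (Square_rot S2).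
    move=> [bl /(congr1 (@rev X))]; rewrite !revK => eg; split=> //.
    apply: swaps_trans pu _; apply: swaps_trans (swaps_sym ru); rewrite bl.
    exact: swaps_cons.
  have [b4 [l4 [h [S4 S5 S6]]]] := three_squares S1 S2 S3.
  right; exists b4, l4, (h :: u3); split=> //.
    apply: swaps_trans pu _; apply: (swaps_trans (w2 := b1 :: b3 :: u3)).
      exact: swaps_cons.
    exact: swaps_square.
  apply: swaps_trans ru _; apply: (swaps_trans (w2 := l2 :: l3 :: u3)).
    exact: swaps_cons.
  exact: swaps_square.
case: H => [b r l t q S|e v v' H] _.
  by right; exists b, l, q; split=> //; exact: swaps_refl.
by left; split=> //; exact: rst_step.
Qed.

Lemma swaps_consI e p q : swaps (e :: p) (e :: q) -> swaps p q.
Proof.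
move=> /swaps_last[[]//|[b [l [u [/Square_opp S _ _]]]]].
by case: (Square_neq simplicial S).
Qed.

Lemma swaps_neq e f p q : swaps (e :: p) (f :: q) -> e <> f ->
  exists b l u, [/\ Square b e l f, swaps p (b :: u) & swaps q (l :: u)].
Proof. by move=> /swaps_last[[]//|]. Qed.

Definition ends_with e w := exists p, swaps w (e :: p).

Lemma ends_with_swaps e w w' : swaps w w' -> ends_with e w -> ends_with e w'.
Proof. by move=> ww' [p H]; exists p; exact: swaps_trans (swaps_sym ww') H. Qed.

(** Backtracking is excluded up to swaps, not only in the word as written. *)
Fixpoint reduced w : Prop :=
  if w is e :: p then reduced p /\ ~ ends_with (rev e) p else True.

(** The square carries a backtrack of the new word to one of the old word. *)
Lemma swap_step_reduced w w' : swap_step w w' -> reduced w -> reduced w'.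
Proof.
elim=> [b r l t q S [[rq Hb] Hr]|e v v' vv' IH [/IH rv' He]]; last first.
  split=> // /ends_with_swaps => /(_ _ (swaps_sym (rst_step _ _ _ _ vv'))).
  exact: He.
have Sl : Square (rev l) b t (rev r) by exact: Square_rot (Square_sym S).
split; first split=> //.
  move=> [u H]; apply: Hr; exists (t :: u).
  by apply: swaps_trans (swaps_cons b H) _; exact: swaps_square.
move=> [u /swaps_neq[|b' [l' [u' [S' H _]]]]].
  by move=> lt; apply: (Square_neq simplicial Sl); rewrite lt revK.
have := Square_opp S'; rewrite revK => /(Square_uniq simplicial Sl)[bb _].
by apply: Hb; exists u'; rewrite bb revK.
Qed.

Lemma swaps_reduced w w' : swaps w w' -> reduced w -> reduced w'.
Proof.
elim/swaps_ind: w w' / => [//|w1 w2 w3 _ H1 H2 /H1/H2 //|w w'].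
exact: swap_step_reduced.
Qed.

Definition word := gquot swap_step.
Definition word_class w : word := gclass swap_step w.

Lemma word_classP w w' : word_class w = word_class w' <-> swaps w w'.
Proof. exact: gclassP. Qed.

Lemma word_classK (z : word) : word_class (repr z) = z.
Proof. exact: reprK. Qed.

Lemma word_class_rep (z : word) : exists w, word_class w = z.
Proof. by exists (repr z); exact: word_classK. Qed.

(* Appending an edge to a reduced word, with cancellation; nonreduced words are
   left alone, which makes the operation invertible on all words. *)
Definition append e (z : word) : word :=
  if pselect (reduced (repr z)) then
    if pselect (ends_with (rev e) (repr z)) is left H then word_class (projT1 (cid H))
    else word_class (e :: repr z)
  else z.

Lemma append_nonreduced e w : ~ reduced w -> append e (word_class w) = word_class w.
Proof.
move=> nr; rewrite /append; case: pselect => //= r; case: nr.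
by apply: swaps_reduced r; apply/word_classP; rewrite word_classK.
Qed.

Lemma repr_swaps w : swaps (repr (word_class w)) w.
Proof. by apply/word_classP; rewrite word_classK. Qed.

Lemma append_cancel e w p : reduced w -> swaps w (rev e :: p) ->
  append e (word_class w) = word_class p.
Proof.
move=> rw H; have rs := repr_swaps w.
rewrite /append; case: pselect => [_|[]] /=; last exact: swaps_reduced (swaps_sym rs) rw.
case: pselect => [H'|[]]; last by exists p; exact: swaps_trans H.
case: cid => u Hu /=; apply/word_classP; apply: (@swaps_consI (rev e)).
apply: swaps_trans (swaps_sym Hu) _; exact: swaps_trans rs H.
Qed.

Lemma append_cons e w : reduced w -> ~ ends_with (rev e) w ->
  append e (word_class w) = word_class (e :: w).
Proof.
move=> rw H; have rs := repr_swaps w.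
rewrite /append; case: pselect => [_|[]] /=; last exact: swaps_reduced (swaps_sym rs) rw.
case: pselect => [H'|_]; first by case: H; exact: ends_with_swaps H'.
by apply/word_classP/swaps_cons.
Qed.

Lemma append_rev e z : append (rev e) (append e z) = z.
Proof.
have [w <-] := word_class_rep z.
have [rw|nr] := pselect (reduced w); last by rewrite !append_nonreduced.
have [[p H]|H] := pselect (ends_with (rev e) w).
  have [rp Hp] := swaps_reduced H rw.
  by rewrite (append_cancel rw H) append_cons //; apply/word_classP/swaps_sym.
have r2 : reduced (e :: w) by split.
have s2 : swaps (e :: w) (rev (rev e) :: w) by rewrite revK; exact: swaps_refl.
by rewrite append_cons // (append_cancel r2 s2).
Qed.

(** If [r] cancelled after [b], uniqueness of the square would make [w] end with [rev l]. *)
Lemma append_not_not b r l t w : Square b r l t -> reduced w ->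
  ~ ends_with (rev b) w -> ~ ends_with (rev l) w ->
  append r (append b (word_class w)) = word_class (r :: b :: w).
Proof.
move=> S rw Hb Hl; rewrite append_cons // append_cons //.
have S1 := Square_rot S.
move=> [u /swaps_neq[|b' [l' [u' [/Square_opp S' H _]]]]].
  by move=> br; apply: (Square_neq simplicial S1); rewrite br revK.
rewrite revK in S'; have [bb _] := Square_uniq simplicial S1 S'.
by apply: Hl; exists u'; rewrite bb revK.
Qed.

(** Here [b] cancels at once, whereas on the other side it is [t] that cancels, after the square has
    moved [l] past [rev b]. *)
Lemma append_ends_not b r l t w p : Square b r l t -> reduced w ->
  swaps w (rev b :: p) -> ~ ends_with (rev l) w ->
  append r (append b (word_class w)) = word_class (r :: p) /\
  append t (append l (word_class w)) = word_class (r :: p).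
Proof.
move=> S rw Hb Hl; have [rp _] := swaps_reduced Hb rw.
split.
  rewrite (append_cancel rw Hb) append_cons // => -[u H]; apply: Hl.
  exists (rev t :: u); apply: swaps_trans Hb _.
  apply: swaps_trans (swaps_cons _ H) _.
  exact: swaps_square (Square_opp S).
rewrite append_cons //; apply: append_cancel; first by split.
apply: swaps_trans (swaps_cons l Hb) _.
exact: swaps_square (Square_rot S).
Qed.

(** A word that can end with two different edges ends with two sides of a square; by uniqueness that
    square is [S], and both paths walk back along it. *)
Lemma append_ends_ends b r l t w : Square b r l t -> reduced w ->
  ends_with (rev b) w -> ends_with (rev l) w ->
  exists u, [/\ swaps w (rev b :: rev r :: u), swaps w (rev l :: rev t :: u) &
    append r (append b (word_class w)) = word_class u /\
    append t (append l (word_class w)) = word_class u].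
Proof.
move=> S rw [p Hb] [q Hl].
have bl : rev b <> rev l.
  by move=> /(congr1 (@rev X)); rewrite !revK; exact: Square_neq S.
have [b' [l' [u [/Square_opp S' Hp Hq]]]] :=
  swaps_neq (swaps_trans (swaps_sym Hb) Hl) bl.
rewrite !revK in S'.
have [rb tl] := Square_uniq simplicial S S'.
rewrite -[b']revK -[l']revK -rb -tl in Hp Hq.
have [rp _] := swaps_reduced Hb rw; have [rq _] := swaps_reduced Hl rw.
exists u; split.
- by apply: swaps_trans Hb _; exact: swaps_cons.
- by apply: swaps_trans Hl _; exact: swaps_cons.
by rewrite (append_cancel rw Hb) (append_cancel rw Hl) (append_cancel rp Hp) (append_cancel rq Hq).
Qed.

Lemma append_local_system : local_system append.
Proof.
split=> [e z|c z]; first exact: append_rev.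
have S : Square (bottom_edge c) (right_edge c) (left_edge c) (top_edge c) by exists c.
have [w <-] := word_class_rep z.
have [rw|nr] := pselect (reduced w); last by rewrite !append_nonreduced.
have [Hb|Hb] := pselect (ends_with (rev (bottom_edge c)) w);
  have [Hl|Hl] := pselect (ends_with (rev (left_edge c)) w).
- by have [u [_ _ [-> ->]]] := append_ends_ends S rw Hb Hl.
- by have [p Hp] := Hb; have [-> ->] := append_ends_not S rw Hp Hl.
- by have [p Hp] := Hl; have [-> ->] := append_ends_not (Square_sym S) rw Hp Hb.
rewrite (append_not_not S) // (append_not_not (Square_sym S)) //.
by apply/word_classP; exact: swaps_square.
Qed.

End Words.

(** * Normal forms of geodesics and descending edges *)

Section NormalForms.
Variable X : cubeComplex.
Implicit Types (w p q : seq (X 1)) (e f b r l t : X 1) (u v : X 0).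
Hypothesis simplicial : forall v : X 0, link_is_simplicial v.
Hypothesis flag : forall v : X 0, link_is_flag v.

Fixpoint word_path u w v : Prop :=
  if w is e :: w' then target e = v /\ word_path u w' (source e) else u = v.

Lemma swaps_word_path u w w' v : swaps w w' -> word_path u w v -> word_path u w' v.
Proof.
elim/swaps_ind: w w' / => [//|w1 w2 w3 _ H1 H2 /H1/H2 //|w w' H].
elim: H v => [b r l t q /Square_source[bl rb tl rt]|e w0 w1 _ IH] v /=.
  by move=> [<- [_ H]]; rewrite rt tl -bl.
by move=> [<- /IH H].
Qed.

Variables (N : nat) (lab : X 1 -> 'I_N).
Hypothesis lab_parallel : forall n (c : X n) i (a b : {ffun 'I_n -> bool}), lab (edge c i a) = lab (edge c i b).

Lemma lab_rev e : lab (rev e) = lab e.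
Proof. by rewrite -{2}(edge1 e); exact: lab_parallel. Qed.

Lemma lab_square b r l t : Square b r l t -> lab b = lab t /\ lab l = lab r.
Proof. by elim/Square_ind => c; split; exact: lab_parallel. Qed.

Definition word_degree w : 'X_{1..N} := [multinom count (fun e => lab e == i) w | i < N].

Lemma word_degree_cons e w : word_degree (e :: w) = (U_(lab e) + word_degree w)%MM.
Proof. by apply/mnmP => i; rewrite mnmDE !mnmE /=. Qed.

Lemma swaps_degree w w' : swaps w w' -> word_degree w = word_degree w'.
Proof.
elim/swaps_ind: w w' / => [//|w1 w2 w3 _ -> -> //|w w'].
elim=> [b r l t q /lab_square[bt lr]|e v v' _ IH].
  by rewrite !word_degree_cons bt lr; apply/mnmP => i; rewrite !mnmDE addnCA.
by rewrite !word_degree_cons IH.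
Qed.

Lemma word_degree_size w : mdeg (word_degree w) = size w.
Proof.
elim: w => [|e w IH].
  by apply/eqP; rewrite mdeg_eq0; apply/eqP/mnmP => i; rewrite !mnmE.
by rewrite word_degree_cons mdegD mdeg1 IH.
Qed.

Lemma append_cases e w : reduced w -> exists w',
  [/\ append e (word_class w) = word_class w', reduced w' &
    (~ ends_with (rev e) w /\ w' = e :: w) \/ swaps w (rev e :: w')].
Proof.
move=> rw; have [[p Hp]|H] := pselect (ends_with (rev e) w).
  exists p; split; [exact: append_cancel|by have [] := swaps_reduced simplicial flag Hp rw|by right].
by exists (e :: w); split; [exact: append_cons|split|left].
Qed.

(** Each step lengthens or shortens the word by one. Equal length in the end means that nothing
    cancelled, so the word has the labels of the path. *)
Lemma foldl_append u p v : is_edge_path u p v -> exists w,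
  [/\ foldl (fun z e => append e z) (word_class [::]) p = word_class w, reduced w,
      word_path u w v, size w <= size p & size w = size p -> word_degree w = word_degree p].
Proof.
have path_rcons e q x y : is_edge_path x (rcons q e) y -> is_edge_path x q (source e) /\ target e = y.
  by elim: q x => [|f q IH] x /= [-> // /IH[]].
elim/last_ind: p v => [|p e IH] v.
  by move=> /= ->; exists [::].
move=> /path_rcons[/IH[w [wE rw wp sw dw]] <-].
have [w' [w'E rw' ww']] := append_cases e rw.
exists w'; rewrite foldl_rcons wE size_rcons; split=> //.
- case: ww' => [[_ -> //]|H].
  by have [_] := swaps_word_path H wp; rewrite source_rev.
- by case: ww' => [[_ ->]//|/swaps_size /= H]; rewrite H in sw; exact: leq_trans (leqnSn _) (leqW sw).
- case: ww' => [[_ ->] /= [/dw we]|/swaps_size /= H].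
    rewrite word_degree_cons we; apply/mnmP => i.
    by rewrite mnmDE !mnmE -cats1 count_cat /= addn0 addnC.
  by move=> E; move: sw; rewrite H E ltnNge leqW.
Qed.

Hypothesis connected : forall u v, edge_connected u v.
Hypothesis unique_transport : forall u p q v (z : word X),
  is_edge_path u p v -> is_edge_path u q v ->
  foldl (fun z e => append e z) z p = foldl (fun z e => append e z) z q.

Variable u : X 0.

Definition base_path v := projT1 (cid (connected u v)).
Lemma base_pathP v : is_edge_path u (base_path v) v.
Proof. exact: projT2 (cid (connected u v)). Qed.

(* The swap class of the geodesics from the base vertex [u] to [v]. *)
Definition normal_form v := foldl (fun z e => append e z) (word_class [::]) (base_path v).

Lemma normal_form_path p v : is_edge_path u p v ->
  foldl (fun z e => append e z) (word_class [::]) p = normal_form v.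
Proof. by move=> H; apply: unique_transport H _; exact: base_pathP. Qed.

Lemma normal_form_base : normal_form u = word_class [::].
Proof. by rewrite -(@normal_form_path [::] u). Qed.

Lemma normal_form_edge e : normal_form (target e) = append e (normal_form (source e)).
Proof.
rewrite -(@normal_form_path (rcons (base_path (source e)) e)); first by rewrite foldl_rcons.
rewrite -cats1; apply: edge_path_cat (base_pathP _) _.
by [].
Qed.

Definition geodesic v : seq (X 1) := repr (normal_form v).

Lemma geodesicK v : word_class (geodesic v) = normal_form v.
Proof. exact: word_classK. Qed.

Lemma geodesicP v : reduced (geodesic v) /\ word_path u (geodesic v) v.
Proof.
have [w [wE rw wp _ _]] := foldl_append (base_pathP v).
have H : swaps w (geodesic v) by apply/word_classP; rewrite -wE geodesicK.
split; [exact: swaps_reduced rw|exact: swaps_word_path wp].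
Qed.

Definition degree v : 'X_{1..N} := word_degree (geodesic v).

Lemma degree_class v w : normal_form v = word_class w -> degree v = word_degree w.
Proof. by rewrite -geodesicK => /word_classP/swaps_degree. Qed.

(** Together with [geodesic_path]: the shortest edge paths from [u] to [v] have [mdeg (degree v)]
    edges, and all have degree [degree v]. *)
Lemma degree_path p v : is_edge_path u p v ->
  mdeg (degree v) <= size p /\ (mdeg (degree v) = size p -> degree v = word_degree p).
Proof.
move=> H; have [w [wE rw wp sw dw]] := foldl_append H.
rewrite (degree_class (esym (etrans (esym wE) (normal_form_path H)))).
by rewrite word_degree_size.
Qed.

Lemma geodesic_path v : exists2 p, is_edge_path u p v & word_degree p = degree v.
Proof.
have [_ H] := geodesicP v; exists (seq.rev (geodesic v)); last first.
  by apply/mnmP => i; rewrite !mnmE count_rev.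
move: (geodesic v) H => w; elim: w v => [|e w IH] v /=; first by [].
move=> [<- /IH H]; rewrite rev_cons -cats1; apply: edge_path_cat H _.
by [].
Qed.

(** The edge points towards [u]: some geodesic to its source arrives along it backwards. *)
Definition descends e : bool := `[< ends_with (rev e) (geodesic (source e)) >].

Lemma descendsP e : reflect (exists w, [/\ reduced w, normal_form (target e) = word_class w &
  normal_form (source e) = word_class (rev e :: w)]) (descends e).
Proof.
have [rg _] := geodesicP (source e).
apply: (iffP (asboolP _)) => [[w H]|[w [rw tw sw]]].
  exists w; split; first by have [] := swaps_reduced simplicial flag H rg.
    by rewrite normal_form_edge -geodesicK; exact: append_cancel.
  by rewrite -geodesicK; apply/word_classP.
by exists w; apply/word_classP; rewrite geodesicK.
Qed.

Lemma descendsN e : ~~ descends e ->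
  normal_form (target e) = word_class (e :: geodesic (source e)).
Proof.
move=> /asboolP H; have [rg _] := geodesicP (source e).
by rewrite normal_form_edge -{1}geodesicK append_cons.
Qed.

Lemma degree_descends e : descends e ->
  degree (source e) = (U_(lab e) + degree (target e))%MM.
Proof.
move=> /descendsP[w [rw /degree_class -> /degree_class ->]].
by rewrite word_degree_cons lab_rev.
Qed.

Lemma degree_ascends e : ~~ descends e ->
  degree (target e) = (U_(lab e) + degree (source e))%MM.
Proof. by move=> /descendsN/degree_class ->; rewrite word_degree_cons. Qed.

Lemma descends_rev e : descends (rev e) = ~~ descends e.
Proof.
apply/idP/idP => [/degree_descends|H].
  rewrite source_rev target_rev lab_rev => H; apply/negP => /degree_descends.
  by rewrite H => /(congr1 mdeg)/eqP; rewrite !mdegD !mdeg1; lia.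
apply/descendsP; exists (geodesic (source e)); rewrite target_rev source_rev revK.
by split; [have [] := geodesicP (source e)|rewrite geodesicK|exact: descendsN].
Qed.

(** Whether or not [l] cancels, moving across the square brings the normal form at the end of [l] to
    end with [rev t]. *)
Lemma descends_square_imp b r l t : Square b r l t -> descends b -> descends t.
Proof.
move=> S /asboolP Hb; have [bl rb tl rt] := Square_source S.
have [rg _] := geodesicP (source b).
have key z : normal_form (target l) = word_class z -> ends_with (rev t) z -> descends t.
  by rewrite -tl -geodesicK => /word_classP/swaps_sym H H'; apply/asboolP; exact: ends_with_swaps H'.
have lE : normal_form (target l) = append l (word_class (geodesic (source b))).
  by rewrite geodesicK bl normal_form_edge.
have [Hl|Hl] := pselect (ends_with (rev l) (geodesic (source b))).
  have [z [_ Hz _]] := append_ends_ends simplicial flag S rg Hb Hl.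
  apply: (key (rev t :: z)); last by exists z; exact: swaps_refl.
  by rewrite lE (append_cancel simplicial flag rg Hz).
have [z Hz] := Hb.
apply: (key (l :: geodesic (source b))); first by rewrite lE append_cons.
exists (r :: z); apply: swaps_trans (swaps_cons l Hz) _.
exact: swaps_square (Square_rot S).
Qed.

Lemma descends_square b r l t : Square b r l t -> descends b = descends t.
Proof.
move=> S; apply/idP/idP; first exact: descends_square_imp S.
apply: contraTT; rewrite -!descends_rev; apply: descends_square_imp.
exact: Square_rot S.
Qed.

Lemma descends_cube n (c : X n) i (a : {ffun 'I_n -> bool}) : a i = false ->
  descends (edge c i a) = descends (edge c i (zerov n)).
Proof.
move=> ai; suff H k : descends (edge c i (truncv a k)) = descends (edge c i (zerov n)).
  by rewrite -(H n) truncv_ge.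
elim: k => [|k <-]; first by rewrite truncv0.
have [kn|nk] := ltnP k n; last by rewrite !truncv_ge // leqW.
rewrite (truncvS a (Ordinal kn)); case: ifP => // ak.
have ik : i != Ordinal kn by apply: contraTneq ak => <-; rewrite ai.
by apply/esym/(descends_square (Square_cube c (truncv a k) ik)).
Qed.

(** Geodesics to the common source can end with the reverse of either edge; the exchange property
    produces the square. *)
Lemma descends_adjacent e f : source e = source f -> descends e -> descends f ->
  e <> f -> adjacent e f.
Proof.
move=> ef /asboolP[p Hp] /asboolP[q Hq] nef; rewrite -ef in Hq.
have [|b [l [w [/Square_opp S _ _]]]] :=
    swaps_neq simplicial flag (swaps_trans (swaps_sym Hp) Hq).
  by move=> /(congr1 (@rev X)); rewrite !revK.
by move: S; rewrite !revK; exact: Square_adjacent.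
Qed.

Lemma descends_exists v : v != u -> exists2 e, source e = v & descends e.
Proof.
move=> vu; have [_] := geodesicP v.
case E: (geodesic v) => [|e w] /= H; first by rewrite H eqxx in vu.
have {H}[ev _] := H.
exists (rev e); first by rewrite source_rev.
by apply/asboolP; exists w; rewrite source_rev revK ev E; exact: swaps_refl.
Qed.

Lemma base_not_descends e : source e = u -> descends e = false.
Proof.
move=> eu; apply/asboolP => -[w H].
have /swaps_size : swaps (geodesic (source e)) [::].
  by apply/word_classP; rewrite geodesicK eu normal_form_base.
by rewrite (swaps_size H).
Qed.

End NormalForms.

(** * The weighted sum over cubes at a vertex *)

Local Open Scope ring_scope.

Section Weights.
Variables (N n : nat).
Local Notation P := {mpoly rat[N]}.

(** The exponent is [n] because a cube of dimension at most [n] may have the same label in all its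
    directions. *)
Definition common_denominator : P := \prod_(h < N) (1 - 'X_h ^+ 2) ^+ n.

Definition cofactor k (l : 'I_k -> 'I_N) : P :=
  \prod_(h < N) (1 - 'X_h ^+ 2) ^+ (n - #|[set i | l i == h]|).

Lemma prod_labels (A : comNzRingType) k (l : 'I_k -> 'I_N) (F : 'I_N -> A) :
  \prod_i F (l i) = \prod_h F h ^+ #|[set i | l i == h]|.
Proof.
rewrite (partition_big l predT) //=; apply: eq_bigr => h _.
rewrite (eq_bigr (fun=> F h)) => [|i /eqP -> //].
by rewrite prodr_const; congr (_ ^+ _); apply: eq_card => i; rewrite inE.
Qed.

Lemma cofactorE k (l : 'I_k -> 'I_N) : (k <= n)%N ->
  cofactor l * \prod_i (1 - 'X_(l i) ^+ 2) = common_denominator.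
Proof.
move=> kn; rewrite (prod_labels l (fun h => 1 - 'X_h ^+ 2 : P)) -big_split /=.
apply: eq_bigr => h _; rewrite -exprD subnK //.
by apply: leq_trans (max_card _) _; rewrite card_ord.
Qed.

(* The weights -t/(1-t^2) (for a direction separating the two vertices) and
   t^2/(1-t^2), multiplied by the common denominator. *)
Definition cube_weight k (l : 'I_k -> 'I_N) (a : {ffun 'I_k -> bool}) : P :=
  cofactor l * \prod_i (if a i then - 'X_(l i) else 'X_(l i) ^+ 2).

(** The sum factors over the directions: the factor is -t + t^3 = -t(1 - t^2) where [g i] holds, and
    -t^2 + t^2 = 0 elsewhere. *)
Lemma sum_cube_weight k (l : 'I_k -> 'I_N) (g : {ffun 'I_k -> bool}) : (k <= n)%N ->
  \sum_(a : {ffun 'I_k -> bool})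
    (\prod_i (if a i == g i then 1 else 'X_(l i))) * cube_weight l a =
  if [forall i, g i] then (-1) ^+ k * (\prod_i 'X_(l i)) * common_denominator else 0.
Proof.
move=> kn.
transitivity (cofactor l * \sum_(a : {ffun 'I_k -> bool}) \prod_i
   ((if a i == g i then 1 else 'X_(l i)) * (if a i then - 'X_(l i) else 'X_(l i) ^+ 2 : P))).
  by rewrite mulr_sumr; apply: eq_bigr => a _; rewrite /cube_weight big_split /=; ring.
rewrite -(bigA_distr_bigA (fun i b => (if b == g i then 1 else 'X_(l i)) *
   (if b then - 'X_(l i) else 'X_(l i) ^+ 2 : P))).
under eq_bigr => i _ do rewrite big_bool.
case: ifP => [/forallP gi|/negbT/forallPn[i gi]]; last first.
  by rewrite (bigD1 i) //= (negPf gi) /=; ring.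
rewrite (eq_bigr (fun i => - 'X_(l i) * (1 - 'X_(l i) ^+ 2))); last first.
  by move=> i _; rewrite gi /=; ring.
by rewrite big_split prodrN /= card_ord mulrCA cofactorE.
Qed.

End Weights.

(** This is (1 - 1)^m; the upper limit may exceed [m], as falling factorials vanish beyond it. *)
Lemma alternating_binomial (m n : nat) : (m <= n)%N ->
  \sum_(k < n.+1) (-1) ^+ k * ((k`!)%:R^-1 * (m ^_ k)%:R) = (m == 0)%:R :> rat.
Proof.
move=> mn.
have E k : (k`!)%:R^-1 * (m ^_ k)%:R = 'C(m, k)%:R :> rat.
  by rewrite -bin_ffact natrM mulrC mulfK // pnatr_eq0 -lt0n fact_gt0.
under eq_bigr => k _ do rewrite E.
transitivity ((1 - 1 : rat) ^+ m); last by rewrite subrr expr0n.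
rewrite exprDn -(big_mkord xpredT (fun k => (-1) ^+ k * 'C(m, k)%:R : rat)).
rewrite (@big_cat_nat _ _ _ m.+1) //=.
rewrite [X in _ + X]big_nat_cond [X in _ + X]big1 ?addr0; last first.
  by move=> k /andP[/andP[mk _] _]; rewrite bin_small // mulr0.
rewrite big_mkord; apply: eq_bigr => k _.
by rewrite expr1n mul1r mulr_natr.
Qed.

(** * The alternating sum over the cubes at one vertex of X *)

Section LocalIdentity.
Variable X : cubeComplex.
Hypothesis simplicial : forall v : X 0%N, link_is_simplicial v.
Hypothesis flag : forall v : X 0%N, link_is_flag v.
Variables (N : nat) (lab : X 1%N -> 'I_N).
Hypothesis lab_parallel : forall n (c : X n) i (a b : {ffun 'I_n -> bool}),
  lab (edge c i a) = lab (edge c i b).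
Hypothesis connected : forall u v : X 0%N, edge_connected u v.
Hypothesis unique_transport : forall u p q v (z : word X),
  is_edge_path u p v -> is_edge_path u q v ->
  foldl (fun z e => append e z) z p = foldl (fun z e => append e z) z q.
Variable u : X 0%N.
Local Notation P := {mpoly rat[N]}.
Local Notation descends := (descends connected u).
Local Notation degree := (degree lab connected u).

Definition monomial v : P := 'X_[degree v].
Definition dir_lab n (c : X n) i := lab (edge c i (zerov n)).
(** The corner of [c] closest to [u], as [monomial_cube] shows. *)
Definition gate n (c : X n) : {ffun 'I_n -> bool} := [ffun i => descends (edge c i (zerov n))].

Lemma descends_revE e : descends (rev e) = ~~ descends e.
Proof. exact: (descends_rev simplicial flag lab_parallel connected unique_transport). Qed.

Lemma monomial_flip n (c : X n) (a : {ffun 'I_n -> bool}) i : a i = gate c i ->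
  monomial (vx c (flipv a i)) = 'X_(dir_lab c i) * monomial (vx c a).
Proof.
move=> ai.
have D : ~~ descends (edge c i a).
  case E: (a i); last first.
    rewrite (descends_cube simplicial flag lab_parallel connected unique_transport) //.
    by move: ai; rewrite E ffunE => <-.
  rewrite -descends_revE rev_edge (descends_cube simplicial flag lab_parallel connected unique_transport).
    by move: ai; rewrite E ffunE => <-.
  by rewrite ffunE E eqxx.
have := degree_ascends simplicial flag lab_parallel unique_transport D.
rewrite target_edge source_edge /monomial => ->; rewrite mpolyXD.
by congr ('X_ _ * _); exact: lab_parallel.
Qed.

Lemma monomial_cube n (c : X n) (a : {ffun 'I_n -> bool}) :
  monomial (vx c a) =
  monomial (vx c (gate c)) * \prod_i (if a i == gate c i then 1 else 'X_(dir_lab c i)).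
Proof.
(* Interpolates between the gate at [k = 0] and [a] at [k = n], one coordinate at a time. *)
pose b k : {ffun 'I_n -> bool} := [ffun j : 'I_n => if (j < k)%N then a j else gate c j].
suff H k : monomial (vx c (b k)) = monomial (vx c (gate c)) *
    \prod_(i < n | (i < k)%N) (if a i == gate c i then 1 else 'X_(dir_lab c i)).
  have -> : a = b n by apply/ffunP => j; rewrite ffunE ltn_ord.
  rewrite H; congr (_ * _); apply: eq_big => j; first by rewrite ltn_ord.
  by rewrite [b n j]ffunE ltn_ord.
elim: k => [|k IH].
  rewrite big_pred0 ?mulr1 //; congr (monomial (vx c _)).
  by apply/ffunP => j; rewrite !ffunE.
have [kn|nk] := ltnP k n; last first.
  have -> : b k.+1 = b k.
    by apply/ffunP => j; rewrite !ffunE !(leq_trans (ltn_ord j)) // leqW.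
  rewrite IH; congr (_ * _); apply: eq_bigl => j.
  by rewrite !(leq_trans (ltn_ord j)) // leqW.
pose i := Ordinal kn.
rewrite (bigD1 i) ?ltnSn //= (eq_bigl (fun j : 'I_n => j < k)%N); last first.
  by move=> j; rewrite -val_eqE /=; lia.
have bi : b k i = gate c i by rewrite !ffunE ltnn.
case: eqP => ai.
  rewrite mul1r -IH; congr (monomial (vx c _)); apply/ffunP => j; rewrite !ffunE ltnS leq_eqVlt.
  case: eqP => [jk|//]; have -> : j = i by apply/val_inj.
  by rewrite ltnn ai ffunE.
rewrite mulrCA -IH -monomial_flip //; congr (monomial (vx c _)).
apply/ffunP => j; rewrite [LHS]ffunE [RHS]ffunE [b k j]ffunE ltnS leq_eqVlt -val_eqE /=.
case: eqP => [jk|_]; last by rewrite addbF.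
have -> : j = i by apply/val_inj.
by rewrite ltnn; case: (a i) (gate c i) ai => [] [].
Qed.

Lemma sum_cube n k (c : X k) : (k <= n)%N ->
  \sum_(a : {ffun 'I_k -> bool}) monomial (vx c a) * cube_weight n (dir_lab c) a =
  if [forall i, gate c i]
  then (-1) ^+ k * (common_denominator N n * monomial (vx c (zerov k))) else 0.
Proof.
move=> kn; under eq_bigr => a _ do rewrite monomial_cube -mulrA.
rewrite -mulr_sumr sum_cube_weight //; case: ifP => [/forallP g|_]; last by rewrite mulr0.
rewrite [monomial (vx c (zerov k))]monomial_cube.
rewrite [X in _ = _ * (_ * (_ * X))](eq_bigr (fun i => 'X_(dir_lab c i))); last first.
  by move=> i _; rewrite g ffunE.
by ring.
Qed.

(** A parametrized [k]-cube whose edges at [w] all descend amounts to an ordered choice of [k]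
    distinct descending edges: these are pairwise adjacent, and flagness fills them in. *)
Lemma card_descending (w : X 0%N) k (sk : seq (X k)) (s1 : seq (X 1%N)) :
  uniq sk -> (forall c, (c \in sk) = (vx c (zerov k) == w)) ->
  uniq s1 -> (forall e, (e \in s1) = (source e == w)) ->
  count (fun c => [forall i, gate c i]) sk = (count descends s1) ^_ k.
Proof.
move=> uk kP u1 eP.
pose S := [seq c <- sk | [forall i, gate c i]]; pose L := [seq e <- s1 | descends e].
have mL (c : seq_sub S) i : edge (ssval c) i (zerov k) \in L.
  have := ssvalP c; rewrite !mem_filter kP eP => /andP[/forallP/(_ i) + /eqP <-].
  by rewrite ffunE => ->; rewrite source_edge eqxx.
pose g (c : seq_sub S) : {ffun 'I_k -> seq_sub L} := [ffun i => SeqSub (mL c i)].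
have gE c i : ssval (g c i) = edge (ssval c) i (zerov k) by rewrite ffunE.
have vS (c : seq_sub S) : vx (ssval c) (zerov k) = w.
  by have := ssvalP c; rewrite !mem_filter kP => /andP[_ /eqP].
have ginj : injective g.
  move=> c c' e; apply/val_inj/(cube_uniq simplicial) => [|i]; first by rewrite !vS.
  by rewrite -[LHS]gE e gE.
rewrite -!size_filter -!card_seq_sub ?filter_uniq //.
rewrite -[X in _ ^_ X]card_ord -card_inj_ffuns -(card_codom ginj).
apply: eq_card => f; rewrite inE; apply/codomP/injectiveP.
  move=> [c ->] i j /(congr1 val); rewrite /= !gE.
  exact: (edges_at_inj simplicial).
move=> finj.
have fL i : descends (ssval (f i)) /\ source (ssval (f i)) = w.
  by have := ssvalP (f i); rewrite mem_filter eP => /andP[-> /eqP].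
have [||i j ij|c cw cE] := flag_cube flag (v := w) (e := fun i => ssval (f i)).
- by move=> i j /val_inj/finj.
- by move=> i; have [] := fL i.
- have [di si] := fL i; have [dj sj] := fL j.
  apply: (descends_adjacent simplicial flag _ di dj); first by rewrite si.
  by move=> /val_inj/finj/eqP; rewrite (negPf ij).
have cS : c \in S.
  rewrite mem_filter kP cw eqxx andbT; apply/forallP => i; rewrite ffunE cE.
  by have [] := fL i.
exists (SeqSub cS); apply/ffunP => i; apply/val_inj; rewrite /= gE /=.
by rewrite cE.
Qed.

Lemma local_identity n (w : X 0%N) (star : forall k, seq (X k)) :
  (forall k, (n < k)%N -> X k -> False) ->
  (forall k, uniq (star k)) ->
  (forall k c, (c \in star k) = (vx c (zerov k) == w)) ->
  \sum_(k < n.+1) (k`!%:R^-1 : rat) *: \sum_(c <- star k) \sum_(a : {ffun 'I_k -> bool})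
     monomial (vx c a) * cube_weight n (dir_lab c) a =
  if w == u then common_denominator N n else 0.
Proof.
move=> dim su sP.
pose m := count descends (star 1%N).
have cnt k : count (fun c => [forall i, gate c i]) (star k) = m ^_ k.
  by apply: (card_descending (w := w)).
(* More than [n] descending edges at [w] would span an [n.+1]-cube. *)
have mn : (m <= n)%N.
  rewrite -ltnS -[(m < n.+1)%N]negbK -leqNgt -ffact_gt0 -cnt.
  by case: (star n.+1) => [//|c s]; case: (dim n.+1).
transitivity (\sum_(k < n.+1) ((-1) ^+ k * ((k`!)%:R^-1 * (m ^_ k)%:R) : rat) *:
   (common_denominator N n * monomial w)).
  apply: eq_bigr => k _.
  rewrite (eq_big_seq (fun c => if [forall i, gate c i] then
     (-1) ^+ k * (common_denominator N n * monomial w) else 0)); last first.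
    by move=> c; rewrite sP => /eqP <-; rewrite sum_cube // -ltnS.
  rewrite -big_mkcond big_const_seq iter_addr_0 cnt -scaler_nat scalerA.
  have sgn (p : P) : (-1) ^+ k * p = ((-1) ^+ k : rat) *: p.
    rewrite -signr_odd -[in RHS]signr_odd.
    by case: (odd k); rewrite /= ?expr0 ?expr1 ?mulN1r ?scaleN1r ?mul1r ?scale1r.
  by rewrite sgn scalerA [in RHS]mulrC.
rewrite -scaler_suml alternating_binomial //.
have [wu|wu] := eqVneq w u.
  have -> : m = 0%N.
    apply/eqP; rewrite eqn0Ngt -has_count; apply/hasPn => e; rewrite sP wu => /eqP eu.
    by rewrite (base_not_descends connected unique_transport).
  rewrite wu eqxx scale1r /monomial.
  rewrite (degree_class lab_parallel (normal_form_base connected unique_transport u)).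
  suff -> : word_degree lab [::] = 0%MM by rewrite mpolyX0 mulr1.
  by apply/mnmP => i; rewrite !mnmE.
have [e ew de] := descends_exists simplicial flag lab connected wu.
suff : (0 < m)%N by case: m {cnt mn} => // m _; rewrite scale0r.
by rewrite -has_count; apply/hasP; exists e => //; rewrite sP; apply/eqP.
Qed.

End LocalIdentity.

(** * Symmetries of cubes and the number of cubes per simplex of a link *)

Lemma extend_injection j i (h : 'I_j -> 'I_(j + i)) : injective h ->
  exists2 s : 'I_(j + i) -> 'I_(j + i), injective s & forall a, s (lshift i a) = h a.
Proof.
move=> hi.
pose S := [set h a | a : 'I_j]%SET.
have cS : #|~: S| = i.
  by rewrite cardsCs finset.setCK card_imset // !card_ord addKn.
pose g (b : 'I_i) : 'I_(j + i) := enum_val (cast_ord (esym cS) b).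
have gS b : g b \notin S by have := enum_valP (cast_ord (esym cS) b); rewrite inE.
have hS a : h a \in S by exact: imset_f.
exists (fun x => match fintype.split x with inl a => h a | inr b => g b end).
  move=> x y; case: split_ordP => a ->; case: split_ordP => b -> e.
  - by rewrite (hi _ _ e).
  - by have := gS b; rewrite -e hS.
  - by have := gS a; rewrite e hS.
  - by move/enum_val_inj/cast_ord_inj: e => ->.
by move=> a; case: split_ordP => [b /lshift_inj -> //|b /eqP]; rewrite eq_lrshift.
Qed.

Section Symmetries.
Variable K : cubeComplex.

(** Lets any cube containing a given cell be reparametrized so that the cell is its base face, as
    links require. *)
Lemma extend_faceMap j i (f : faceMap j (j + i)) :
  exists s : faceMap (j + i) (j + i), comp_face s (base_face j i) = f.
Proof.
have [s si sE] := extend_injection (injectiveP _ (fdir_inj f)).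
exists (subface si (fcorner f)); apply: faceMap_eq.
  by apply/ffunP => a; rewrite !ffunE sE.
exact: (face_vertex0 (subface si (fcorner f))).
Qed.

Lemma symmetry_inverse n (s : faceMap n n) : exists s', comp_face s s' = id_face n.
Proof.
have surj j : fcoord s j != None.
  have /codomP[i ->] : j \in codom (fdir s).
    by rewrite (inj_card_onto (injectiveP _ (fdir_inj s))) ?card_ord.
  by rewrite fcoord_fdir.
have [||s' e] := @face_factor _ _ _ (id_face n) s.
- by move=> i; exact: surj.
- by move=> j E; have := surj j; rewrite E.
by exists s'.
Qed.

Lemma face_sym_inj n (s : faceMap n n) : injective (@face K n n s).
Proof.
move=> c c' e; have [s' E] := symmetry_inverse s.
by rewrite -(face_id c) -(face_id c') -E -!face_comp e.
Qed.

Variable cellsK : forall k, seq (K k).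
Hypothesis cells_uniq : forall k, uniq (cellsK k).
Hypothesis cells_all : forall k c, c \in cellsK k.

Lemma cells_symmetry n (s : faceMap n n) :
  perm_eq [seq face s c | c <- cellsK n] (cellsK n).
Proof.
have us : uniq [seq face s c | c <- cellsK n].
  by rewrite map_inj_uniq //; exact: face_sym_inj.
apply: uniq_perm => //; apply: (uniq_min_size us _ _).2.
  by move=> c _; exact: cells_all.
by rewrite size_map.
Qed.

Lemma big_cells_symmetry (A : nmodType) n (s : faceMap n n) (Q : pred (K n)) (F : K n -> A) :
  \sum_(c <- cellsK n | Q c) F c = \sum_(c <- cellsK n | Q (face s c)) F (face s c).
Proof.
by rewrite -(perm_big _ (cells_symmetry s)) /= big_map.
Qed.

End Symmetries.

Section LinkCount.
Variables (K : cubeComplex) (j : nat) (D : K j).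
Hypothesis simplicial : link_is_simplicial D.

Definition link_vertices i (c : K (j + i)) : {fset K (j + 1)} :=
  [fset link_vertex c m | m in 'I_i]%fset.

Lemma card_link_vertices i (c : K (j + i)) : link_cube D c -> #|` link_vertices c| = i.
Proof.
move=> Dc; rewrite card_imfset ?size_enum_ord //=; exact: simplicial.1.
Qed.

Lemma link_reorder i (c : K (j + i)) (t : 'I_i -> 'I_i) : injective t -> link_cube D c ->
  exists2 c' : K (j + i), link_cube D c' & forall m, link_vertex c' m = link_vertex c (t m).
Proof.
move=> ti Dc.
pose s (x : 'I_(j + i)) : 'I_(j + i) :=
  match fintype.split x with inl a => lshift i a | inr b => rshift j (t b) end.
have sl a : s (lshift i a) = lshift i a.
  by rewrite /s; case: split_ordP => [b /lshift_inj ->//|b /eqP]; rewrite eq_lrshift.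
have sr b : s (rshift j b) = rshift j (t b).
  by rewrite /s; case: split_ordP => [a /eqP|a /rshift_inj ->//]; rewrite eq_rlshift.
have si : injective s.
  move=> x y; case: (split_ordP x) => a ->; case: (split_ordP y) => b ->; rewrite ?sl ?sr => e.
  - by rewrite (lshift_inj e).
  - by move/eqP: e; rewrite eq_lrshift.
  - by move/eqP: e; rewrite eq_rlshift.
  - by rewrite (ti _ _ (rshift_inj e)).
exists (face (subface si (zerov _)) c).
  rewrite /link_cube face_comp -[RHS]Dc; congr (face _ c); apply: faceMap_eq.
    by apply/ffunP => a; rewrite !ffunE sl.
  exact: (face_vertex0 (subface si _)).
move=> m; rewrite /link_vertex face_comp; congr (face _ c); apply: faceMap_eq.
  apply/ffunP => a; rewrite !ffunE /spike; case: split_ordP => b _; first by rewrite sl.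
  by rewrite sr.
exact: (face_vertex0 (subface si _)).
Qed.

(** One cube for each numbering of the vertices of [A]: simpliciality of the link makes it unique,
    [link_reorder] makes it exist. *)
Lemma count_link i (s : seq (K (j + i))) (A : {fset K (j + 1)}) :
  uniq s -> (forall c, c \in s) -> link_simplex D A -> #|` A| = i ->
  count (fun c => `[< link_cube D c >] && (link_vertices c == A)) s = i`!.
Proof.
move=> us sall [i' [c0 [Dc0 AE]]] Ai.
have ii : i' = i by rewrite -Ai AE; exact/esym/card_link_vertices.
subst i'.
pose S := [seq c <- s | `[< link_cube D c >] && (link_vertices c == A)].
have SP (c : seq_sub S) : link_cube D (ssval c) /\ link_vertices (ssval c) = A.
  by have := ssvalP c; rewrite mem_filter => /andP[/andP[/asboolP ? /eqP ?] _].
have mA (c : seq_sub S) m : link_vertex (ssval c) m \in A.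
  by have [_ <-] := SP c; apply/imfsetP; exists m.
pose g (c : seq_sub S) : {ffun 'I_i -> A} := [ffun m => [` mA c m]%fset].
have gE c m : fsval (g c m) = link_vertex (ssval c) m by rewrite ffunE.
have ginj : injective g.
  move=> c c' e; apply/val_inj; apply: simplicial.2; [by case: (SP c)|by case: (SP c')|].
  by move=> m; rewrite -[LHS]gE e gE.
rewrite -size_filter -card_seq_sub ?filter_uniq // -(card_codom ginj).
have <- : #|{: A}| ^_ #|'I_i| = i`! by rewrite -cardfE Ai card_ord ffactnn.
rewrite -card_inj_ffuns.
apply: eq_card => f; rewrite inE; apply/codomP/injectiveP.
  move=> [c ->] m m' /(congr1 (@fsval _ A)); rewrite !gE.
  by apply: simplicial.1; case: (SP c).
move=> finj.
have AP v : v \in A -> exists m0, v = link_vertex c0 m0.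
  by rewrite AE => /imfsetP[m0 _ ->]; exists m0.
have ex m : exists m0, link_vertex c0 m0 == fsval (f m).
  by have [m0 ->] := AP _ (fsvalP (f m)); exists m0.
pose t m := xchoose (ex m).
have tE m : link_vertex c0 (t m) = fsval (f m) by apply/eqP; exact: (xchooseP (ex m)).
have ti : injective t.
  by move=> m m' e; apply/finj/val_inj; rewrite /= -!tE e.
have [c Dc cE] := link_reorder ti Dc0.
have cA : link_vertices c = A.
  have tb : bijective t by apply: injF_bij.
  rewrite AE; apply/fsetP => v; apply/imfsetP/imfsetP => -[m _ ->].
    by exists (t m); rewrite ?cE.
  by case: tb => t' _ tK; exists (t' m); rewrite ?cE ?tK.
have cS : c \in S by rewrite mem_filter sall cA eqxx andbT; apply/andP; split=> //; apply/asboolP.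
exists (SeqSub cS); apply/ffunP => m; apply/val_inj; rewrite /= gE /= cE.
by rewrite tE.
Qed.

End LinkCount.

(** * The Eulerian condition as a sum over cubes *)

Section EulerSum.
Variables (K : cubeComplex) (n : nat).
Hypothesis eulerian : Eulerian n K.
Variable cellsK : forall k, seq (K k).
Hypothesis cells_uniq : forall k, uniq (cellsK k).
Hypothesis cells_all : forall k c, c \in cellsK k.

(** A simplex of maximal dimension spans with [D] a maximal cell, hence an [n]-cube: a larger cube
    would contribute a larger simplex to the link of [D]. *)
Lemma link_dimE j (D : K j) d : link_dim D d -> d = (n : int) - (j : int) - 1 /\ (j <= n)%N.
Proof.
have [simp max _] := eulerian.
move=> [[A [i [C [DC AE]]] Ad] dmax].
have Ai : #|` A| = i by rewrite AE; exact: (card_link_vertices (simp _ D) DC).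
suff nE : (j + i)%N = n by move: Ad; rewrite Ai -nE; lia.
apply: max (C) _ => m c f fc.
have jm : (j + i <= m)%N := faceMap_leq f.
have [i' mE] : exists i', m = (j + i')%N by exists (m - j)%N; lia.
subst m.
have [s sE] := extend_faceMap (comp_face f (base_face j i)).
have Dc : link_cube D (face s c) by rewrite /link_cube face_comp sE -face_comp fc.
have := dmax _ (ex_intro _ i' (ex_intro _ (face s c) (conj Dc erefl))).
rewrite -/(link_vertices _) (card_link_vertices (simp _ D) Dc) -Ad Ai; lia.
Qed.

Lemma dim_le j (D : K j) : (j <= n)%N.
Proof. by have [_ _ /(_ j D)[d /link_dimE[]]] := eulerian. Qed.

Lemma link_simplex0 j (D : K j) : link_simplex D fset0.
Proof.
have ci : injective (cast_ord (addn0 j)) by exact: cast_ord_inj.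
exists 0, (face (subface ci (zerov j)) D); split.
  rewrite /link_cube face_comp -[RHS]face_id; congr (face _ D); apply: faceMap_eq.
    by apply/ffunP => a; rewrite !ffunE; apply/val_inj.
  exact: (face_vertex0 (subface ci _)).
by apply/fsetP => A; rewrite inE; apply/esym/imfsetP => -[[]].
Qed.

Variable F : fieldType.
Hypothesis F0 : forall k, k.+1%:R != 0 :> F.

Lemma factF k : k`!%:R != 0 :> F.
Proof. by case: k`! (fact_gt0 k) => // m _. Qed.

(** Each simplex is represented by [i!] cubes, so the left side is the sum of (-1)^|A| over all
    simplices, the empty one included; that is 1 minus the Euler characteristic. *)
Lemma link_euler_sum j (D : K j) :
  \sum_(i < n.+1) (-1) ^+ i * (i`!%:R^-1 *
     (count (fun c => `[< link_cube D c >]) (cellsK (j + i)))%:R) = (-1) ^+ (n - j) :> F.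
Proof.
have [simp _ euler] := eulerian.
pose S := undup (flatten [seq [seq link_vertices c | c <- cellsK (j + i) & `[< link_cube D c >]]
  | i <- iota 0 n.+1]).
have SP A : reflect (link_simplex D A) (A \in S).
  rewrite mem_undup; apply: (iffP flatten_mapP) => [[i _ /mapP[c + ->]]|[i [c [Dc AE]]]].
    by rewrite mem_filter => /andP[/asboolP Dc _]; exists i, c.
  exists i; first by have := dim_le c; rewrite mem_iota; lia.
  by apply/mapP; exists c => //; rewrite mem_filter cells_all andbT; apply/asboolP.
have cnt i : (count (fun c => `[< link_cube D c >]) (cellsK (j + i)))%:R =
    \sum_(A <- S) (if #|` A| == i then i`!%:R else 0) :> F.
  transitivity (\sum_(c <- cellsK (j + i) | `[< link_cube D c >])
      \sum_(A <- S | A == link_vertices c) (1 : F)).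
    rewrite -sum1_count natr_sum; apply: eq_bigr => c /asboolP Dc.
    have cS : link_vertices c \in S by apply/SP; exists i, c.
    by rewrite big_const_seq iter_addr_0 count_uniq_mem ?undup_uniq // cS.
  rewrite (exchange_big_dep xpredT) //=; apply: eq_big_seq => A /SP sA.
  rewrite (eq_bigl (fun c => `[< link_cube D c >] && (link_vertices c == A))); last first.
    by move=> c; rewrite [A == _]eq_sym.
  rewrite big_const_seq iter_addr_0; case: eqP => [Ai|nAi].
    by rewrite (count_link (simp _ D)).
  rewrite (eq_in_count (a2 := pred0)) ?count_pred0 // => c _ /=.
  apply/andP => -[/asboolP Dc /eqP cA]; apply: nAi.
  by rewrite -cA (card_link_vertices (simp _ D)).
transitivity (\sum_(A <- S) (-1 : F) ^+ #|` A|).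
  under eq_bigr => i _ do rewrite cnt mulr_sumr mulr_sumr.
  rewrite exchange_big /=; apply: eq_big_seq => A /SP[i [c [Dc AE]]].
  have Ai : #|` A| = i by rewrite AE; exact: (card_link_vertices (simp _ D)).
  have i_n : (i < n.+1)%N by have := dim_le c; lia.
  rewrite (bigD1 (Ordinal i_n)) //= Ai eqxx mulVf ?factF // mulr1 big1 ?addr0 //.
  by move=> k /negPf; rewrite -val_eqE /= eq_sym => ->; rewrite !mulr0.
have [d dD] := euler j D; have [-> jn] := link_dimE dD.
rewrite /link_euler_char.
rewrite (_ : [set A | _]%classic = [set` [seq A <- S | A != fset0]]%classic); last first.
  apply/seteqP; split=> A /=; rewrite mem_filter.
    by move=> [/SP -> ->].
  by move=> /andP[? /SP].
rewrite -fsbig_seq ?filter_uniq ?undup_uniq // big_filter.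
move=> /(congr1 (fun z : int => z%:~R : F)).
rewrite rmorph_sum /= => E.
rewrite (bigD1_seq fset0) ?undup_uniq //=; last exact/SP/link_simplex0.
rewrite expr0.
have -> : \sum_(A <- S | A != fset0) (-1 : F) ^+ #|` A| =
   - \sum_(A <- S | A != fset0) ((-1 : int) ^+ #|` A|.-1)%:~R.
  rewrite -sumrN; apply: eq_bigr => A A0.
  have : (0 < #|` A|)%N by rewrite cardfs_gt0.
  by case: (#|` A|) => // m _; rewrite /= rmorphXn rmorphN1 exprS mulN1r.
rewrite E rmorphD rmorph1 opprD addrA subrr add0r.
have -> : Posz n - Posz j - 1 = Posz (n - j) - 1 by lia.
(* For [j = n] the link is empty, of dimension -1, and the exponent is negative. *)
case: (n - j)%N => [|e]; first by rewrite sub0r exprN1 invrN1 rmorphN1 opprK expr0.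
have -> : Posz e.+1 - 1 = Posz e by lia.
by rewrite -exprnP rmorphXn rmorphN1 exprS mulN1r.
Qed.

End EulerSum.

(** * Reciprocity for B, with formal weights *)

Lemma sum_triangle (A : nmodType) n (F : nat -> nat -> A) :
  \sum_(k < n.+1) \sum_(j < n.+1 | (j <= k)%N) F k j =
  \sum_(j < n.+1) \sum_(i < n.+1 | (j + i <= n)%N) F (j + i)%N j.
Proof.
rewrite (exchange_big_dep xpredT) //=; apply: eq_bigr => j _.
rewrite -[LHS](big_mkord (fun k => j <= k)%N (fun k => F k j)).
rewrite -[RHS](big_mkord (fun i => j + i <= n)%N (fun i => F (j + i)%N j)).
rewrite (@big_cat_nat _ _ _ j) ?(ltnW (ltn_ord j)) //=.
rewrite [X in X + _]big_nat_cond [X in X + _]big_pred0 ?add0r; last by move=> i; lia.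
rewrite -{1}[nat_of_ord j]add0n big_addn.
rewrite [RHS](@big_cat_nat _ _ _ (n.+1 - j)) ?leq_subr //=.
rewrite [X in _ = _ + X]big_nat_cond [X in _ = _ + X]big_pred0 ?addr0; last by move=> i; lia.
rewrite big_nat_cond [RHS]big_nat_cond; apply: eq_big => [i|i _]; first by lia.
by rewrite addnC.
Qed.

Section Reciprocity.
Variables (K : cubeComplex) (n : nat).
Hypothesis eulerian : Eulerian n K.
Variable cellsK : forall k, seq (K k).
Hypothesis cells_uniq : forall k, uniq (cellsK k).
Hypothesis cells_all : forall k c, c \in cellsK k.
Variables (N : nat) (lab : K 1%N -> 'I_N).
Hypothesis lab_parallel : forall n (c : K n) i (a b : {ffun 'I_n -> bool}),
  lab (edge c i a) = lab (edge c i b).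
Variable F : fieldType.
Hypothesis F0 : forall k, k.+1%:R != 0 :> F.
Implicit Types s q : 'I_N -> F.

Definition cube_sum s q (z : K 0%N) k (c : K k) : F :=
  \sum_(a : {ffun 'I_k -> bool} | vx c a == z)
    \prod_i (if a i then s (dir_lab lab c i) else q (dir_lab lab c i)).

(** B(y,z) with arbitrary weights: [s] for the directions separating the two corners, [q] for the
    others. *)
Definition vertex_sum s q (y z : K 0%N) : F :=
  \sum_(k < n.+1) k`!%:R^-1 *
    \sum_(c <- cellsK k | vx c (zerov k) == y) cube_sum s q z c.

(** The sum [cube_sum] for the face of [c] at its origin spanned by the directions in [S]. *)
Definition subcube_sum s q z k (c : K k) (S : {set 'I_k}) : F :=
  \sum_(a : {ffun 'I_k -> bool} | [forall i, a i ==> (i \in S)] && (vx c a == z))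
    \prod_(i in S) (if a i then s (dir_lab lab c i) else q (dir_lab lab c i)).

Lemma cube_sum_subface s q z j k (c : K k) (h : 'I_j -> 'I_k) (hi : injective h) :
  cube_sum s q z (face (subface hi (zerov k)) c) = subcube_sum s q z c [set h i | i in 'I_j].
Proof.
rewrite /subcube_sum.
pose ext := face_vertex (subface hi (zerov k)).
pose res (a : {ffun 'I_k -> bool}) : {ffun 'I_j -> bool} := [ffun i => a (h i)].
have extE b i : ext b (h i) = b i by rewrite /ext face_vertex_sub ffunE.
have ext_out b m : m \notin [set h i | i in 'I_j]%SET -> ext b m = false.
  move=> H; rewrite /ext face_vertex_sub_out ?ffunE // => i.
  by apply: contraNneq H => <-; exact: imset_f.
rewrite (reindex_onto ext res) /=; last first.
  move=> a /andP[/forallP aS _]; apply/ffunP => m.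
  have [/imsetP[i _ ->]|H] := boolP (m \in [set h i | i in 'I_j]%SET).
    by rewrite extE ffunE.
  by rewrite ext_out //; have := aS m; rewrite (negPf H) implybF => /negPf ->.
apply: eq_big => [b|b _].
  have -> : res (ext b) = b by apply/ffunP => i; rewrite ffunE extE.
  rewrite eqxx andbT vx_face -/(ext b) andb_idl // => _.
  apply/forallP => m; apply/implyP; apply: contraLR => H.
  by rewrite ext_out.
rewrite big_imset /=; last by move=> x y _ _; exact: hi.
apply: eq_bigr => i _; rewrite extE.
suff -> : dir_lab lab (face (subface hi (zerov k)) c) i = dir_lab lab c (h i) by [].
by rewrite /dir_lab edge_face ffunE; exact: lab_parallel.
Qed.

(** In a direction with [a i = 0] the factor is -(1 + q): the summand 1 leaves the direction out of
    the face [S], the summand q keeps it. Directions with [a i = 1] are always kept. *)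
Lemma cube_sum_expand s q z k (c : K k) :
  cube_sum (fun h => - s h) (fun h => - (1 + q h)) z c =
  (-1) ^+ k * \sum_(S : {set 'I_k}) subcube_sum s q z c S.
Proof.
rewrite /subcube_sum (exchange_big_dep (fun a => vx c a == z)) /=; last first.
  by move=> S a _ /andP[].
rewrite mulr_sumr; apply: eq_bigr => a az.
transitivity (\prod_(i < k) ((-1) * (if a i then s (dir_lab lab c i) else 1 + q (dir_lab lab c i)))).
  by apply: eq_bigr => i _; case: (a i); rewrite mulN1r.
rewrite big_split /= prodr_const card_ord; congr (_ * _).
transitivity (\prod_(i < k) \sum_(b : bool)
   (if b then if a i then s (dir_lab lab c i) else q (dir_lab lab c i) else (~~ a i)%:R)).
  apply: eq_bigr => i _; rewrite big_bool /=.
  by case: (a i); rewrite ?addr0 // addrC.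
rewrite bigA_distr_bigA /=.
rewrite (reindex_onto (fun S : {set 'I_k} => [ffun i => i \in S]) (fun f : {ffun 'I_k -> bool} => [set i | f i]%SET)); last first.
  by move=> f _; apply/ffunP => i; rewrite ffunE inE.
rewrite [RHS]big_mkcond [LHS]big_mkcond /=; apply: eq_bigr => S _.
have -> : [set i | [ffun i0 => i0 \in S] i]%SET = S by apply/setP => i; rewrite inE ffunE.
rewrite eqxx az andbT; case: ifP => [/forallP aS|/negbT/forallPn[i]].
  rewrite [RHS]big_mkcond; apply: eq_bigr => i _; rewrite ffunE.
  by have := aS i; case: (i \in S); rewrite // implybF => ->.
rewrite negb_imply => /andP[ai iS].
by rewrite (bigD1 i) //= ffunE (negPf iS) ai mul0r.
Qed.

(** Passing from subsets to injections allows symmetries of the cubes to act on them. *)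
Lemma sum_injections k j (g : {set 'I_k} -> F) :
  \sum_(h : {ffun 'I_j -> 'I_k} | injectiveb h) g [set h i | i in 'I_j]%SET =
  j`!%:R * \sum_(S : {set 'I_k} | #|S| == j) g S.
Proof.
rewrite (partition_big (fun h : {ffun 'I_j -> 'I_k} => [set h i | i in 'I_j]%SET)
   (fun S => #|S| == j)) /=; last first.
  by move=> h /injectiveP hi; rewrite card_imset // card_ord.
rewrite mulr_sumr; apply: eq_bigr => S /eqP Sj.
rewrite (eq_bigr (fun=> g S)) => [|h /andP[_ /eqP -> //]].
rewrite sumr_const -[LHS]mulr_natl; congr (_ * g S).
have <- : #|S| ^_ #|'I_j| = j`! by rewrite Sj card_ord ffactnn.
rewrite -card_inj_ffuns_on; congr (_%:R).
apply: eq_card => h; rewrite !inE; apply/andP/andP.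
  move=> [hi /eqP <-]; split=> //; apply/ffun_onP => i; exact: imset_f.
move=> [/ffun_onP hS hi]; split=> //.
rewrite eqEcard; apply/andP; split.
  by apply/fintype.subsetP => m /imsetP[i _ ->].
by rewrite card_imset ?card_ord ?Sj //; exact/injectiveP.
Qed.

(** The cubes are grouped by their base face [D]; those over [D] are its link cubes. *)
Lemma sum_link s q y z j i :
  \sum_(c <- cellsK (j + i) | vx c (zerov (j + i)) == y) cube_sum s q z (face (base_face j i) c) =
  \sum_(D <- cellsK j | vx D (zerov j) == y) cube_sum s q z D *
     (count (fun c => `[< link_cube D c >]) (cellsK (j + i)))%:R.
Proof.
have base0 (c : K (j + i)) : vx (face (base_face j i) c) (zerov j) = vx c (zerov (j + i)).
  by rewrite vx_face (face_vertex0 (base_face j i)).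
transitivity (\sum_(D <- cellsK j | vx D (zerov j) == y)
   \sum_(c <- cellsK (j + i) | `[< link_cube D c >]) cube_sum s q z D); last first.
  by apply: eq_bigr => D _; rewrite big_const_seq iter_addr_0 mulr_natr.
rewrite (exchange_big_dep (fun c => vx c (zerov (j + i)) == y)) /=; last first.
  by move=> D c /eqP <- /asboolP <-; rewrite base0.
apply: eq_bigr => c /eqP cy.
rewrite (eq_bigl (fun D => D == face (base_face j i) c)); last first.
  move=> D; apply/andP/eqP => [[_ /asboolP <-]//|->].
  by rewrite base0 cy; split=> //; apply/asboolP.
rewrite (eq_bigr (fun=> cube_sum s q z (face (base_face j i) c))) => [|D /eqP -> //].
by rewrite big_const_seq iter_addr_0 count_uniq_mem // cells_all.
Qed.

(** A symmetry preserving the origin turns the face along [h] into the base face and permutes the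
    list of cubes, so every injection contributes the same amount. *)
Lemma sum_ordered_subcubes s q y z j i :
  \sum_(c <- cellsK (j + i) | vx c (zerov (j + i)) == y)
    \sum_(h : {ffun 'I_j -> 'I_(j + i)} | injectiveb h)
       subcube_sum s q z c [set h m | m in 'I_j]%SET =
  ((j + i) ^_ j)%:R *
  \sum_(c <- cellsK (j + i) | vx c (zerov (j + i)) == y) cube_sum s q z (face (base_face j i) c).
Proof.
rewrite exchange_big /=.
rewrite (eq_bigr (fun=> \sum_(c <- cellsK (j + i) | vx c (zerov (j + i)) == y)
   cube_sum s q z (face (base_face j i) c))); last first.
  move=> h /injectiveP hi; have [t ti tE] := extend_injection hi.
  rewrite [RHS](big_cells_symmetry cells_uniq cells_all (subface ti (zerov _))).
  apply: eq_big => [c|c _]; first by rewrite vx_face (face_vertex0 (subface ti _)).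
  rewrite -(cube_sum_subface s q z c hi); congr cube_sum.
  rewrite face_comp; congr (face _ c); apply: faceMap_eq.
    by apply/ffunP => m; rewrite !ffunE tE.
  exact/esym/(face_vertex0 (subface ti _)).
rewrite sumr_const -[LHS]mulr_natl; congr (_%:R * _).
have <- : #|'I_(j + i)| ^_ #|'I_j| = ((j + i) ^_ j)%N by rewrite !card_ord.
by rewrite -card_inj_ffuns; apply: eq_card => h; rewrite inE.
Qed.

Lemma sum_by_cardinal k (f : {set 'I_k} -> F) : (k <= n)%N ->
  \sum_S f S = \sum_(j < n.+1 | (j <= k)%N) \sum_(S : {set 'I_k} | #|S| == j) f S.
Proof.
move=> kn.
have Sk (S : {set 'I_k}) : (#|S| <= k)%N by rewrite -[X in (_ <= X)%N]card_ord max_card.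
have Sn (S : {set 'I_k}) : (#|S| < n.+1)%N by rewrite ltnS; exact: leq_trans kn.
rewrite (partition_big (fun S : {set 'I_k} => inord #|S| : 'I_n.+1) (fun j => (j <= k)%N)) /=.
  apply: eq_bigr => j _; apply: eq_bigl => S.
  by rewrite -val_eqE /= inordK.
by move=> S _; rewrite inordK.
Qed.

Theorem vertex_sum_reciprocity s q y z :
  vertex_sum (fun h => - s h) (fun h => - (1 + q h)) y z =
  (-1) ^+ n * vertex_sum s q y z.
Proof.
pose G k j : F := k`!%:R^-1 * (j`!%:R^-1 * ((-1) ^+ k *
  \sum_(c <- cellsK k | vx c (zerov k) == y)
    \sum_(h : {ffun 'I_j -> 'I_k} | injectiveb h) subcube_sum s q z c [set h i | i in 'I_j]%SET)).
transitivity (\sum_(k < n.+1) \sum_(j < n.+1 | (j <= k)%N) G k j).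
  apply: eq_bigr => k _; rewrite /G -mulr_sumr; congr (_ * _).
  rewrite (eq_bigr (fun c => (-1) ^+ k * \sum_(S : {set 'I_k}) subcube_sum s q z c S)); last first.
    by move=> c _; exact: cube_sum_expand.
  rewrite -mulr_sumr.
  transitivity (\sum_(j < n.+1 | (j <= k)%N) (-1) ^+ k *
      \sum_(c <- cellsK k | vx c (zerov k) == y)
         \sum_(S : {set 'I_k} | #|S| == j) subcube_sum s q z c S); last first.
    apply: eq_bigr => j _; rewrite [RHS]mulrCA; congr (_ * _).
    rewrite [X in _ = _ * X](eq_bigr (fun c => j`!%:R *
        \sum_(S : {set 'I_k} | #|S| == j) subcube_sum s q z c S)); last first.
      by move=> c _; exact: sum_injections.
    by rewrite -mulr_sumr mulKf // factF.
  rewrite -mulr_sumr; congr (_ * _); rewrite [RHS]exchange_big /=; apply: eq_bigr => c _.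
  by apply: sum_by_cardinal; rewrite -ltnS.
rewrite sum_triangle /vertex_sum mulr_sumr; apply: eq_bigr => j _.
transitivity (\sum_(i < n.+1) (j`!%:R^-1 * ((-1) ^+ (j + i) * (i`!%:R^-1 *
   \sum_(D <- cellsK j | vx D (zerov j) == y) cube_sum s q z D *
   (count (fun c => `[< link_cube D c >]) (cellsK (j + i)))%:R)))).
  (* There are no cubes beyond dimension [n], so the range of [i] can be extended. *)
  rewrite big_mkcond; apply: eq_bigr => i _; case: leqP => [jin|jin]; last first.
    have -> : cellsK (j + i) = [::].
      by case: cellsK => // c r; have := dim_le eulerian c; rewrite leqNgt jin.
    rewrite big1 ?mulr0 // => D _; by rewrite mulr0.
  rewrite /G sum_ordered_subcubes sum_link mulrCA; congr (_ * _).
  rewrite mulrCA; congr (_ * _); rewrite mulrA; congr (_ * _).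
  (* With k = j + i, dividing the number k!/i! of injections by k! leaves 1/i!, the factor in the
     Euler sum. *)
  rewrite -(ffact_fact (leq_addr i j)) addKn natrM invfM mulrAC mulVf ?mul1r //.
  apply: contraTneq (factF F0 (j + i)) => e.
  by rewrite -(ffact_fact (leq_addr i j)) natrM e mul0r eqxx.
rewrite -mulr_sumr [RHS]mulrCA; congr (_ * _).
rewrite mulr_sumr.
under eq_bigr => i _ do rewrite mulrA mulr_sumr.
rewrite exchange_big /=; apply: eq_bigr => D _.
have E := link_euler_sum eulerian cells_uniq cells_all F0 D.
have jn := dim_le eulerian D.
have -> : (-1) ^+ n = (-1) ^+ j * (-1) ^+ (n - j) :> F by rewrite -exprD subnKC.
rewrite -E [X in _ = X * _]mulr_sumr mulr_suml.
by apply: eq_bigr => i _; rewrite exprD; ring.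
Qed.

End Reciprocity.

(** * Rational functions *)

Section RationalFunctions.
Variable N : nat.
Local Notation P := {mpoly rat[N]}.
Local Notation F := (rational_functions N).
Local Notation tofrac := (@FracField.tofrac P).

Lemma rational_functions_char0 k : k.+1%:R != 0 :> F.
Proof.
rewrite -[_.+1%:R](rmorph_nat tofrac) tofrac_eq0 -[_%:R](rmorph_nat (@mpolyC N rat)).
by rewrite mpolyC_eq0 pnatr_eq0.
Qed.

Lemma frac_reprE (f : F) : tofrac (frac (repr f)).2 * f = tofrac (frac (repr f)).1.
Proof.
rewrite -{2}[f]reprK; set x := repr f.
unlock FracField.tofrac; rewrite -[LHS]FracField.pi_mul; apply/eqmodP.
have n1 : 1 != 0 :> P by exact: oner_neq0.
have d0 := denom_ratioP x.
rewrite /= FracField.equivfE /FracField.mulf !numden_Ratio ?mul1r ?mulr1 //.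
Qed.

Lemma mmap1_inv (m : 'X_{1..N}) :
  mmap1 (fun i => (tofrac 'X_i)^-1) m = (tofrac 'X_[m])^-1.
Proof.
rewrite mpolyXE_id rmorph_prod /mmap1 -prodfV; apply: eq_bigr => i _.
by rewrite rmorphXn exprVn.
Qed.

Definition eval_inv_morphism : {rmorphism P -> F} :=
  mmap (tofrac \o @mpolyC N rat) (fun i => (tofrac 'X_i)^-1).

Lemma eval_inv_morphismE p : eval_inv p = eval_inv_morphism p.
Proof. by []. Qed.

(** Multiplying p(1/t) by a large monomial gives a polynomial with the same coefficients and
    reversed exponents. *)
Lemma eval_inv_eq0 (p : P) : (eval_inv p == 0) = (p == 0).
Proof.
apply/idP/idP => [|/eqP ->]; last by rewrite eval_inv_morphismE rmorph0.
apply: contraTT => p0.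
pose M : 'X_{1..N} := [multinom msize p | i < N].
have le m : m \in msupp p -> (m <= M)%MM.
  move=> mp; apply/mnm_lepP => i; rewrite mnmE.
  apply: leq_trans (ltnW (msize_mdeg_lt mp)); rewrite mdegE (bigD1 i) //=; exact: leq_addr.
pose q := \sum_(m <- msupp p) p@_m *: 'X_[M - m] : P.
have qE : eval_inv p * tofrac 'X_[M] = tofrac q.
  rewrite /eval_inv /mmap mulr_suml rmorph_sum /=; apply: eq_big_seq => m mp.
  rewrite mmap1_inv -mul_mpolyC rmorphM -mulrA; congr (_ * _).
  rewrite -{1}(submK (le _ mp)) mpolyXD rmorphM mulrC mulfK //.
  rewrite tofrac_eq0; apply/eqP => /(congr1 (mcoeff m))/eqP.
  by rewrite mcoeffX mcoeff0 eqxx oner_eq0.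
apply/eqP => e; move: qE; rewrite e mul0r => /esym/eqP; rewrite tofrac_eq0 => /eqP q0.
have [m mp] : exists m, m \in msupp p.
  case E: (msupp p) => [|m r]; last by exists m; rewrite mem_head.
  by move/eqP: E; rewrite msupp_eq0 (negPf p0).
have := mcoeff0 rat (M - m)%MM; rewrite -q0 /q raddf_sum (bigD1_seq m) ?msupp_uniq //=.
rewrite mcoeffZ mcoeffX eqxx mulr1 big_seq_cond big1 ?addr0.
  by move/eqP; rewrite mcoeff_eq0 mp.
move=> m' /andP[m'p m'm]; rewrite mcoeffZ mcoeffX; case: eqP => [e2|_]; last by rewrite mulr0.
case/eqP: m'm; have : (M - m' + m' = M - m + m)%MM by rewrite !submK ?le.
rewrite e2 => /(congr1 (fun z => z - (M - m))%MM).
by rewrite [(_ + m')%MM]addmC [(_ + m)%MM]addmC !addmK.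
Qed.

(** The chosen representative of the fraction does not matter, because a nonzero denominator stays
    nonzero under [eval_inv]. *)
Lemma subst_invE (p q : P) : q != 0 ->
  subst_inv (tofrac p / tofrac q) = eval_inv p / eval_inv q.
Proof.
move=> q0; rewrite /subst_inv; set f := tofrac p / tofrac q.
have := frac_reprE f; have := denom_ratioP (repr f).
move: (frac (repr f)) => [a b] /= b0; rewrite /f => e.
apply/eqP; rewrite eqr_div ?eval_inv_eq0 //; apply/eqP.
rewrite !eval_inv_morphismE -!rmorphM; congr (eval_inv_morphism _).
apply/eqP; rewrite -tofrac_eq !rmorphM /= -e; apply/eqP.
by rewrite -mulrA divfK ?tofrac_eq0 // mulrC.
Qed.

Lemma mcoeff_mul_supp (q g : P) (m : 'X_{1..N}) :
  (q * g)@_m = \sum_(k <- msupp q | (k <= m)%MM) q@_k * g@_(m - k).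
Proof.
rewrite {1}[q]mpolyE mulr_suml raddf_sum [RHS]big_mkcond /=; apply: eq_bigr => k _.
rewrite -scalerAl mcoeffZ; case: ifP => [km|km].
  by rewrite mulrC -{1}(submK km) addmC mulrC; congr (_ * _); rewrite mulrC mcoeffMX.
rewrite mcoeffM big1 ?mulr0 // => -[a b] /= /eqP mE.
rewrite mcoeffX; case: eqP => [ka|_]; last by rewrite mul0r.
by have := lem_addr a b; rewrite -mE -ka km.
Qed.

Definition vanishes_to (D : nat) (p : P) := forall m : 'X_{1..N}, (mdeg m <= D)%N -> p@_m = 0.

Lemma vanishes_toM D p q : vanishes_to D p -> vanishes_to D (p * q).
Proof.
move=> H m mD; rewrite mcoeffM big1 // => -[a b] /= /eqP mE.
have abD : (mdeg a + mdeg b <= D)%N by rewrite -mdegD -mE.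
by rewrite H ?mul0r // (leq_trans (leq_addr _ _) abD).
Qed.

Lemma vanishes_to_sum D (I : Type) (r : seq I) (Q : pred I) (p : I -> P) :
  (forall i, Q i -> vanishes_to D (p i)) -> vanishes_to D (\sum_(i <- r | Q i) p i).
Proof.
by move=> H m mD; rewrite raddf_sum big1 // => i Qi; exact: H.
Qed.

End RationalFunctions.

(** * Inverting the matrix B *)

(** B is [A] divided by [d], and its inverse is [d] times the adjugate divided by the determinant.
    If B is multiplied by [e] with [e * e = 1], so is its inverse. *)
Lemma invertible_matrix_reciprocity (R : comNzRingType) (F : fieldType)
    (f f' : {rmorphism R -> F}) (M : nat) (A : 'M[R]_M) (d : R) (e : F) i j :
  f (\det A) != 0 -> f' (\det A) != 0 -> f d != 0 -> f' d != 0 -> e * e = 1 ->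
  (forall k l, f' (A k l) / f' d = e * (f (A k l) / f d)) ->
  f' (d * (\adj A) i j) / f' (\det A) = e * (f (d * (\adj A) i j) / f (\det A)).
Proof.
move=> d0 d0' e0 e0' ee H.
have inv (h : {rmorphism R -> F}) : h (\det A) != 0 -> h d != 0 ->
    ((h d)^-1 *: map_mx h A) *m ((h d / h (\det A)) *: map_mx h (\adj A)) = 1%:M.
  move=> h0 h1; rewrite -scalemxAl -scalemxAr scalerA -map_mxM mul_mx_adj map_scalar_mx.
  by rewrite mulrA mulVf // mul1r scale_scalar_mx mulVf.
have I := inv f d0 e0; have I' := inv f' d0' e0'.
have BB : (f' d)^-1 *: map_mx f' A = e *: ((f d)^-1 *: map_mx f A).
  by apply/matrixP => k l; rewrite !mxE mulrC H mulrC [f _ / _]mulrC mulrC.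
rewrite BB -scalemxAl in I'.
set B := _ *: map_mx f A in I I'; set V := _ *: map_mx f _ in I.
set V' := _ *: map_mx f' _ in I'.
have /(congr1 (mulmx V)) : B *m V' = e *: 1%:M.
  by rewrite -I' scalerA ee scale1r.
rewrite mulmxA (mulmx1C I) mul1mx -scalemxAr mulmx1 => /matrixP/(_ i j).
rewrite !mxE !rmorphM => E.
by rewrite mulrAC E; congr (_ * _); rewrite mulrAC.
Qed.

Section SeriesReciprocity.
Variables (K : cubeComplex) (n : nat).
Hypothesis eulerian : Eulerian n K.
Variable cellsK : forall k, seq (K k).
Hypothesis cells_uniq : forall k, uniq (cellsK k).
Hypothesis cells_all : forall k c, c \in cellsK k.
Variables (N : nat) (lab : K 1%N -> 'I_N).
Hypothesis lab_parallel : forall n (c : K n) i (a b : {ffun 'I_n -> bool}),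
  lab (edge c i a) = lab (edge c i b).
Local Notation P := {mpoly rat[N]}.
Local Notation F := (rational_functions N).
Local Notation tofrac := (@FracField.tofrac P).
Local Notation denom := (common_denominator N n).

(* B(y,z), multiplied by the common denominator. *)
Definition vertex_poly (y z : K 0%N) : P :=
  \sum_(k < n.+1) (k`!%:R^-1 : rat) *:
    \sum_(c <- cellsK k | vx c (zerov k) == y)
      \sum_(a : {ffun 'I_k -> bool} | vx c a == z) cube_weight n (dir_lab lab c) a.

Lemma vx0 (v : K 0%N) a : vx v a = v.
Proof. by rewrite /vx -[RHS]face_id; congr (face _ v); apply: faceMap0; apply/ffunP => -[]. Qed.

(** The weight of a cube of positive dimension is divisible by an indeterminate, so only the
    vertices contribute. *)
Lemma vertex_poly_const y z : (vertex_poly y z)@_0%MM = (y == z)%:R.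
Proof.
have X0 h : ('X_h : P)@_0%MM = 0.
  by rewrite mcoeffX; case: eqP => // /(congr1 mdeg); rewrite mdeg1 mdeg0.
have w0 k (l : 'I_k -> 'I_N) a : (cube_weight n l a)@_0%MM = (k == 0%N)%:R.
  rewrite /cube_weight rmorphM /cofactor rmorph_prod big1 => [|h _]; last first.
    by rewrite rmorphXn rmorphB rmorph1 rmorphXn /= X0 expr0n subr0 expr1n.
  rewrite mul1r rmorph_prod; case: k l a => [|k] l a; first by rewrite big_ord0.
  rewrite big_ord_recl /=; case: (a ord0); first by rewrite raddfN /= X0 oppr0 mul0r.
  by rewrite rmorphXn /= X0 expr0n mul0r.
rewrite /vertex_poly raddf_sum big_ord_recl /= [X in _ + X]big1 ?addr0; last first.
  move=> k _; rewrite mcoeffZ raddf_sum big1 ?mulr0 // => c _.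
  by rewrite raddf_sum big1 // => a _; rewrite /= w0.
rewrite mcoeffZ fact0 invr1 mul1r raddf_sum /=.
rewrite (eq_bigr (fun c => (c == z)%:R)); last first.
  move=> c _; rewrite raddf_sum /=.
  rewrite (eq_bigl (fun=> c == z)); last by move=> a; rewrite vx0.
  rewrite (eq_bigr (fun=> 1)) => [|a _]; last by rewrite w0.
  case: (c == z); last by rewrite big_pred0.
  by rewrite sumr_const card_ffun card_ord expn0.
rewrite (eq_bigl (fun c => c == y)); last by move=> c; rewrite vx0.
rewrite (eq_bigr (fun=> (y == z)%:R)) => [|c /eqP -> //].
by rewrite big_const_seq iter_addr_0 count_uniq_mem // cells_all.
Qed.

Lemma vertex_poly_morphism (F : fieldType) (F0 : forall k, k.+1%:R != 0 :> F)
    (f : {rmorphism P -> F}) (y z : K 0%N) :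
  (forall h, 1 - f 'X_h ^+ 2 != 0) ->
  f (vertex_poly y z) = f denom *
    vertex_sum n cellsK lab (fun h => - f 'X_h / (1 - f 'X_h ^+ 2))
                      (fun h => f 'X_h ^+ 2 / (1 - f 'X_h ^+ 2)) y z.
Proof.
move=> fX.
have fZ k p : f ((k`!%:R^-1 : rat) *: p) = k`!%:R^-1 * f p.
  apply: (mulfI (factF F0 k)).
  rewrite mulVKf ?(factF F0) //.
  rewrite -(rmorph_nat f) -rmorphM; congr (f _).
  rewrite -mul_mpolyC -[_%:R](rmorph_nat (@mpolyC N rat)) mulrA -rmorphM /=.
  by rewrite divff ?mpolyC1 ?mul1r // pnatr_eq0 -lt0n fact_gt0.
have fw k (l : 'I_k -> 'I_N) a : (k <= n)%N -> f (cube_weight n l a) = f denom *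
    \prod_i (if a i then - f 'X_(l i) / (1 - f 'X_(l i) ^+ 2)
             else f 'X_(l i) ^+ 2 / (1 - f 'X_(l i) ^+ 2)).
  move=> kn; rewrite /cube_weight rmorphM -(cofactorE l kn) rmorphM -mulrA; congr (_ * _).
  rewrite !rmorph_prod -big_split /=; apply: eq_bigr => i _.
  rewrite rmorphB rmorph1 rmorphXn.
  by case: (a i); rewrite ?rmorphN ?rmorphXn mulrC divfK.
rewrite /vertex_poly /vertex_sum rmorph_sum mulr_sumr; apply: eq_bigr => k _.
rewrite fZ mulrCA; congr (_ * _); rewrite rmorph_sum mulr_sumr; apply: eq_bigr => c _.
rewrite rmorph_sum /cube_sum mulr_sumr; apply: eq_bigr => a _.
by rewrite fw // -ltnS.
Qed.

Lemma denom_neq0 : denom != 0.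
Proof.
suff : denom@_0%MM != 0 by apply: contra_neq => ->; rewrite mcoeff0.
rewrite /common_denominator rmorph_prod big1 ?oner_eq0 // => h _.
rewrite rmorphXn rmorphB rmorph1 rmorphXn /= mcoeffX.
by case: eqP => [/(congr1 mdeg)|_]; rewrite ?mdeg1 ?mdeg0 // expr0n subr0 expr1n.
Qed.

(** Abstract morphisms stand for the two substitutions, so that the rules for the weights are
    identities in the single element [f 'X_h]. *)
Lemma vertex_poly_reciprocity (E : fieldType) (E0 : forall k, k.+1%:R != 0 :> E)
    (f f' : {rmorphism P -> E}) y z :
  (forall h, f 'X_h != 0) -> (forall h, 1 - f 'X_h ^+ 2 != 0) ->
  (forall h, f' 'X_h = (f 'X_h)^-1) -> f denom != 0 -> f' denom != 0 ->
  f' (vertex_poly y z) / f' denom = (-1) ^+ n * (f (vertex_poly y z) / f denom).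
Proof.
move=> X0 X2 XV d0 d0'.
have V2 h : 1 - (f 'X_h)^-1 ^+ 2 != 0.
  move: (X0 h) (X2 h); move: (f _) => t t0; apply: contra_neq => /eqP.
  by rewrite subr_eq0 exprVn => /eqP e; rewrite -[_ ^+ 2]invrK -e invr1 subrr.
rewrite (vertex_poly_morphism E0 (f := f)) //.
rewrite (vertex_poly_morphism E0 (f := f')); last by move=> h; rewrite XV.
rewrite mulrC mulKf // [f denom * _ / _]mulrC mulKf //.
rewrite -(vertex_sum_reciprocity eulerian cells_uniq cells_all lab_parallel E0).
congr (vertex_sum n cellsK lab _ _ y z); apply/funext => h; rewrite XV.
  by field; rewrite X2 X0 -opprB oppr_eq0 X2.
by field; rewrite X2 X0 -opprB oppr_eq0 X2.
Qed.

Lemma vertex_poly_eval_inv y z :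
  eval_inv_morphism N (vertex_poly y z) / eval_inv_morphism N denom =
  (-1) ^+ n * (tofrac (vertex_poly y z) / tofrac denom).
Proof.
apply: (vertex_poly_reciprocity (@rational_functions_char0 N)).
- move=> h; rewrite tofrac_eq0; apply: contraTneq isT => /(congr1 (mcoeff U_(h)%MM)) /eqP.
  by rewrite mcoeffX eqxx mcoeff0 oner_eq0.
- move=> h; rewrite -rmorphXn -(rmorph1 tofrac) -rmorphB tofrac_eq0.
  apply: contraTneq isT => /(congr1 (mcoeff 0%MM)) /eqP.
  rewrite rmorphB rmorphXn rmorph1 /= mcoeffX mcoeff0.
  by rewrite mnm1_eq0 expr0n subr0 oner_eq0.
- by move=> h; rewrite /eval_inv_morphism /= mmapX mmap1U.
- by rewrite tofrac_eq0 denom_neq0.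
- by rewrite -eval_inv_morphismE eval_inv_eq0 denom_neq0.
Qed.

Variable x : K 0%N.
Variable g : K 0%N -> 'X_{1..N} -> nat.
(** The row of growth series times B is the unit row at [x]; here this is required of polynomials
    agreeing with the series up to total degree [D], and only up to that degree. *)
Hypothesis truncations : forall D, exists G : K 0%N -> P,
  (forall y m, (mdeg m <= D)%N -> (G y)@_m = (g y m)%:R) /\
  forall z, vanishes_to D (\sum_(y <- cellsK 0%N) G y * vertex_poly y z -
                           (if z == x then denom else 0)).

Local Notation M := (size (cellsK 0%N)).
Local Notation v := (tnth (in_tuple (cellsK 0%N))).
Let A : 'M[P]_M := \matrix_(i, j) vertex_poly (v i) (v j).

Lemma vertex_index y : exists i, v i = y.
Proof. by have /(tnthP (in_tuple _))[i ->] := cells_all y; exists i. Qed.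

Lemma vertex_index_inj : injective v.
Proof. by apply/tuple_uniqP; exact: cells_uniq. Qed.

Lemma det_const : (\det A)@_0%MM = 1.
Proof.
have -> : (\det A)@_0%MM = \det (map_mx (mcoeff 0%MM) A) by rewrite -det_map_mx.
rewrite (_ : map_mx _ _ = 1%:M) ?det1 //; apply/matrixP => i j.
by rewrite !mxE vertex_poly_const (inj_eq vertex_index_inj).
Qed.

Lemma det_neq0 : \det A != 0.
Proof. by apply: contra_eq_neq det_const => ->; rewrite mcoeff0 eq_sym oner_eq0. Qed.

(** Multiply the truncated row relation by the adjugate of [A]. *)
Lemma truncated_inverse i j (ix : 'I_M) D (G : K 0%N -> P) : v ix = x ->
  (forall z, vanishes_to D (\sum_(y <- cellsK 0%N) G y * vertex_poly y z -
                           (if z == x then denom else 0))) ->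
  v i = j -> vanishes_to D (\det A * G j - denom * (\adj A) ix i).
Proof.
move=> vx EG vi.
pose r : 'rV[P]_M := \row_i G (v i).
pose E : 'rV[P]_M := r *m A - denom *: delta_mx ord0 ix.
have Ev l : vanishes_to D (E ord0 l).
  have := EG (v l); congr vanishes_to; rewrite !mxE.
  rewrite big_tnth; congr (_ - _).
    by apply: eq_bigr => k _; rewrite !mxE.
  rewrite -vx (inj_eq vertex_index_inj) eqxx /=.
  by case: eqP => _; rewrite ?mulr1 ?mulr0.
have -> : \det A * G j - denom * (\adj A) ix i = \sum_l E ord0 l * (\adj A) l i.
  transitivity ((E *m \adj A) ord0 i); last by rewrite mxE.
  rewrite /E mulmxBl -mulmxA mul_mx_adj mul_mx_scalar -scalemxAl -rowE !mxE.
  by rewrite vi.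
by apply: vanishes_to_sum => l _; exact: vanishes_toM.
Qed.

Theorem series_reciprocity w : exists f : F,
  expands_to f (g w) /\ subst_inv f = (-1) ^+ n * f.
Proof.
have [ix vix] := vertex_index x; have [iw viw] := vertex_index w.
exists (tofrac (denom * (\adj A) ix iw) / tofrac (\det A)); split.
  exists (denom * (\adj A) ix iw), (\det A); split=> //.
    by rewrite det_const oner_eq0.
  (* Only coefficients of degree at most that of [m] enter, so one truncation settles the
     coefficient of [m]. *)
  move=> m; have [G [Gg EG]] := truncations (mdeg m).
  have := truncated_inverse vix EG viw (leqnn (mdeg m)).
  rewrite mcoeffB => /eqP; rewrite subr_eq0 => /eqP <-; rewrite mcoeff_mul_supp.
  apply: eq_bigr => k km; rewrite Gg //.
  have := congr1 mdeg (submK km); rewrite mdegD => <-; exact: leq_addr.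
rewrite subst_invE ?det_neq0 // !eval_inv_morphismE.
apply: invertible_matrix_reciprocity.
- by rewrite tofrac_eq0 det_neq0.
- by rewrite -eval_inv_morphismE eval_inv_eq0 det_neq0.
- by rewrite tofrac_eq0 denom_neq0.
- by rewrite -eval_inv_morphismE eval_inv_eq0 denom_neq0.
- by rewrite -expr2 sqrr_sign.
move=> k l; rewrite !mxE; exact: vertex_poly_eval_inv.
Qed.

End SeriesReciprocity.

(** * The quotient by a free action *)

Local Close Scope ring_scope.
Local Open Scope classical_set_scope.

Arguments quotient_complex : simpl never.
Arguments source : simpl never.
Arguments target : simpl never.

Section Quotient.
Variables (R : realType) (G : groupType) (X : cubeComplex).
Variables (a : cellularAction G X) (afree : free_action R a).
Local Notation XG := (quotient_complex afree).
Local Notation proj := (@orbit_cube R G X a afree _).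

Lemma face_proj m n (f : faceMap m n) (c : X n) : face f (proj c) = proj (face f c).
Proof. exact: orbit_faceE. Qed.

Lemma source_proj (e : X 1%N) : source (proj e) = proj (source e).
Proof. exact: orbit_faceE. Qed.

Lemma target_proj (e : X 1%N) : target (proj e) = proj (target e).
Proof. exact: orbit_faceE. Qed.

Lemma rev_proj (e : X 1%N) : rev (proj e) = proj (rev e).
Proof. exact: orbit_faceE. Qed.

Lemma proj_act g n (c : X n) : proj (act a g c) = proj c.
Proof. by apply/esym/orbit_ofP; exists g. Qed.

Lemma proj_eq n (c c' : X n) : proj c = proj c' -> exists g, c' = act a g c.
Proof. by move/orbit_ofP. Qed.

Lemma proj_repr n (C : XG n) : proj (repr C) = C.
Proof. exact: orbit_of_repr. Qed.

Lemma act_free g h n (c : X n) : act a g c = act a h c -> g = h.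
Proof.
move=> e; have : act a (h^-1 * g)%g c = c by rewrite actM e -actM mulVg act1.
move=> e1; have : (h^-1 * g)%g = 1%g.
  by apply: (afree (c := c) (p := cube_origin R n)); rewrite e1.
by move/(congr1 (fun k => h * k)%g); rewrite mulgA mulgV mul1g mulg1.
Qed.

Definition quotient_param (s : param_points R X) : realization R XG :=
  point_of (proj (tagged (tag s))) (tagged s).

Lemma quotient_param_glue s t : gclass (@glue R X) s = gclass (@glue R X) t ->
  quotient_param s = quotient_param t.
Proof.
move=> /gclassP; elim=> {s t} [_ _ [m n f c p q pq]|//|s t _ -> //|s t r _ -> _ -> //].
rewrite /quotient_param /=; apply/gclassP/Relation_Operators.rst_step.
by rewrite -face_proj; exact: Glue.
Qed.

Definition quotient_map : realization R X -> realization R XG := quotient_param \o repr.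

Lemma quotient_mapE n (c : X n) (p : set_type (unit_cube R n)) :
  quotient_map (point_of c p) = point_of (proj c) p.
Proof.
have -> : point_of (proj c) p = quotient_param (param_point c p) by [].
by apply: quotient_param_glue; exact: reprK.
Qed.

Lemma quotient_map_continuous : continuous quotient_map.
Proof.
apply: repr_comp_continuous => [|s t /eqP st].
  move=> [c p] U nU; apply: (@existT_continuous (cells X) (fun s => set_type (unit_cube R (tag s)))).
  exact: (@point_of_continuous R XG _ (proj (tagged c))).
by apply/eqP; exact: quotient_param_glue.
Qed.

Lemma trace_proj u p :
  @trace R _ (proj u) (map proj p) = quotient_map \o @trace R _ u p.
Proof.
elim: p u => [|e p IH] u /=.
  by apply/funext => t; rewrite /= /vertex_point quotient_mapE.
by rewrite target_proj IH; apply/funext => t; rewrite /concat /=; case: ifP => _; rewrite ?quotient_mapE.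
Qed.

Lemma edge_path_proj u p v : is_edge_path u p v ->
  is_edge_path (proj u) (map proj p) (proj v).
Proof.
elim: p u => [|e p IH] u /=; first by move->.
by move=> [<- /IH]; rewrite source_proj target_proj.
Qed.

(** Edge by edge: the representative of the next edge is translated to start where the lift has
    arrived. *)
Lemma edge_path_lift u (q : seq (XG 1%N)) y : is_edge_path (proj u) q y ->
  exists p v, [/\ is_edge_path u p v, map proj p = q & proj v = y].
Proof.
elim: q u => [|E q IH] u /=; first by exists [::], u.
move=> [+ Eq]; rewrite -(proj_repr E) in Eq *; set e := repr E in Eq *.
rewrite source_proj => /proj_eq[g ue].
have [|p [v [pv pq vy]]] := IH (target (act a g e)).
  by rewrite /target -act_face proj_act -target_proj.
exists (act a g e :: p), v; split=> //=; last by rewrite pq proj_act.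
by split=> //; rewrite /source -act_face -ue.
Qed.

(** The position of [v] in its orbit, which the chosen representative identifies with [G]. *)
Definition deck (v : X 0%N) : G := projT1 (cid (proj_eq (proj_repr (proj v)))).

Lemma deckK v : act a (deck v) (repr (proj v)) = v.
Proof. by rewrite /deck; case: cid. Qed.

Lemma deck_act g v : deck (act a g v) = (g * deck v)%g.
Proof.
apply: (act_free (c := repr (proj v))); rewrite actM deckK.
by rewrite -[in repr _](proj_act g v) deckK.
Qed.

Lemma deck_inj v v' : proj v = proj v' -> deck v = deck v' -> v = v'.
Proof. by move=> e d; rewrite -(deckK v) -(deckK v') e d. Qed.

(** The covering of X/G by X as a local system: the change of position along a lift of [E], the same
    for all lifts. *)
Definition deck_edge (E : XG 1%N) : G :=
  ((deck (source (repr E)))^-1 * deck (target (repr E)))%g.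

Lemma deck_edgeE (e : X 1%N) :
  deck_edge (proj e) = ((deck (source e))^-1 * deck (target e))%g.
Proof.
have [g ge] := proj_eq (proj_repr (proj e)).
rewrite /deck_edge [in RHS]ge /source /target -!act_face !deck_act invgM.
by rewrite -mulgA mulKg.
Qed.

Definition deck_transport (E : XG 1%N) (g : G) : G := (g * deck_edge E)%g.

Lemma edge_proj n (c : X n) i b : edge (proj c) i b = proj (edge c i b).
Proof. exact: orbit_faceE. Qed.

Lemma deck_local_system : local_system deck_transport.
Proof.
split=> [E g|Q g].
  rewrite -(proj_repr E) /deck_transport rev_proj !deck_edgeE.
  by rewrite source_rev target_rev; rewrite !mulgA mulgK mulgVK.
rewrite -(proj_repr Q); move: (repr Q) => c.
rewrite /deck_transport /right_edge /bottom_edge /left_edge /top_edge !edge_proj !deck_edgeE.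
by rewrite -!mulgA !source_edge !target_edge !mulVKg flipvC.
Qed.

Lemma deck_fold u p v g : is_edge_path u p v ->
  foldl (fun h E => deck_transport E h) g (map proj p) = (g * ((deck u)^-1 * deck v))%g.
Proof.
elim: p u g => [|e p IH] u g /=; first by move->; rewrite mulVg mulg1.
by move=> [<- /IH ->]; rewrite /deck_transport deck_edgeE -!mulgA mulVKg.
Qed.

(** Homotopic projections have equal transport in [G], hence lifts with the same end. Conversely,
    paths in the simply connected X with common ends are homotopic, and the homotopy projects. *)
Theorem projected_homotopy u p v p' v' : simply_connected R (realization R X) ->
  is_edge_path u p v -> is_edge_path u p' v' -> proj v = proj v' ->
  homotopic (vertex_point R (proj u)) (vertex_point R (proj v))
    (@trace R _ (proj u) (map proj p)) (@trace R _ (proj u) (map proj p')) <-> v = v'.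
Proof.
move=> sc pv pv' vv'; split=> [H|e].
  have P := edge_path_proj pv; have P' := edge_path_proj pv'; rewrite -vv' in P'.
  have := homotopic_transport deck_local_system 1%g P P' H.
  rewrite (deck_fold _ pv) (deck_fold _ pv') !mul1g => /(congr1 (fun k => deck u * k)%g).
  by rewrite !mulVKg; exact: deck_inj.
rewrite -{}e {vv'} in pv' *; rewrite !trace_proj.
rewrite /vertex_point -!quotient_mapE; apply: homotopic_image; first exact: quotient_map_continuous.
by apply: simply_connected_homotopic; [exact: sc|exact: trace_path|exact: trace_path].
Qed.

End Quotient.

(** * The growth series as a sum over the vertices of X *)

Section Growth.
Variables (R : realType) (G : groupType) (X : cubeComplex).
Variables (a : cellularAction G X) (afree : free_action R a).
Local Notation XG := (quotient_complex afree).
Local Notation proj := (@orbit_cube R G X a afree _).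
Hypothesis contractible : simply_connected R (realization R X).
Hypothesis simplicial : forall v : X 0, link_is_simplicial v.
Hypothesis flag : forall v : X 0, link_is_flag v.

Lemma simply_connected_edge_connected (u v : X 0) : edge_connected u v.
Proof.
by have [p] := contractible.1 (vertex_point R u) (vertex_point R v); exact: path_edge_connected.
Qed.

Lemma simply_connected_transport u p q v (z : word X) :
  is_edge_path u p v -> is_edge_path u q v ->
  foldl (fun z e => append e z) z p = foldl (fun z e => append e z) z q.
Proof.
move=> pv qv; apply: (homotopic_transport (append_local_system simplicial flag) _ pv qv).
by apply: simply_connected_homotopic; [exact: contractible|exact: trace_path|exact: trace_path].
Qed.

Variables (N : nat) (hyp : 'I_N -> hyperplane_orbit a).
Hypothesis hyp_inj : injective hyp.
Variable lab : X 1 -> 'I_N.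
Hypothesis labE : forall e, hyp (lab e) = hyperplane_orbit_of a (hyperplane_of e).

Lemma lab_parallel n (c : X n) i (b b' : {ffun 'I_n -> bool}) :
  lab (edge c i b) = lab (edge c i b').
Proof.
apply: hyp_inj; rewrite !labE; congr hyperplane_orbit_of.
by apply/gclassP/rst_step; do 4 eexists; split; [|reflexivity|reflexivity].
Qed.

Lemma lab_act g e : lab (act a g e) = lab e.
Proof.
apply: hyp_inj; rewrite !labE; apply/esym/gclassP/rst_step.
by exists g, e.
Qed.

Definition orbit_lab (E : XG 1) : 'I_N := lab (repr E).

Lemma orbit_labE (e : X 1) : orbit_lab (proj e) = lab e.
Proof. by have [g ge] := proj_eq (proj_repr (proj e)); rewrite [in RHS]ge lab_act. Qed.

Lemma orbit_lab_parallel n (c : XG n) i (b b' : {ffun 'I_n -> bool}) :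
  orbit_lab (edge c i b) = orbit_lab (edge c i b').
Proof. by rewrite -(proj_repr c) !edge_proj !orbit_labE; exact: lab_parallel. Qed.

Lemma count_lab_proj p i :
  count (fun e => lab e == i) p = count (fun E => orbit_lab E == i) (map proj p).
Proof. by rewrite count_map; apply: eq_count => e /=; rewrite orbit_labE. Qed.

Lemma count_hyp p i :
  count (fun e => hyperplane_orbit_of a (hyperplane_of e) == hyp i) p =
  count (fun e => lab e == i) p.
Proof. by apply: eq_count => e; rewrite /= -labE (inj_eq hyp_inj). Qed.

Variable u : X 0.
Local Notation degree := (degree lab simply_connected_edge_connected u).

Let geodesic_ex v : exists p, is_edge_path u p v /\ word_degree lab p = degree v.
Proof.
by have [p pv pd] := geodesic_path simplicial flag lab simply_connected_edge_connected u v; exists p.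
Qed.

Let geo v := projT1 (cid (geodesic_ex v)).

Let geoP v : is_edge_path u (geo v) v.
Proof. exact: (projT2 (cid (geodesic_ex v))).1. Qed.

Let geo_degree v : word_degree lab (geo v) = degree v.
Proof. exact: (projT2 (cid (geodesic_ex v))).2. Qed.

Definition path_class x y (p : R -> realization R XG) : set (R -> realization R XG) :=
  [set q | is_path x y q /\ homotopic x y p q].

Lemma path_class_eq x y p q : homotopic x y p q -> path_class x y p = path_class x y q.
Proof.
move=> pq; apply/seteqP; split=> r [ry pr]; split=> //.
  exact: homotopic_trans (homotopic_sym pq) pr.
exact: homotopic_trans pq pr.
Qed.

(** The class of the projected geodesic to [v]: it matches the vertices over [y] with the classes
    counted by the series. *)
Let cls v := path_class (vertex_point R (proj u)) (vertex_point R (proj v))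
  (@trace R _ (proj u) (map proj (geo v))).

Let geo_path v : is_path (vertex_point R (proj u)) (vertex_point R (proj v))
  (@trace R _ (proj u) (map proj (geo v))).
Proof. exact/trace_path/edge_path_proj/geoP. Qed.

Let geo_homotopic p v v' : is_edge_path u p v -> proj v = proj v' ->
  homotopic (vertex_point R (proj u)) (vertex_point R (proj v))
    (@trace R _ (proj u) (map proj p)) (@trace R _ (proj u) (map proj (geo v'))) <-> v = v'.
Proof. by move=> pv vv'; exact: projected_homotopy (geoP v') vv'. Qed.

Let cls_inj v v' : proj v = proj v' -> cls v = cls v' -> v = v'.
Proof.
move=> vv' e; apply/(geo_homotopic (geoP v) vv').
have : cls v' (@trace R _ (proj u) (map proj (geo v'))).
  by split; [exact: geo_path|apply/(geo_homotopic (geoP v')) ].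
by rewrite -e => -[].
Qed.

Let geo_size v : size (map proj (geo v)) = mdeg (degree v).
Proof. by rewrite size_map -(word_degree_size lab) geo_degree. Qed.

Let degree_le p v : is_edge_path u p v ->
  mdeg (degree v) <= size p /\ (mdeg (degree v) = size p -> degree v = word_degree lab p).
Proof. exact: (degree_path simplicial flag lab_parallel simply_connected_edge_connected simply_connected_transport). Qed.

Let cls_tau v m : degree v = m -> tau_is hyp (proj u) (proj v) (cls v) m.
Proof.
move=> <-; exists u, v, (geo v); split; first exact: geoP.
  split; [exact/edge_path_proj/geoP|by split; [exact: geo_path|apply/(geo_homotopic (geoP v))]|].
  move=> q qv [_ H]; have [p [w [pw pq wv]]] := edge_path_lift qv.
  rewrite -pq in H *; rewrite geo_size size_map.
  have -> : v = w.
    exact: (projected_homotopy contractible (geoP v) pw (esym wv)).1 H.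
  exact: (degree_le pw).1.
by move=> i; rewrite count_hyp -geo_degree mnmE.
Qed.

Let tau_cls y C m : homotopy_classes (vertex_point R (proj u)) (vertex_point R y) C ->
  tau_is hyp (proj u) y C m -> exists v, [/\ C = cls v, proj v = y & degree v = m].
Proof.
move=> [c cp CE] [u' [v' [p' [pv' [p'y Cp' minp'] mE]]]].
(* The path supplied by [tau_is] need not start at [u]; its projection is lifted again from [u]. *)
have [p [v [pv pp' vy]]] := edge_path_lift p'y; rewrite -{}vy in cp CE minp' Cp' p'y *.
have Cv : C = cls v.
  rewrite CE -/(path_class _ _ _) in Cp' *; rewrite (path_class_eq Cp'.2).
  by apply: path_class_eq; rewrite -pp'; apply/(geo_homotopic pv).
exists v; split=> //.
have [le eqD] := degree_le pv.
rewrite eqD; last first.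
  apply/eqP; rewrite eqn_leq le -geo_size -(size_map (fun e : X 1 => proj e)) pp' minp' //.
    exact/edge_path_proj/geoP.
  by rewrite Cv; split; [exact: geo_path|apply/(geo_homotopic (geoP v))].
by apply/mnmP => i; rewrite mnmE mE count_hyp !count_lab_proj pp'.
Qed.

(** [B] is any finite list containing the vertices of degree [m]; it makes the count over the
    vertices of X meaningful. *)
Theorem growth_series_count (B : seq (X 0)) y m : uniq B ->
  (forall v, degree v = m -> v \in B) ->
  growth_series hyp (proj u) y m = count (fun v => (proj v == y) && (degree v == m)) B.
Proof.
move=> uB Bm; rewrite /growth_series .
set S := [set C | _].
pose L := [seq v <- B | (proj v == y) && (degree v == m)].
have inL v : v \in L -> proj v = y /\ degree v = m.
  by rewrite mem_filter => /andP[/andP[/eqP -> /eqP ->]].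
have -> : S = [set` [fset cls v | v in L]%fset].
  apply/seteqP; split=> [C [hC tC]|C].
    have [v [-> vy vm]] := tau_cls hC tC.
    apply/imfsetP; exists v => //; rewrite mem_filter vy vm !eqxx; exact: Bm.
  move=> /imfsetP[v /inL[vy vm] ->]; rewrite /S /= -vy; split; last exact: cls_tau.
  by exists (@trace R _ (proj u) (map proj (geo v))); first exact: geo_path.
rewrite set_fsetK card_in_imfset /=; last first.
  by move=> v w /inL[vy _] /inL[wy _]; apply: cls_inj; rewrite vy wy.
by rewrite undup_id ?filter_uniq // size_filter.
Qed.

End Growth.

Local Open Scope ring_scope.

(** * The relation between the growth series and B, up to a given degree *)

Section FlipCubes.
Variable K : cubeComplex.

(** Reparametrizes [c] so that its corner [b] becomes the origin; the old origin becomes the corner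
    [b]. *)
Definition flip_cube n (b : {ffun 'I_n -> bool}) (c : K n) : K n :=
  face (subface (@inj_id 'I_n) b) c.

Lemma flip_vertex n (b d : {ffun 'I_n -> bool}) i :
  face_vertex (subface (@inj_id 'I_n) b) d i = b i (+) d i.
Proof. exact: (face_vertex_sub (@inj_id 'I_n)). Qed.

Lemma flip_cubeK n (b : {ffun 'I_n -> bool}) : involutive (flip_cube b).
Proof.
move=> c; rewrite /flip_cube face_comp -[RHS]face_id; congr (face _ c).
apply: faceMap_eq; apply/ffunP => i; first by rewrite !ffunE.
by rewrite [in LHS]/= flip_vertex ffunE addbb.
Qed.

Lemma flip_cube_origin n b (c : K n) : vx (flip_cube b c) (zerov n) = vx c b.
Proof. by rewrite vx_face (face_vertex0 (subface _ b)). Qed.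

Lemma flip_cube_corner n b (c : K n) : vx (flip_cube b c) b = vx c (zerov n).
Proof. by rewrite vx_face; congr vx; apply/ffunP => i; rewrite flip_vertex addbb ffunE. Qed.

Lemma dir_lab_flip N (lab : K 1%N -> 'I_N) n b (c : K n) :
  (forall n (c : K n) i (b b' : {ffun 'I_n -> bool}), lab (edge c i b) = lab (edge c i b')) ->
  dir_lab lab (flip_cube b c) = dir_lab lab c.
Proof.
move=> lp; apply/funext => i; rewrite /dir_lab edge_face ffunE; exact: lp.
Qed.

End FlipCubes.

Section Truncations.
Variables (R : realType) (G : groupType) (X : cubeComplex).
Variables (a : cellularAction G X) (afree : free_action R a).
Local Notation XG := (quotient_complex afree).
Local Notation proj := (@orbit_cube R G X a afree _).

Lemma proj_vx n (c : X n) b : vx (proj c) b = proj (vx c b).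
Proof. exact: orbit_faceE. Qed.

(** The group element relating the two lifts fixes a vertex, so it is trivial. *)
Lemma lift_unique n (c c' : X n) b : proj c = proj c' -> vx c b = vx c' b -> c = c'.
Proof.
move=> /proj_eq[g ->]; rewrite /vx -act_face => e.
by rewrite -(act_free afree (g := 1) (h := g) (c := vx c b)) ?act1.
Qed.

Variable cellsK : forall k, seq (XG k).
Hypothesis cells_uniq : forall k, uniq (cellsK k).
Hypothesis cells_all : forall k c, c \in cellsK k.

Definition lift_at k (w : X 0%N) (C : XG k) : option (X k) :=
  if pselect (exists c : X k, proj c = C /\ vx c (zerov k) = w) is left H
  then Some (projT1 (cid H)) else None.

Lemma lift_atP k w C (c : X k) : lift_at w C = Some c <-> proj c = C /\ vx c (zerov k) = w.
Proof.
rewrite /lift_at; case: pselect => [H|H]; last by split=> // Hc; case: H; exists c.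
case: cid => c' [c'C c'w] /=; split=> [[<-]//|[cC cw]].
by congr Some; apply: (lift_unique (b := zerov k)); rewrite ?c'w ?c'C.
Qed.

(** The cubes with origin [w] form a finite list, as each cell of X/G has at most one lift with that
    origin. *)
Definition cubes_at k (w : X 0%N) : seq (X k) := pmap (lift_at w) (cellsK k).

Lemma mem_cubes_at k w c : (c \in cubes_at k w) = (vx c (zerov k) == w).
Proof.
rewrite mem_pmap; apply/mapP/eqP => [[C _ /esym/lift_atP[]//]|cw].
by exists (proj c); [exact: cells_all|apply/esym/lift_atP].
Qed.

Lemma cubes_at_uniq k w : uniq (cubes_at k w).
Proof.
apply: (pmap_uniq (g := fun c : X k => proj c)) => // C.
by case E: (lift_at w C) => [c|] //=; have /lift_atP[] := E.
Qed.

Lemma big_cubes_at (A : nmodType) k w (F : XG k -> A) :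
  \sum_(C <- cellsK k | vx C (zerov k) == proj w) F C = \sum_(c <- cubes_at k w) F (proj c).
Proof.
rewrite -big_filter -[RHS](big_map (fun c : X k => proj c) xpredT F); apply: perm_big.
apply: uniq_perm; first exact: filter_uniq.
  rewrite map_inj_in_uniq ?cubes_at_uniq // => c c'; rewrite !mem_cubes_at => /eqP cw /eqP cw' e.
  by apply: (lift_unique e (b := zerov k)); rewrite cw.
move=> C; rewrite mem_filter cells_all andbT; apply/eqP/mapP => [|[c + ->]].
  rewrite -(proj_repr C) proj_vx => /proj_eq[g ge].
  exists (act a g (repr C)); last by rewrite proj_act.
  by rewrite mem_cubes_at /vx -act_face -ge.
by rewrite mem_cubes_at proj_vx => /eqP ->.
Qed.

Definition cubes_from k (B : seq (X 0%N)) : seq (X k) := flatten [seq cubes_at k w | w <- B].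

Lemma mem_cubes_from k B c : (c \in cubes_from k B) = (vx c (zerov k) \in B).
Proof.
apply/flattenP/idP => [[s /mapP[w wB ->]]|cB]; first by rewrite mem_cubes_at => /eqP ->.
exists (cubes_at k (vx c (zerov k))); last by rewrite mem_cubes_at.
by apply/mapP; exists (vx c (zerov k)).
Qed.

Lemma cubes_from_uniq k B : uniq B -> uniq (cubes_from k B).
Proof.
rewrite /cubes_from; elim: B => [|w B IH] //= /andP[wB uB].
rewrite cat_uniq cubes_at_uniq IH // andbT /=; apply/hasPn => c.
rewrite -/(cubes_from k B) mem_cubes_from /= mem_cubes_at => cB.
by apply: contraNneq wB => <-.
Qed.

Lemma big_cubes_from (A : nmodType) k B (F : X 0%N -> X k -> A) :
  \sum_(w <- B) \sum_(c <- cubes_at k w) F w c = \sum_(c <- cubes_from k B) F (vx c (zerov k)) c.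
Proof.
rewrite big_flatten big_map; apply: eq_bigr => w _; apply: eq_big_seq => c.
by rewrite mem_cubes_at => /eqP ->.
Qed.

(** Vertices at edge distance at most [k], possibly with repetitions; finite because the stars
    are. *)
Fixpoint ball (k : nat) (u : X 0%N) : seq (X 0%N) :=
  u :: if k is k'.+1 then flatten [seq ball k' (target e) | e <- cubes_at 1 u] else [::].

Lemma mem_ball u p v k : is_edge_path u p v -> (size p <= k)%N -> v \in ball k u.
Proof.
elim: p u k => [|e p IH] u k /=; first by move=> ->; case: k => *; rewrite mem_head.
case: k => // k [<- pv] pk; rewrite /= in_cons; apply/orP; right.
apply/flattenP; exists (ball k (target e)); last exact: IH.
by apply/mapP; exists e; rewrite // mem_cubes_at.
Qed.

Hypothesis contractible : simply_connected R (realization R X).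
Hypothesis simplicial : forall v : X 0%N, link_is_simplicial v.
Hypothesis flag : forall v : X 0%N, link_is_flag v.
Variables (n : nat) (N : nat) (hyp : 'I_N -> hyperplane_orbit a).
Hypothesis eulerian : Eulerian n XG.
Hypothesis hyp_inj : injective hyp.
Variable lab : X 1%N -> 'I_N.
Hypothesis labE : forall e, hyp (lab e) = hyperplane_orbit_of a (hyperplane_of e).
Variable u : X 0%N.
Local Notation connected := (simply_connected_edge_connected contractible).
Local Notation degree := (degree lab connected u).
Local Notation monomial := (monomial lab connected u).
Local Notation P := {mpoly rat[N]}.
Local Notation parallel := (lab_parallel hyp_inj labE).
Let labK : XG 1%N -> 'I_N := orbit_lab lab.

Lemma degree_ball D : exists2 B : seq (X 0%N), uniq B &
  forall v, (v \in B) = (mdeg (degree v) <= D)%N.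
Proof.
exists [seq v <- undup (ball D u) | (mdeg (degree v) <= D)%N].
  by rewrite filter_uniq ?undup_uniq.
move=> v; rewrite mem_filter mem_undup andb_idr // => vD.
have [p pv pd] := geodesic_path simplicial flag lab connected u v.
by apply: mem_ball pv _; rewrite -(word_degree_size lab) pd.
Qed.

Lemma dir_lab_proj k (c : X k) : dir_lab labK (proj c) = dir_lab lab c.
Proof. by apply/funext => i; rewrite /dir_lab edge_proj /labK (orbit_labE afree hyp_inj labE). Qed.

Lemma vertex_poly_proj v z : vertex_poly n cellsK labK (proj v) z =
  \sum_(k < n.+1) (k`!%:R^-1 : rat) *: \sum_(c <- cubes_at k v)
    \sum_(b : {ffun 'I_k -> bool} | proj (vx c b) == z) cube_weight n (dir_lab lab c) b.
Proof.
apply: eq_bigr => k _; congr (_ *: _); rewrite big_cubes_at; apply: eq_bigr => c _.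
by rewrite dir_lab_proj; apply: eq_bigl => b; rewrite proj_vx.
Qed.

(* Every vertex of B' is weighted by the cubes having one corner there and
   another corner in B; flipping the cube exchanges the two corners. *)
Lemma exchange_corners k (B B' : seq (X 0%N)) z : uniq B -> uniq B' ->
  (forall (c : X k) b, vx c (zerov k) \in B -> vx c b \in B') ->
  \sum_(v <- B) \sum_(c <- cubes_at k v)
    \sum_(b : {ffun 'I_k -> bool} | proj (vx c b) == z) monomial v * cube_weight n (dir_lab lab c) b =
  \sum_(w <- B' | proj w == z) \sum_(c <- cubes_at k w)
    \sum_(b : {ffun 'I_k -> bool} | vx c b \in B)
       monomial (vx c b) * cube_weight n (dir_lab lab c) b.
Proof.
move=> uB uB' BB'.
rewrite big_cubes_from [RHS]big_mkcond /=.
under [RHS]eq_bigr => w _.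
  rewrite (_ : (if _ then _ else _) = \sum_(c <- cubes_at k w)
    \sum_(b : {ffun 'I_k -> bool} | (proj w == z) && (vx c b \in B))
       monomial (vx c b) * cube_weight n (dir_lab lab c) b); last first.
    case: ifP => // _; rewrite big1 // => c _; exact: big_pred0.
  over.
rewrite big_cubes_from.
under [LHS]eq_bigr => c _ do rewrite big_mkcond /=.
under [RHS]eq_bigr => c _ do rewrite big_mkcond /=.
rewrite exchange_big [RHS]exchange_big /=; apply: eq_bigr => b _.
rewrite -!big_mkcond -[LHS]big_filter -[RHS]big_filter.
rewrite [RHS](perm_big [seq flip_cube b c | c <- [seq c <- cubes_from k B | proj (vx c b) == z]]) /=.
  rewrite [RHS]big_map; apply: eq_bigr => c _.
  by rewrite flip_cube_corner dir_lab_flip //; exact: parallel.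
apply: uniq_perm.
- by rewrite filter_uniq ?cubes_from_uniq.
- by rewrite map_inj_uniq ?filter_uniq ?cubes_from_uniq //; exact: can_inj (flip_cubeK b).
move=> c; rewrite mem_filter mem_cubes_from -[in RHS](flip_cubeK b c) mem_map; last first.
  exact: can_inj (flip_cubeK b).
rewrite mem_filter mem_cubes_from flip_cube_origin flip_cube_corner.
rewrite -andbA; congr (_ && _); rewrite andb_idr // => cB.
by rewrite -(flip_cube_corner b); apply: BB'; rewrite flip_cube_origin.
Qed.

(** The truncations keep the vertices of degree at most [D]. After the exchange of corners, the
    relation differs from the sum of the local identities only by terms whose monomials have degree
    above [D]. *)
Lemma truncations D : exists Gs : XG 0%N -> P,
  (forall y m, (mdeg m <= D)%N -> (Gs y)@_m = (growth_series hyp (proj u) y m)%:R) /\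
  forall z, vanishes_to D (\sum_(y <- cellsK 0%N) Gs y * vertex_poly n cellsK labK y z -
                           (if z == proj u then common_denominator N n else 0)).
Proof.
have [B uB BD] := degree_ball D.
exists (fun y => \sum_(v <- B | proj v == y) monomial v); split.
  move=> y m mD.
  rewrite (growth_series_count simplicial flag hyp_inj labE (B := B)) //; last first.
    by move=> v e; rewrite BD e.
  rewrite raddf_sum /= (eq_bigr (fun v => (degree v == m)%:R)); last first.
    by move=> v _; rewrite mcoeffX.
  by rewrite -sum1_count natr_sum [RHS]big_mkcondr /=; apply: eq_bigr => v _; case: eqP.
move=> z.
pose corners k := flatten [seq [seq vx c b | b <- enum {ffun 'I_k -> bool}] | c <- cubes_from k B].
(* All vertices that receive a contribution from [B]; [u] is included so that its local identity,
   the only nonzero one, occurs in the sum. *)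
pose B' := undup (u :: flatten [seq corners k | k <- iota 0 n.+1]).
have uB' : uniq B' by exact: undup_uniq.
have BB' k (c : X k) b : vx c (zerov k) \in B -> vx c b \in B'.
  move=> cB; rewrite mem_undup in_cons; apply/orP; right.
  apply/flattenP; exists (corners k).
    by apply/mapP; exists k; rewrite // mem_iota /= ltnS; exact: dim_le eulerian _ (proj c).
  apply/flattenP; exists [seq vx c b | b <- enum {ffun 'I_k -> bool}].
    by apply/mapP; exists c; rewrite // mem_cubes_from.
  by apply/mapP; exists b; rewrite // mem_enum.
have -> : \sum_(y <- cellsK 0%N) (\sum_(v <- B | proj v == y) monomial v) *
            vertex_poly n cellsK labK y z =
    \sum_(v <- B) monomial v * vertex_poly n cellsK labK (proj v) z.
  under eq_bigr => y _ do rewrite mulr_suml big_mkcond.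
  rewrite exchange_big /=; apply: eq_bigr => v _.
  rewrite (bigD1_seq (proj v)) /=; [|exact: cells_all|exact: cells_uniq].
  rewrite big1 => [|y yv]; last by case: eqP => // vy; case/eqP: yv.
  by rewrite addr0; case: eqP.
have -> : \sum_(v <- B) monomial v * vertex_poly n cellsK labK (proj v) z =
    \sum_(k < n.+1) (k`!%:R^-1 : rat) *: \sum_(w <- B' | proj w == z) \sum_(c <- cubes_at k w)
      \sum_(b : {ffun 'I_k -> bool} | vx c b \in B) monomial (vx c b) * cube_weight n (dir_lab lab c) b.
  under eq_bigr => v _ do rewrite vertex_poly_proj mulr_sumr.
  rewrite exchange_big /=; apply: eq_bigr => k _.
  rewrite -exchange_corners //; last by move=> c b; exact: BB'.
  rewrite scaler_sumr; apply: eq_bigr => v _; rewrite -scalerAr; congr (_ *: _).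
  by rewrite mulr_sumr; apply: eq_bigr => c _; rewrite mulr_sumr.
have -> : (if z == proj u then common_denominator N n else 0) =
    \sum_(k < n.+1) (k`!%:R^-1 : rat) *: \sum_(w <- B' | proj w == z) \sum_(c <- cubes_at k w)
      \sum_(b : {ffun 'I_k -> bool}) monomial (vx c b) * cube_weight n (dir_lab lab c) b.
  under [RHS]eq_bigr => k _ do rewrite scaler_sumr.
  rewrite [RHS]exchange_big /=.
  rewrite [RHS](eq_bigr (fun w => if w == u then common_denominator N n else 0)); last first.
    move=> w _; apply: (@local_identity X simplicial flag N lab parallel connected _ u n w (fun k => cubes_at k w)).
    - move=> u0 p q v s; exact: (simply_connected_transport contractible).
    - by move=> k nk c; have := dim_le eulerian (proj c); rewrite leqNgt nk.
    - by move=> k; exact: cubes_at_uniq.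
    - by move=> k c; exact: mem_cubes_at.
  have uu : u \in B' by rewrite mem_undup mem_head.
  rewrite big_mkcond (bigD1_seq u) //= eqxx big1 ?addr0; first by rewrite eq_sym.
  by move=> w /negPf ->; case: ifP.
move=> m mD; rewrite mcoeffB; apply/eqP; rewrite subr_eq0; apply/eqP.
rewrite !raddf_sum /=; apply: eq_bigr => k _; rewrite !mcoeffZ; congr (_ * _).
rewrite !raddf_sum /=; apply: eq_bigr => w _.
rewrite !raddf_sum /=; apply: eq_bigr => c _.
rewrite !raddf_sum /= [LHS]big_mkcond /=; apply: eq_bigr => b _.
(* The corners missing on the left are those outside [B], whose monomials vanish up to degree
   [D]. *)
rewrite BD; case: leqP => // Dv; apply/esym; move: m mD; apply: vanishes_toM => m mD.
by rewrite mcoeffX; case: eqP => // e; move: Dv; rewrite e ltnNge mD.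
Qed.

End Truncations.

(** * Reciprocity for the growth series of the compact quotient *)

(** Compactness yields finite lists of the cells of X/G, so that B is a finite matrix; the chosen
    lift of [x] is the base vertex, and the inverse of [hyp] labels the edges. *)
Theorem mainTheorem1 (R : realType) (G : groupType) (X : cubeComplex)
    (a : cellularAction G X)
    (afree : free_action R a)
    (acocompact :
       compact [set: realization R (quotient_complex afree)])
    (Xconnected : connected [set: realization R X])
    (XCAT0 : CAT0 R X)
    (n : nat) (XGeulerian : Eulerian n (quotient_complex afree))
    (* t_0, ..., t_(N-1): one indeterminate for each orbit of hyperplanes *)
    (N : nat) (hyp : 'I_N -> hyperplane_orbit a) (hyp_bij : bijective hyp)
    (x y : quotient_complex afree 0%N) :
  exists F : rational_functions N,
    expands_to F (growth_series hyp x y) /\ subst_inv F = (-1) ^+ n * F.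
Proof.
have [contractible links] := XCAT0.
have simplicial v := (links v).1; have flag v := (links v).2.
have cellsP k : exists s : seq (quotient_complex afree k), uniq s /\ forall c, c \in s.
  have [s sP] := cells_finite acocompact k.
  by exists (undup s); rewrite undup_uniq; split=> // c; rewrite mem_undup.
pose cellsK k := projT1 (cid (cellsP k)).
have cells_uniq k : uniq (cellsK k) := (projT2 (cid (cellsP k))).1.
have cells_all k c : c \in cellsK k := (projT2 (cid (cellsP k))).2 c.
have [inv hypK invK] := hyp_bij.
have hyp_inj := can_inj hypK.
pose lab e := inv (hyperplane_orbit_of a (hyperplane_of e)).
have labE e : hyp (lab e) = hyperplane_orbit_of a (hyperplane_of e) by exact: invK.
rewrite -(proj_repr x); set u := repr x.
apply: (series_reciprocity XGeulerian cells_uniq cells_all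
  (orbit_lab_parallel (afree := afree) hyp_inj labE) (g := growth_series hyp (orbit_cube afree u))).
exact: truncations.
Qed.
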